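(* The $*$-weakly compact set $\mathcal{S}_{\mathbb{I}_\mathbb{Z}}(\mathfrak{M})$ of spreading invariant states on the monotone $C^*$-algebra $\mathfrak{M}$ is $$\mathcal{S}_{\mathbb{I}_\mathbb{Z}}(\mathfrak{M})=\{(1-x)\omega_\infty+x\omega\mid x\in[0,1]\},$$ where $\omega$ is the vacuum state and $\omega_\infty$ is the state at infinity.
   Context: For $k\ge 1$ let $I_k=\{(i_1,\dots,i_k)\mid i_1<\cdots<i_k,\ i_j\in\mathbb{Z}\}$. The discrete monotone Fock space is $\mathcal{F}_m=\bigoplus_{k=0}^\infty\mathcal{H}_k$ with $\mathcal{H}_0=\mathbb{C}\Omega$ and $\mathcal{H}_k=\ell^2(I_k)$ for $k\ge1$, with canonical orthonormal basis $e_{(i_1,\dots,i_k)}$, $e_\emptyset=\Omega$. For $i\in\mathbb{Z}$ the monotone creator and annihilator are the mutually adjoint bounded operators $$a_i^\dagger e_{(i_1,\dots,i_k)}=\begin{cases}e_{(i,i_1,\dots,i_k)}&\text{if } i<i_1,\\0&\text{otherwise,}\end{cases}\qquad a_i e_{(i_1,\dots,i_k)}=\begin{cases}e_{(i_2,\dots,i_k)}&\text{if } k\ge1,\ i=i_1,\\0&\text{otherwise,}\end{cases}$$ with $a_i^\dagger\Omega=e_{(i)}$. $\mathfrak{M}_o\subset\mathcal{B}(\mathcal{F}_m)$ is the unital $*$-algebra generated by $\{a_i\}_{i\in\mathbb{Z}}$, and $\mathfrak{M}$ is its norm closure (a unital $C^*$-algebra). A state is a positive normalised linear functional. A Hamel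 basis $\{X_\lambda\}$ of $\mathfrak{M}_o$ is indexed by all pairs $\lambda=(\lambda_1,\lambda_2)$ of finite (possibly empty) subsets of $\mathbb{Z}$: $X_{(\emptyset,\emptyset)}=I$; $X_{(\{i\},\{i\})}=a_ia_i^\dagger$; and for any other $\lambda=(\{i_1<\cdots<i_m\},\{j_n<\cdots<j_1\})$, $X_\lambda=a_{i_1}^\dagger\cdots a_{i_m}^\dagger a_{j_1}\cdots a_{j_n}$. A strictly increasing map $f:\mathbb{Z}\to\mathbb{Z}$ acts on indices by $f(\lambda)=(f(\lambda_1),f(\lambda_2))$. For $h\in\mathbb{Z}$ the partial shifts are $\theta_h(k)=k$ if $k<h$, $\theta_h(k)=k+1$ if $k\ge h$; and $\psi_h(k)=k$ if $k>h$, $\psi_h(k)=k-1$ if $k\le h$. $\mathbb{I}_\mathbb{Z}$ is the monoid, under composition, generated by all $\theta_h,\psi_h$, $h\in\mathbb{Z}$. The monoid $\mathbb{I}_\mathbb{Z}$ acts on the whole $C^*$-algebra $\mathfrak{M}$ by $*$-endomorphisms $g\mapsto\Gamma_g$, as follows. On the Hamel basis put $\beta^o_k(X_\lambda)=X_{\theta_k(\lambda)}$ and $\gamma^o_k(X_\lambda)=X_{\psi_k(\lambda)}$, $k\in\mathbb{Z}$, extended by linearity to $\mathfrak{M}_o$. The maps $\beta^o_0,\gamma^o_0$ are $*$-endomorphisms of $\mathfrak{M}_o$ and extend to $*$-endomorphisms $\beta_0,\gamma_0$ of $\mathfrak{M}$. With $U$ the unitary on $\mathcal{F}_m$ given by $Ue_{(i_1,\dots,i_k)}=e_{(i_1+1,\dots,i_k+1)}$,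 $U\Omega=\Omega$, and $\mathrm{ad}(U^k)(X)=U^kXU^{-k}$, one sets $\beta_k=\mathrm{ad}(U^k)\circ\beta_0\circ\mathrm{ad}(U^{-k})$ and $\gamma_k=\mathrm{ad}(U^k)\circ\gamma_0\circ\mathrm{ad}(U^{-k})$, which extend $\beta^o_k$ and $\gamma^o_k$ to $\mathfrak{M}$; the action is determined on the generators by $\Gamma_{\theta_k}=\beta_k$, $\Gamma_{\psi_k}=\gamma_k$. A state $\varphi$ on $\mathfrak{M}$ is spreading invariant if $\varphi\circ\Gamma_g=\varphi$ on $\mathfrak{M}$ for each $g\in\mathbb{I}_\mathbb{Z}$; $\mathcal{S}_{\mathbb{I}_\mathbb{Z}}(\mathfrak{M})$ is the set of such states. The vacuum state is $\omega(Y)=\langle Y\Omega,\Omega\rangle$. Let $\mathfrak{A}$ be the norm closure of the linear span of all words of positive length of the form $a_{i_1}^\dagger\cdots a_{i_m}^\dagger a_{j_1}\cdots a_{j_n}$ with $i_1<\cdots<i_m$, $j_1>\cdots>j_n$ ($m,n\ge0$, length $m+n$), or of the form $a_{i_1}^\dagger\cdots a_{i_m}^\dagger a_ka_k^\dagger a_{j_1}\cdots a_{j_n}$ with $i_1<\cdots<i_m<k>j_1>\cdots>j_n$ ($m,n\ge0$, length $m+2+n$). $\mathfrak{M}$ is the $C^*$-algebra obtained by adding the identity to $\mathfrak{A}$, so every element of $\mathfrak{M}$ is of the form $X+cI$ with $X\in\mathfrak{A}$, $c\in\mathbb{C}$, and the state at infinity is $\omega_\infty(X+cI)=c$.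
   Formalization: β_0 and γ_0 are the bounded linear extensions of X_λ ↦ X_{θ_0(λ)} and X_λ ↦ X_{ψ_0(λ)}, not *-endomorphisms: no multiplicative map has these values, since a_{-1}a_{-1}† = a_0†a_0 + a_0a_0† would not be preserved. *)

(* Defs.v *)
From HB Require Import structures.
From mathcomp Require Import all_boot all_order all_algebra.
From mathcomp Require Import finmap complex ring lra.
From mathcomp Require Import all_classical all_reals all_analysis.

Set Implicit Arguments.
Unset Strict Implicit.
Unset Printing Implicit Defensive.

Import Order.TTheory GRing.Theory Num.Theory.
Import numFieldNormedType.Exports.

Local Open Scope classical_set_scope.
Local Open Scope ring_scope.
Local Open Scope complex_scope.

Lemma esum_le_fin (R : realType) (T : choiceType) (f : T -> R) (c : R) :
  (forall F : {fset T}, \sum_(t <- F) f t <= c) ->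
  (\esum_(t in setT) (f t)%:E <= c%:E)%E.
Proof.
move=> H; apply: ge_ereal_sup => _ [F [finF _] <-].
by rewrite fsbig_finite// sumEFin lee_fin.
Qed.

Lemma fin_le_esum (R : realType) (T : choiceType) (f : T -> R) (F : {fset T}) :
  ((\sum_(t <- F) f t)%:E <= \esum_(t in setT) (f t)%:E)%E.
Proof.
apply: ereal_sup_ubound; exists [set` F] => //.
by rewrite fsbig_finite// set_fsetK sumEFin.
Qed.

(* reindexing a sum along a pair of mutually inverse partial injections *)
Lemma esum_pinj (R : realType) (T : choiceType) (p q : T -> option T)
    (h : T -> T -> \bar R) :
  (forall s t, (p s == Some t) = (q t == Some s)) ->
  \esum_(s in setT) (if p s is Some t then h s t else 0%E)
  = \esum_(t in setT) (if q t is Some s then h s t else 0%E).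
Proof.
move=> pq.
have pqE s t : p s = Some t -> q t = Some s by move=> /eqP; rewrite pq => /eqP.
have qpE s t : q t = Some s -> p s = Some t by move=> /eqP; rewrite -pq => /eqP.
pose P := [set s | p s]; pose Q := [set t | q t].
transitivity (\esum_(s in P) (if p s is Some t then h s t else 0%E)).
  rewrite [RHS]esum_mkcond; apply: eq_esum => s _.
  by rewrite /P; case: ifPn => // /negP; rewrite inE /=; case: (p s).
transitivity (\esum_(t in Q) (if q t is Some s then h s t else 0%E)); last first.
  rewrite [LHS]esum_mkcond; apply: eq_esum => s _.
  by rewrite /Q; case: ifPn => // /negP; rewrite inE /=; case: (q s).
rewrite (@reindex_esum _ _ _ Q P (fun t => odflt t (q t))).
  apply: eq_esum => t; rewrite /Q /=; case E: (q t) => [s|]//= _.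
  by rewrite (qpE _ _ E).
split.
- by move=> t; rewrite /Q /P /=; case E: (q t) => [s|]//= _; rewrite (qpE _ _ E).
- move=> t t'; rewrite !inE /Q /=.
  case E: (q t) => [s|]//= _; case E': (q t') => [s'|]//= _ ss'.
  by move: (qpE _ _ E) (qpE _ _ E'); rewrite ss' => -> [].
- move=> s; rewrite /P /=; case E: (p s) => [t|]//= _; exists t.
    by rewrite /Q /= (pqE _ _ E).
  by rewrite (pqE _ _ E).
Qed.

Section ell2.
Variables (R : realType) (T : choiceType).
Local Notation C := R[i].

Definition modsq (z : C) : R := complex.Re z ^+ 2 + complex.Im z ^+ 2.

Lemma modsq_ge0 z : 0 <= modsq z.
Proof. by rewrite addr_ge0 ?sqr_ge0. Qed.

Lemma modsqM z w : modsq (z * w) = modsq z * modsq w.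
Proof. by case: z w => [a b] [c d]; rewrite /modsq /=; ring. Qed.

Lemma modsq0 : modsq 0 = 0.
Proof. by rewrite /modsq /= expr0n/= addr0. Qed.

Lemma modsqD (z w : C) (a b : R) : 0 < a -> 0 < b ->
  modsq (z + w) <= (a + b) * (modsq z / a + modsq w / b).
Proof.
move=> a0 b0; case: z w => [x y] [x' y']; rewrite /modsq /= -subr_ge0.
have -> : (a + b) * ((x ^+ 2 + y ^+ 2) / a + (x' ^+ 2 + y' ^+ 2) / b) -
    ((x + x') ^+ 2 + (y + y') ^+ 2)
    = ((b * x - a * x') ^+ 2 + (b * y - a * y') ^+ 2) / (a * b).
  by field; rewrite ?gt_eqF.
by rewrite divr_ge0 ?addr_ge0 ?sqr_ge0// mulr_ge0 ?ltW.
Qed.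

Definition sqsum (v : T -> C) : \bar R := \esum_(t in setT) (modsq (v t))%:E.

Definition square_summable : {pred T -> C} := fun v => (sqsum v < +oo)%E.

Lemma sqsum_ge0 v : (0 <= sqsum v)%E.
Proof. by apply: esum_ge0 => t _; rewrite lee_fin modsq_ge0. Qed.

Lemma sqsum_finP v (c : R) : (sqsum v <= c%:E)%E -> v \in square_summable.
Proof. by move=> vc; rewrite unfold_in (le_lt_trans vc)// ltry. Qed.

Lemma sqsumD u v (a b : R) : 0 < a -> 0 < b ->
  (sqsum u <= (a ^+ 2)%:E)%E -> (sqsum v <= (b ^+ 2)%:E)%E ->
  (sqsum (u + v)%R <= ((a + b) ^+ 2)%:E)%E.
Proof.
move=> a0 b0 ua vb; apply: esum_le_fin => F.
have uF : \sum_(t <- F) modsq (u t) <= a ^+ 2.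
  by rewrite -lee_fin; apply: le_trans ua; exact: fin_le_esum.
have vF : \sum_(t <- F) modsq (v t) <= b ^+ 2.
  by rewrite -lee_fin; apply: le_trans vb; exact: fin_le_esum.
apply: (@le_trans _ _
    (\sum_(t <- F) (a + b) * (modsq (u t) / a + modsq (v t) / b))).
  by apply: ler_sum => t _; exact: modsqD.
rewrite -mulr_sumr big_split/= -!mulr_suml expr2.
have ab : 0 <= a + b by rewrite ltW// addr_gt0.
rewrite ler_wpM2l// lerD//.
  by rewrite ler_pdivrMr// -expr2.
by rewrite ler_pdivrMr// -expr2.
Qed.

Lemma sqsumZ_le (k : C) v (c : R) : (sqsum v <= c%:E)%E ->
  (sqsum (k *: v)%R <= (modsq k * c)%:E)%E.
Proof.
move=> vc; apply: esum_le_fin => F.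
under eq_bigr do rewrite modsqM.
rewrite -mulr_sumr ler_wpM2l ?modsq_ge0//.
by rewrite -lee_fin; apply: le_trans vc; exact: fin_le_esum.
Qed.

Lemma sqsum_bound v : v \in square_summable ->
  exists2 a : R, 0 < a & (sqsum v <= (a ^+ 2)%:E)%E.
Proof.
rewrite unfold_in => vfin; exists (1 + fine (sqsum v)).
  by rewrite ltr_pwDl// fine_ge0// sqsum_ge0.
have f0 : 0 <= fine (sqsum v) by rewrite fine_ge0// sqsum_ge0.
have -> : sqsum v = (fine (sqsum v))%:E.
  by rewrite fineK// ge0_fin_numE// sqsum_ge0.
rewrite lee_fin/=; nra.
Qed.

Lemma square_summable_submod : submod_closed square_summable.
Proof.
split.
  apply: (@sqsum_finP _ 0); apply: esum_le_fin => F.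
  by rewrite big1// => t _; rewrite modsq0.
move=> k u v /sqsum_bound [a a0 ua] /sqsum_bound [b b0 vb].
have [c c0 kuc] : exists2 c : R, 0 < c & (sqsum (k *: u)%R <= (c ^+ 2)%:E)%E.
  apply: sqsum_bound; apply: sqsum_finP; exact: (sqsumZ_le _ ua).
exact: (sqsum_finP (sqsumD c0 b0 kuc vb)).
Qed.

HB.instance Definition _ :=
  GRing.isSubmodClosed.Build C (T -> C) square_summable square_summable_submod.

Record ell2 := Ell2 { ell2val :> T -> C; _ : ell2val \in square_summable }.

HB.instance Definition _ := [isSub for ell2val].
HB.instance Definition _ := [Choice of ell2 by <:].
HB.instance Definition _ := [SubChoice_isSubLmodule of ell2 by <:].

(* sum of an absolutely summable family of reals / of complex numbers *)
Definition rsum (f : T -> R) : R :=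
  fine (\esum_(t in setT) ((EFin \o f)^\+ t) -
        \esum_(t in setT) ((EFin \o f)^\- t))%E.

Definition csum (f : T -> C) : C :=
  rsum (fun t => complex.Re (f t)) +i* rsum (fun t => complex.Im (f t)).

Definition inner (u v : ell2) : C := csum (fun t => u t * (v t)^*).

Definition l2norm (v : ell2) : R := Num.sqrt (fine (sqsum v)).

Lemma sqsumE (v : ell2) : sqsum v = (l2norm v ^+ 2)%:E.
Proof.
rewrite sqr_sqrtr ?fineK//; last by rewrite fine_ge0// sqsum_ge0.
by rewrite ge0_fin_numE ?sqsum_ge0//; exact: (valP v).
Qed.

Lemma l2norm_ge0 v : 0 <= l2norm v. Proof. exact: sqrtr_ge0. Qed.

Lemma l2norm_le (v : ell2) (a : R) : 0 <= a ->
  (l2norm v <= a) = (sqsum v <= (a ^+ 2)%:E)%E.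
Proof. by move=> a0; rewrite sqsumE lee_fin ler_sqr// nnegrE ?l2norm_ge0. Qed.

Lemma l2norm_triangle (u v : ell2) : l2norm (u + v) <= l2norm u + l2norm v.
Proof.
apply/ler_addgt0Pl => e e0.
have a0 : 0 < l2norm u + e / 2 by rewrite ltr_wpDl ?l2norm_ge0// divr_gt0.
have b0 : 0 < l2norm v + e / 2 by rewrite ltr_wpDl ?l2norm_ge0// divr_gt0.
have -> : e + (l2norm u + l2norm v) = (l2norm u + e / 2) + (l2norm v + e / 2).
  by field.
rewrite l2norm_le; last by rewrite addr_ge0// ltW.
apply: sqsumD => //; rewrite -l2norm_le; try exact: ltW;
  by rewrite lerDl divr_ge0// ltW.
Qed.

Lemma l2normZ_le (k : C) (u : ell2) :
  l2norm (k *: u) <= Num.sqrt (modsq k) * l2norm u.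
Proof.
rewrite l2norm_le ?mulr_ge0 ?sqrtr_ge0 ?l2norm_ge0//.
rewrite exprMn sqr_sqrtr ?modsq_ge0//; apply: sqsumZ_le.
by rewrite sqsumE.
Qed.

Lemma l2norm0 : l2norm 0 = 0.
Proof.
apply/eqP; rewrite eq_le l2norm_ge0 andbT.
have := l2normZ_le 0 0.
by rewrite scale0r modsq0 sqrtr0 mul0r.
Qed.

Lemma l2norm_eq0 (v : ell2) : l2norm v = 0 -> v = 0.
Proof.
move=> v0; apply/val_inj/funext => t /=.
have : (sqsum v <= 0%:E)%E by rewrite sqsumE v0 expr0n.
move=> /(le_trans (@fin_le_esum R T (fun t => modsq (v t)) [fset t]%fset)).
rewrite lee_fin big_seq_fset1 /modsq => h.
have hr : complex.Re (v t) ^+ 2 = 0.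
  apply/eqP; rewrite eq_le sqr_ge0 andbT (le_trans _ h)// lerDl sqr_ge0//.
have hi : complex.Im (v t) ^+ 2 = 0.
  apply/eqP; rewrite eq_le sqr_ge0 andbT (le_trans _ h)// lerDr sqr_ge0//.
move: hr hi => /eqP; rewrite sqrf_eq0 => /eqP hr /eqP.
rewrite sqrf_eq0 => /eqP hi.
by rewrite -[LHS]/(ell2val v t); case: (ell2val v t) hr hi => a b /= -> ->.
Qed.

Lemma delta_subproof (t : T) :
  (fun s => (s == t)%:R : C) \in square_summable.
Proof.
apply: (@sqsum_finP _ 1); rewrite /sqsum.
rewrite (esumID [set t]); last by move=> s _; rewrite lee_fin modsq_ge0.
rewrite setTI setTI esum_set1 ?lee_fin ?modsq_ge0//.
rewrite [X in (_ + X)%E]esum1 ?adde0.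
  by rewrite eqxx /modsq /= lee_fin; lra.
by move=> s /= /eqP/negPf ->; rewrite modsq0.
Qed.

Definition delta (t : T) : ell2 := Ell2 (delta_subproof t).

End ell2.

Arguments square_summable {R T}.

Section pshift.
Variables (R : realType) (T : choiceType) (p q : T -> option T).
Hypothesis pq : forall s t, (p s == Some t) = (q t == Some s).
Local Notation C := R[i].

Definition pull (v : T -> C) : T -> C :=
  fun s => if p s is Some t then v t else 0.

Lemma sqsum_pull v : (sqsum (pull v) <= sqsum v)%E.
Proof.
rewrite /sqsum /pull.
under eq_esum => s _.
  rewrite (_ : (_)%:E = if p s is Some t then (modsq (v t))%:E else 0%E).
    over.
  by case: (p s) => // ; rewrite modsq0.
rewrite (esum_pinj (fun _ t => (modsq (v t))%:E) pq).
apply: le_esum => t _; case: (q t) => //.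
by rewrite lee_fin modsq_ge0.
Qed.

Lemma pull_subproof (v : ell2 R T) : pull v \in square_summable.
Proof.
by rewrite unfold_in; apply: le_lt_trans (sqsum_pull v) _; exact: (valP v).
Qed.

Definition pull_ell2 (v : ell2 R T) : ell2 R T := Ell2 (pull_subproof v).

Lemma pull_linear : linear pull_ell2.
Proof.
move=> a u v; apply/val_inj/funext => s /=.
by rewrite /pull !fctE /=; case: (p s) => //; rewrite scaler0 addr0.
Qed.

Lemma l2norm_pull v : l2norm (pull_ell2 v) <= l2norm v.
Proof. by rewrite l2norm_le ?l2norm_ge0// -sqsumE; exact: sqsum_pull. Qed.

End pshift.

Lemma rsum_pinj (R : realType) (T : choiceType) (p q : T -> option T)
    (pq : forall s t, (p s == Some t) = (q t == Some s)) (h : T -> T -> R) :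
  rsum (fun s => if p s is Some t then h s t else 0)
  = rsum (fun t => if q t is Some s then h s t else 0).
Proof.
rewrite /rsum; congr (fine (_ - _)%E).
  transitivity (\esum_(s in [set: T])
      (if p s is Some t then Order.max (h s t)%:E 0%E else 0%E)).
    apply: eq_esum => s _; rewrite funeposE /=; case: (p s) => //.
    by rewrite maxxx.
  rewrite (esum_pinj (fun s t => Order.max (h s t)%:E 0%E) pq).
  apply: eq_esum => s _; rewrite funeposE /=; case: (q s) => //.
  by rewrite maxxx.
transitivity (\esum_(s in [set: T])
    (if p s is Some t then Order.max (- (h s t)%:E)%E 0%E else 0%E)).
  apply: eq_esum => s _; rewrite funenegE /=; case: (p s) => //.
  by rewrite oppr0 maxxx.
rewrite (esum_pinj (fun s t => Order.max (- (h s t)%:E)%E 0%E) pq).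
apply: eq_esum => s _; rewrite funenegE /=; case: (q s) => //.
by rewrite oppr0 maxxx.
Qed.

Lemma inner_pull (R : realType) (T : choiceType) (p q : T -> option T)
    (pq : forall s t, (p s == Some t) = (q t == Some s))
    (qp : forall s t, (q s == Some t) = (p t == Some s)) (u v : ell2 R T) :
  inner (pull_ell2 pq u) v = inner u (pull_ell2 qp v).
Proof.
rewrite /inner /csum /=; congr (_ +i* _).
  have := rsum_pinj pq (fun s t => complex.Re (u t * (v s)^*)).
  congr (_ = _); congr rsum; apply/funext => s; rewrite /pull.
    by case: (p s) => //; rewrite mul0r.
  by case: (q s) => //; rewrite rmorph0 mulr0.
have := rsum_pinj pq (fun s t => complex.Im (u t * (v s)^*)).
congr (_ = _); congr rsum; apply/funext => s; rewrite /pull.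
  by case: (p s) => //; rewrite mul0r.
by case: (q s) => //; rewrite rmorph0 mulr0.
Qed.

(* (i_1, ..., i_k) with i_1 < ... < i_k; the empty sequence indexes Omega *)
Definition incseq := {s : seq int | sorted <%R s}.

Section operators.
Variable R : realType.
Local Notation C := R[i].

Definition fock := ell2 R incseq.

HB.instance Definition _ := GRing.Lmodule.on fock.

Definition bounded_linear : {pred fock -> fock} := fun f =>
  `[< linear f /\ exists c : R, forall v, l2norm (f v) <= c * l2norm v >].

Lemma bounded_linear_submod : submod_closed bounded_linear.
Proof.
split.
  apply/asboolP; split.
    by move=> a u v; rewrite -[LHS]/(0 : fock) -[RHS]/(a *: (0 : fock) + 0) scaler0 addr0.
  by exists 0 => v; rewrite -[(0 : fock -> fock) v]/(0 : fock) l2norm0 mul0r.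
move=> a f g /asboolP[fl [c fc]] /asboolP[gl [d gd]].
apply/asboolP; split.
  move=> k u v; rewrite !fctE fl gl !scalerDr !scalerA.
  by rewrite (mulrC k a) !addrA; congr (_ + _); rewrite addrAC.
exists (Num.sqrt (modsq a) * c + d) => v.
rewrite mulrDl (le_trans (l2norm_triangle _ _))// lerD//.
by rewrite (le_trans (l2normZ_le _ _))// -mulrA ler_wpM2l ?sqrtr_ge0.
Qed.

HB.instance Definition _ :=
  GRing.isSubmodClosed.Build C (fock -> fock) bounded_linear
    bounded_linear_submod.

(* the bounded operators on the Fock space *)
Record bop := Bop { bopval :> fock -> fock; _ : bopval \in bounded_linear }.

HB.instance Definition _ := [isSub for bopval].
HB.instance Definition _ := [Choice of bop by <:].
HB.instance Definition _ := [SubChoice_isSubLmodule of bop by <:].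

Lemma bop_linear (X : bop) : linear X.
Proof. by case: X => f /= /asboolP[]. Qed.

HB.instance Definition _ (X : bop) :=
  GRing.isLinear.Build C fock fock _ X (bop_linear X).

Lemma bop_bounded (X : bop) :
  exists2 c : R, 0 <= c & forall v, l2norm (X v) <= c * l2norm v.
Proof.
case: X => f /= /asboolP[_ [c fc]]; exists `|c| => // v.
by rewrite (le_trans (fc v))// ler_wpM2r ?l2norm_ge0// ler_norm.
Qed.

Lemma one_subproof : (@id fock) \in bounded_linear.
Proof.
apply/asboolP; split; first by [].
by exists 1 => v; rewrite mul1r.
Qed.

Lemma mul_subproof (X Y : bop) : X \o Y \in bounded_linear.
Proof.
apply/asboolP; split; first by move=> a u v; rewrite /= !linearP.
have [c c0 Xc] := bop_bounded X; have [d d0 Yd] := bop_bounded Y.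
exists (c * d) => v /=.
by rewrite (le_trans (Xc _))// -mulrA ler_wpM2l.
Qed.

Definition bop1 : bop := Bop one_subproof.
Definition bopM (X Y : bop) : bop := Bop (mul_subproof X Y).

Lemma bopMA : associative bopM. Proof. by move=> X Y Z; exact/val_inj. Qed.
Lemma bop1M : left_id bop1 bopM. Proof. by move=> X; exact/val_inj. Qed.
Lemma bopM1 : right_id bop1 bopM. Proof. by move=> X; exact/val_inj. Qed.
Lemma bopMDl : left_distributive bopM +%R.
Proof. by move=> X Y Z; exact/val_inj. Qed.
Lemma bopMDr : right_distributive bopM +%R.
Proof.
by move=> X Y Z; apply/val_inj/funext => v /=; rewrite !fctE linearD.
Qed.

Definition basis (s : incseq) : fock := delta R s.

Definition vacuum : fock := basis (Sub [::] isT).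

Lemma basisE s t : basis s t = (t == s)%:R. Proof. by []. Qed.

Lemma basis_neq0 s : basis s != 0.
Proof.
apply/eqP => /(congr1 (fun v : fock => v s)); rewrite basisE eqxx => /eqP.
by rewrite oner_eq0.
Qed.

Lemma bop1_neq0 : bop1 != 0.
Proof.
apply/eqP => /(congr1 (fun X : bop => X vacuum)) /=.
by apply/eqP; exact: basis_neq0.
Qed.

HB.instance Definition _ := GRing.Zmodule_isNzRing.Build bop
  bopMA bop1M bopM1 bopMDl bopMDr bop1_neq0.

Lemma bop_scalerAl (a : C) (X Y : bop) : a *: (X * Y) = (a *: X) * Y.
Proof. exact/val_inj. Qed.

HB.instance Definition _ := GRing.Lmodule_isLalgebra.Build C bop bop_scalerAl.

Lemma bop_scalerAr (a : C) (X Y : bop) : a *: (X * Y) = X * (a *: Y).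
Proof.
by apply/val_inj/funext => v /=; rewrite !fctE linearZ.
Qed.

HB.instance Definition _ := GRing.Lalgebra_isAlgebra.Build C bop bop_scalerAr.

Definition opnorm (X : bop) : R :=
  sup [set l2norm (X v) | v in [set v | l2norm v <= 1]].

Lemma opnorm_has_ubound (X : bop) :
  has_ubound [set l2norm (X v) | v in [set v | l2norm v <= 1]].
Proof.
have [c c0 Xc] := bop_bounded X; exists c => _ [v /= v1 <-].
by rewrite (le_trans (Xc v))// -[leRHS]mulr1 ler_wpM2l.
Qed.

Lemma opnorm_ge0 X : 0 <= opnorm X.
Proof.
rewrite -(l2norm0 R incseq) -(linear0 X); apply: ub_le_sup.
  exact: opnorm_has_ubound.
by exists 0 => //=; rewrite l2norm0.
Qed.

Lemma opnormP (X : bop) (v : fock) : l2norm (X v) <= opnorm X * l2norm v.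
Proof.
have [v0|v0] := eqVneq (l2norm v) 0.
  by rewrite (l2norm_eq0 v0) linear0 l2norm0 mulr0.
have vp : 0 < l2norm v by rewrite lt_neqAle eq_sym v0 l2norm_ge0.
rewrite -ler_pdivrMr//.
have cE (r : R) : 0 <= r -> Num.sqrt (modsq r%:C) = r.
  by move=> r0; rewrite /modsq /= expr0n addr0 sqrtr_sqr ger0_norm.
pose w := ((l2norm v)^-1)%:C *: v.
have w1 : l2norm w <= 1.
  rewrite (le_trans (l2normZ_le _ _))// cE ?invr_ge0 ?l2norm_ge0//.
  by rewrite mulVf.
apply: (@le_trans _ _ (l2norm (X w))); last first.
  by apply: ub_le_sup; [exact: opnorm_has_ubound|exists w].
have vw : v = (l2norm v)%:C *: w.
  by rewrite scalerA -rmorphM /= divff// scale1r.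
rewrite ler_pdivrMr// {1}vw linearZ/= (le_trans (l2normZ_le _ _))//.
by rewrite cE ?l2norm_ge0// mulrC.
Qed.

Lemma opnorm_le (X : bop) (c : R) : 0 <= c ->
  (forall v, l2norm (X v) <= c * l2norm v) -> opnorm X <= c.
Proof.
move=> c0 Xc; apply: ge_sup.
  by exists (l2norm (X 0)), 0 => //=; rewrite l2norm0.
move=> _ [v /= v1 <-]; rewrite (le_trans (Xc v))//.
by rewrite -[leRHS]mulr1 ler_wpM2l.
Qed.

Lemma opnormD (X Y : bop) : opnorm (X + Y) <= opnorm X + opnorm Y.
Proof.
apply: opnorm_le => [|v]; first by rewrite addr_ge0 ?opnorm_ge0.
by rewrite mulrDl (le_trans (l2norm_triangle _ _))// lerD ?opnormP.
Qed.

Lemma opnormZ_le (k : C) (X : bop) :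
  opnorm (k *: X) <= Num.sqrt (modsq k) * opnorm X.
Proof.
apply: opnorm_le => [|v]; first by rewrite mulr_ge0 ?opnorm_ge0 ?sqrtr_ge0.
by rewrite (le_trans (l2normZ_le _ _))// -mulrA ler_wpM2l ?sqrtr_ge0 ?opnormP.
Qed.

Lemma opnormM (X Y : bop) : opnorm (X * Y) <= opnorm X * opnorm Y.
Proof.
apply: opnorm_le => [|v]; first by rewrite mulr_ge0 ?opnorm_ge0.
by rewrite (le_trans (opnormP X _))// -mulrA ler_wpM2l ?opnorm_ge0 ?opnormP.
Qed.

Definition norm_closure (A : set bop) : set bop :=
  [set X | forall e, 0 < e -> exists2 Y, A Y & opnorm (X - Y) < e].

Lemma norm_closure_sub A : A `<=` norm_closure A.
Proof.
move=> X AX e e0; exists X => //; rewrite subrr; apply: le_lt_trans e0.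
by apply: opnorm_le => // v; rewrite mul0r l2norm0.
Qed.

Definition is_adjoint (X Y : bop) : Prop :=
  forall u v : fock, inner (X u) v = inner u (Y v).

Definition unital_star_subalgebra (A : set bop) : Prop :=
  [/\ A 1,
      forall (k : C) X Y, A X -> A Y -> A (k *: X + Y),
      forall X Y, A X -> A Y -> A (X * Y) &
      forall X Y, is_adjoint X Y -> A X -> A Y].

(* Partial injections of the index set. cre_dom i s = Some t and ann_dom i t =
   Some s both say that s = (i, t_1, ..., t_k) with i < t_1. *)
Definition cre_dom (i : int) (s : incseq) : option incseq :=
  if ohead (val s) == Some i then insub (behead (val s)) else None.
Definition ann_dom (i : int) (s : incseq) : option incseq :=
  insub (i :: val s).

Lemma shift_idx_subproof (k : int) (s : incseq) :
  sorted <%R [seq j + k | j <- val s].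
Proof.
by rewrite sorted_map; apply: sub_sorted (valP s) => x y /= xy; rewrite ltrD2r.
Qed.

Definition shift_idx (k : int) (s : incseq) : incseq :=
  Sub [seq j + k | j <- val s] (shift_idx_subproof k s).

Lemma shift_idxK k : cancel (shift_idx (- k)) (shift_idx k).
Proof.
move=> s; apply/val_inj => /=; rewrite -map_comp -[RHS]map_id.
by apply: eq_map => j /=; rewrite subrK.
Qed.

Definition shift_dom (k : int) (s : incseq) : option incseq :=
  Some (shift_idx (- k) s).

Lemma cre_domE i s t : (cre_dom i s == Some t) = (val s == i :: val t).
Proof.
rewrite /cre_dom; case: s => -[|j s] /= hs; first by [].
rewrite eqseq_cons (inj_eq Some_inj); case: (eqVneq j i) => //= _.
case: insubP => [u _ us|].
  by rewrite -us.
by rewrite (path_sorted hs).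
Qed.

Lemma ann_domE i s t : (ann_dom i s == Some t) = (val t == i :: val s).
Proof.
rewrite /ann_dom; case: insubP => [u _ us|nus].
  rewrite -us; apply/eqP/eqP => [[->//]|/val_inj->//].
by apply/esym/eqP => ts; move: nus; rewrite -ts (valP t).
Qed.

Lemma cre_ann i s t : (cre_dom i s == Some t) = (ann_dom i t == Some s).
Proof. by rewrite cre_domE ann_domE. Qed.

Lemma ann_cre i s t : (ann_dom i s == Some t) = (cre_dom i t == Some s).
Proof. by rewrite cre_domE ann_domE. Qed.

Lemma shift_shift k s t :
  (shift_dom k s == Some t) = (shift_dom (- k) t == Some s).
Proof.
rewrite /shift_dom opprK !(inj_eq Some_inj); apply/eqP/eqP => <-.
  exact: shift_idxK.
by have := shift_idxK (- k); rewrite opprK; apply.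
Qed.

Lemma pull_bounded (p q : incseq -> option incseq)
    (pq : forall s t, (p s == Some t) = (q t == Some s)) :
  (pull_ell2 pq : fock -> fock) \in bounded_linear.
Proof.
apply/asboolP; split; first exact: pull_linear.
by exists 1 => v; rewrite mul1r l2norm_pull.
Qed.

Definition crea_op (i : int) : bop := Bop (pull_bounded (cre_ann i)).
Definition anni_op (i : int) : bop := Bop (pull_bounded (ann_cre i)).
(* U^k *)
Definition shift_op (k : int) : bop := Bop (pull_bounded (shift_shift k)).

Lemma pull_basis (p q : incseq -> option incseq)
    (pq : forall s t, (p s == Some t) = (q t == Some s)) t :
  Bop (pull_bounded pq) (basis t) = if q t is Some s then basis s else 0.
Proof.
apply/val_inj/funext => s /=; rewrite /pull.
have -> : (if p s is Some t' then basis t t' else 0) = (p s == Some t)%:R.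
  by case: (p s).
rewrite pq; case: (q t) => [s'|] //=.
by rewrite (inj_eq Some_inj) eq_sym.
Qed.

Lemma crea_basis i t : crea_op i (basis t) =
  if insub (i :: val t) is Some s then basis s else 0.
Proof. exact: pull_basis. Qed.

Lemma anni_basis i t : anni_op i (basis t) =
  if ohead (val t) == Some i then
    if insub (behead (val t)) is Some s then basis s else 0
  else 0.
Proof. by rewrite [LHS]pull_basis /cre_dom; case: ifP. Qed.

Lemma shift_basis k t : shift_op k (basis t) = basis (shift_idx k t).
Proof. by rewrite [LHS]pull_basis /shift_dom opprK. Qed.

Lemma shift_opE k v s : shift_op k v s = v (shift_idx (- k) s).
Proof. by []. Qed.

Lemma anni_crea_adjoint i : is_adjoint (anni_op i) (crea_op i).
Proof. by move=> u v; exact: inner_pull. Qed.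

Lemma shift_adjoint k : is_adjoint (shift_op k) (shift_op (- k)).
Proof.
move=> u v; rewrite [LHS](inner_pull _ (fun s t => esym (shift_shift k t s))).
congr inner; apply/val_inj/funext => s /=; rewrite /pull.
done.
Qed.

End operators.

Section monotone_algebra.
Variable R : realType.
Local Notation C := R[i].
Local Notation bop := (bop R).

(* the unital *-algebra generated by the annihilators *)
Definition Mo : set bop :=
  smallest (@unital_star_subalgebra R) (range (@anni_op R)).

Lemma Mo_star_subalgebra : unital_star_subalgebra Mo.
Proof.
split.
- by move=> A [[]].
- move=> k X Y MX MY A [hA gA]; case: (hA) => _ h _ _.
  by apply: h; [exact: MX|exact: MY].
- move=> X Y MX MY A [hA gA]; case: (hA) => _ _ h _.
  by apply: h; [exact: MX|exact: MY].
- move=> X Y XY MX A [hA gA]; case: (hA) => _ _ _ h.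
  by apply: (h X) => //; exact: MX.
Qed.

Lemma Mo_anni i : Mo (anni_op R i).
Proof. by move=> A [_]; apply; exists i. Qed.

Lemma Mo_crea i : Mo (crea_op R i).
Proof.
have [_ _ _ h] := Mo_star_subalgebra.
exact: h (@anni_crea_adjoint R i) (Mo_anni i).
Qed.

Definition mon_pred : {pred bop} := fun X => `[< norm_closure Mo X >].

Lemma mon_pred_subalg : subalg_closed mon_pred.
Proof.
have [M1 ML MM _] := Mo_star_subalgebra.
split.
- by apply/asboolP; exact: norm_closure_sub.
- move=> k X Y /asboolP hX /asboolP hY; apply/asboolP => e e0.
  have e2 : 0 < e / 2 by rewrite divr_gt0.
  pose d := Num.sqrt (modsq k) + 1.
  have d0 : 0 < d by rewrite ltr_wpDl ?sqrtr_ge0.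
  have [X' MX' XX'] := hX (e / 2 / d) (divr_gt0 e2 d0).
  have [Y' MY' YY'] := hY (e / 2) e2.
  exists (k *: X' + Y'); first exact: ML.
  have -> : k *: X + Y - (k *: X' + Y') = k *: (X - X') + (Y - Y').
    by rewrite scalerBr opprD addrACA.
  rewrite (le_lt_trans (opnormD _ _))//.
  have -> : e = e / 2 + e / 2 by field.
  rewrite ler_ltD// (le_trans (opnormZ_le _ _))//.
  rewrite (@le_trans _ _ (d * opnorm (X - X')))//.
    by rewrite ler_wpM2r ?opnorm_ge0// lerDl.
  by rewrite mulrC -ler_pdivlMr// ltW.
- move=> X Y /asboolP hX /asboolP hY; apply/asboolP => e e0.
  have e2 : 0 < e / 2 by rewrite divr_gt0.
  pose a := opnorm X + 1; pose b := opnorm Y + 1.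
  have a0 : 0 < a by rewrite ltr_wpDl ?opnorm_ge0.
  have b0 : 0 < b by rewrite ltr_wpDl ?opnorm_ge0.
  have [X' MX' XX'] := hX (e / 2 / b) (divr_gt0 e2 b0).
  pose m := Num.min 1 (e / 2 / a).
  have m0 : 0 < m by rewrite lt_min ltr01 !divr_gt0.
  have [Y' MY' YY'] := hY m m0.
  exists (X' * Y'); first exact: MM.
  have -> : X * Y - X' * Y' = X * (Y - Y') + (X - X') * Y'.
    by rewrite mulrBr mulrBl addrA subrK.
  rewrite (le_lt_trans (opnormD _ _))//.
  have -> : e = e / 2 + e / 2 by field.
  rewrite ler_ltD//.
    rewrite (le_trans (opnormM _ _))// (@le_trans _ _ (a * m))//.
      by rewrite ler_pM ?opnorm_ge0 ?lerDl// ltW.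
    by rewrite mulrC -ler_pdivlMr// ge_min lexx orbT.
  rewrite (le_lt_trans (opnormM _ _))//.
  have Yb : opnorm Y' <= b.
    have -> : Y' = Y + (-1) *: (Y - Y').
      by rewrite scaleN1r opprB addrC subrK.
    rewrite (le_trans (opnormD _ _))// lerD2l (le_trans (opnormZ_le _ _))//.
    rewrite /modsq /= sqrrN expr1n oppr0 expr0n addr0 sqrtr1 mul1r.
    by rewrite (le_trans (ltW YY'))// ge_min lexx.
  rewrite (@le_lt_trans _ _ (opnorm (X - X') * b))//.
    by rewrite ler_wpM2l ?opnorm_ge0.
  by rewrite -ltr_pdivlMr.
Qed.

HB.instance Definition _ :=
  GRing.isSubalgClosed.Build C bop mon_pred mon_pred_subalg.

(* the monotone C*-algebra *)
Record mon := Mon { monval :> bop; _ : monval \in mon_pred }.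

HB.instance Definition _ := [isSub for monval].
HB.instance Definition _ := [Choice of mon by <:].
HB.instance Definition _ := [SubChoice_isSubAlgebra of mon by <:].

Lemma Mo_mon X : Mo X -> X \in mon_pred.
Proof. by move=> MX; apply/asboolP; exact: norm_closure_sub. Qed.

Definition anni i : mon := Mon (Mo_mon (Mo_anni i)).
Definition crea i : mon := Mon (Mo_mon (Mo_crea i)).

Definition word (I J : seq int) : mon :=
  (\prod_(i <- I) crea i) * (\prod_(j <- J) anni j).

(* X_(l1,l2): I lists l1 increasingly and J lists l2 decreasingly *)
Definition hamel (I J : seq int) : mon :=
  match I, J with
  | [:: i], [:: j] => if i == j then anni i * crea i else word I J
  | _, _ => word I J
  end.

Definition theta (h k : int) : int := if k < h then k else k + 1.
Definition psi (h k : int) : int := if h < k then k else k - 1.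

(* G extends by linearity and continuity the map X_lambda |-> X_(f lambda);
   there is at most one such G, as the X_lambda span Mo *)
Definition bounded_extension (f : int -> int) (G : mon -> mon) : Prop :=
  [/\ linear G,
      exists c : R, forall X, opnorm (G X) <= c * opnorm X &
      forall I J, sorted <%R I -> sorted >%R J ->
        G (hamel I J) = hamel (map f I) (map f J)].

Definition beta0 : mon -> mon := xget (@id mon : mon -> mon) (bounded_extension (theta 0)).
Definition gamma0 : mon -> mon := xget (@id mon : mon -> mon) (bounded_extension (psi 0)).

Lemma shift_opK k : shift_op R (- k) * shift_op R k = 1.
Proof.
apply/val_inj/funext => v; apply/val_inj/funext => s.
by rewrite -[LHS]/(v (shift_idx (- k) (shift_idx (- - k) s)))
  shift_idxK.
Qed.

Lemma shift_anni k i :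
  shift_op R k * anni_op R i * shift_op R (- k) = anni_op R (i + k).
Proof.
apply/val_inj/funext => v; apply/val_inj/funext => s.
rewrite -[LHS]/(pull (ann_dom i) (shift_op R (- k) v) (shift_idx (- k) s)).
rewrite -[RHS]/(pull (ann_dom (i + k)) v s) /pull.
case E: (ann_dom (i + k) s) => [t|]; case E' : (ann_dom _ _) => [t'|] //.
- move/eqP: E; rewrite ann_domE => /eqP E.
  move/eqP: E'; rewrite ann_domE => /eqP E'.
  rewrite shift_opE opprK; congr (v _); apply/val_inj => /=.
  rewrite E' E /=; congr (_ :: _); rewrite -map_comp -[RHS]map_id.
  by apply: eq_map => j /=; rewrite subrK.
- move/eqP: E; rewrite ann_domE => /eqP E.
  suff : ann_dom i (shift_idx (- k) s) == Some (shift_idx (- k) t).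
    by rewrite E'.
  by rewrite ann_domE /= E /= addrK.
- move/eqP: E'; rewrite ann_domE => /eqP E'.
  suff : ann_dom (i + k) s == Some (shift_idx k t') by rewrite E.
  rewrite ann_domE /= E' /=; apply/eqP; congr (_ :: _).
  by rewrite -map_comp -[RHS]map_id; apply: eq_map => j /=; rewrite subrK.
Qed.

Lemma ad_subproof k (X : mon) :
  shift_op R k * X * shift_op R (- k) \in mon_pred.
Proof.
have UV : shift_op R (- k) * shift_op R k = 1 := shift_opK k.
have VU : shift_op R k * shift_op R (- k) = 1.
  by rewrite -[in LHS](opprK k) opprK -{1}(opprK k) shift_opK.
have adMo Y : Mo Y -> Mo (shift_op R k * Y * shift_op R (- k)).
  pose A := [set Y | Mo (shift_op R k * Y * shift_op R (- k))].
  have [M1 ML MM Madj] := Mo_star_subalgebra.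
  apply: (_ : Mo `<=` A); apply: smallest_sub.
    split.
    - by rewrite /A /= mulr1 VU.
    - move=> a Y1 Y2 h1 h2; rewrite /A /= mulrDr mulrDl -scalerAr -scalerAl.
      exact: ML.
    - move=> Y1 Y2 h1 h2; rewrite /A /=.
      have -> : shift_op R k * (Y1 * Y2) * shift_op R (- k) =
          (shift_op R k * Y1 * shift_op R (- k)) *
          (shift_op R k * Y2 * shift_op R (- k)).
        by rewrite -!mulrA (mulrA (shift_op R (- k))) UV mul1r.
      exact: MM.
    - move=> Y1 Y2 h12 h1; apply: (Madj _ _ _ h1) => u v /=.
      have adjV := @shift_adjoint R (- k); rewrite opprK in adjV.
      apply: (etrans (shift_adjoint _ _ _)).
      apply: (etrans (h12 _ _)).
      exact: adjV.
  move=> _ [i _ <-]; rewrite /A /=.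
  by rewrite shift_anni; exact: Mo_anni.
have [M1 ML MM Madj] := Mo_star_subalgebra.
apply/asboolP => e e0.
have c1 j (v : fock R) : l2norm (shift_op R j v) <= l2norm v.
  exact: l2norm_pull.
have /asboolP/(_ e e0)[Y MY XY] : monval X \in mon_pred := valP X.
exists (shift_op R k * Y * shift_op R (- k)); first exact: adMo.
apply: le_lt_trans XY; apply: opnorm_le => [|v]; first exact: opnorm_ge0.
rewrite -mulrBl -mulrBr (le_trans (c1 _ _))// (le_trans (opnormP _ _))//.
by rewrite ler_wpM2l ?opnorm_ge0.
Qed.

(* ad(U^k) *)
Definition ad (k : int) (X : mon) : mon := Mon (ad_subproof k X).

Definition beta (k : int) : mon -> mon := ad k \o beta0 \o ad (- k).
Definition gamma (k : int) : mon -> mon := ad k \o gamma0 \o ad (- k).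

(* action g G: g lies in the monoid generated by the partial shifts and G is
   the map Gamma_g of mon *)
Inductive action : (int -> int) -> (mon -> mon) -> Prop :=
| action_id : action id id
| action_theta k g G : action g G -> action (theta k \o g) (beta k \o G)
| action_psi k g G : action g G -> action (psi k \o g) (gamma k \o G).

Definition is_state (phi : mon -> C) : Prop :=
  [/\ scalar phi, phi 1 = 1 &
      forall X Xs : mon, is_adjoint X Xs -> 0 <= phi (Xs * X)].

Definition spreading_invariant (phi : mon -> C) : Prop :=
  forall g G, action g G -> phi \o G = phi.

Definition spreading_states : set (mon -> C) :=
  [set phi | is_state phi /\ spreading_invariant phi].

Definition omega (Y : mon) : C := inner (Y (vacuum R)) (vacuum R).

Definition linspan (A : set mon) : set mon :=
  smallest [set V | V 0 /\ forall (a : C) X Y, V X -> V Y -> V (a *: X + Y)] A.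

Definition words : set mon :=
  [set X | exists I J, [/\ sorted <%R I, sorted >%R J,
                          (0 < size I + size J)%N & X = word I J]] `|`
  [set X | exists I k J, [/\ sorted <%R (rcons I k), sorted >%R (k :: J) &
      X = (\prod_(i <- I) crea i) * (anni k * crea k) *
          (\prod_(j <- J) anni j)]].

Definition frakA : set mon :=
  [set X | forall e, 0 < e -> exists2 Y, linspan words Y & opnorm (X - Y) < e].

(* the c such that Z = X + c I with X in frakA *)
Definition omega_inf (Z : mon) : C :=
  xget 0 [set c | exists2 X, frakA X & Z = X + c%:A].

Lemma pull_pull (p q : incseq -> option incseq)
    (pq : forall s t, (p s == Some t) = (q t == Some s)) (v : incseq -> C) s :
  pull p (pull q v) s = if p s then v s else 0.
Proof.
rewrite /pull; case E: (p s) => [t|] //=.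
by have /eqP -> : q t == Some s by rewrite -pq E.
Qed.

Lemma anni_crea_pred i :
  anni (i - 1) * crea (i - 1) = crea i * anni i + anni i * crea i.
Proof.
apply/val_inj/val_inj/funext => v; apply/val_inj/funext => s.
rewrite -[LHS]/(pull (ann_dom (i - 1)) (pull (cre_dom (i - 1)) v) s).
rewrite -[RHS]/(pull (cre_dom i) (pull (ann_dom i) v) s +
                pull (ann_dom i) (pull (cre_dom i) v) s).
rewrite (pull_pull (cre_ann i)) !(pull_pull (ann_cre _)).
have annb j : ann_dom j s = sorted <%R (j :: val s) :> bool.
  by rewrite /ann_dom; case: insubP => [u ->|/negPf ->].
have creb : cre_dom i s = (ohead (val s) == Some i) :> bool.
  rewrite /cre_dom; case: ifP => // _; case: insubP => // /negP[].
  by case: s {annb} => -[|x s] //= /path_sorted.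
rewrite !annb creb; case: s {annb creb} => -[|x s] /= xs.
  by rewrite add0r.
rewrite !xs !andbT (inj_eq Some_inj) ltrBlDr ltzD1.
by case: ltgtP => _; rewrite ?addr0 ?add0r.
Qed.

(* This is why bounded_extension does not require G to be an endomorphism: by
   anni_crea_pred, no multiplicative linear map does X_lambda |->
   X_(theta_0 lambda). *)
Lemma no_multiplicative_extension : ~ exists G : mon -> mon,
  [/\ linear G, (forall X Y, G (X * Y) = G X * G Y) &
      forall I J, sorted <%R I -> sorted >%R J ->
        G (hamel I J) = hamel (map (theta 0) I) (map (theta 0) J)].
Proof.
move=> [G [Gl GM GX]].
have GD X Y : G (X + Y) = G X + G Y by have := Gl 1 X Y; rewrite !scale1r.
have h1 : hamel [::] [:: 0] = anni 0.
  by rewrite /hamel /word big_nil big_seq1 mul1r.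
have h2 : hamel [:: 0] [::] = crea 0.
  by rewrite /hamel /word big_nil big_seq1 mulr1.
have h3 : hamel [:: 1] [::] = crea 1.
  by rewrite /hamel /word big_nil big_seq1 mulr1.
have h4 : hamel [::] [:: 1] = anni 1.
  by rewrite /hamel /word big_nil big_seq1 mul1r.
have Ga : G (anni 0) = anni 1 by rewrite -h1 GX//= h4.
have Gc : G (crea 0) = crea 1 by rewrite -h2 GX//= h3.
have Gm : G (anni (0 - 1) * crea (0 - 1)) = anni (0 - 1) * crea (0 - 1).
  by have := GX [:: -1] [:: -1] isT isT.
have := Gm; rewrite {1}anni_crea_pred GD !GM Ga Gc -anni_crea_pred.
rewrite subrr => E.
pose s : incseq := Sub [:: 0] isT.
have : pull (ann_dom 0) (pull (cre_dom 0) (basis R s)) s =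
       pull (ann_dom (0 - 1)) (pull (cre_dom (0 - 1)) (basis R s)) s.
  exact: (congr1 (fun X : mon => X (basis R s) s) E).
rewrite !(pull_pull (ann_cre _)) basisE eqxx /ann_dom.
case: insubP => // _; case: insubP => [u _ _ /esym/eqP|] //.
by rewrite oner_eq0.
Qed.

End monotone_algebra.

(* Main.v *)
Require Import Defs.
From HB Require Import structures.
From mathcomp Require Import all_boot all_order all_algebra.
From mathcomp Require Import finmap complex ring lra zify.
From mathcomp Require Import all_classical all_reals all_analysis.
Import Order.TTheory GRing.Theory Num.Theory numFieldNormedType.Exports.
Local Open Scope classical_set_scope.
Local Open Scope ring_scope.
Local Open Scope complex_scope.

(** The spreading invariant states form the segment between the state at
    infinity and the vacuum state because invariance leaves a single free
    number.

    The linear span of the Hamel words is dense ([hamels_dense]), and a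
    state is bounded ([state_bounded]), so an invariant state is determined by
    its values on Hamel words. Consider a word [X] other than [1] and the
    [a_i a_i^+], and let [m] be its largest index. Partial shifts at [m],
    [m + 1], ... raise [m] and fix the other indices, so the state has the same
    value [w] on all the words [X_k] obtained by replacing [m] with [m + k]. But
    [X_0 + ... + X_(n-1)] has norm of order [sqrt n] at most: distinct creators
    have orthogonal ranges, and the [a_k^+ a_k] are orthogonal projections.
    Hence [n |w|] is at most of order [sqrt n], and [w = 0] ([average_vanish],
    [vanish_left], [vanish_right], [vanish_both]). On the projections
    [a_i a_i^+] the state is constant, with a value [x] in [[0, 1]]
    ([state_tailproj]). The vacuum state has [x = 1], the state at infinity has
    [x = 0], so the given state is their convex combination with weight [x]
    ([spreading_mixture]).

    Conversely, the values on Hamel words of such a combination do not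
    change when the indices are relabelled injectively, so it is invariant
    ([hamel_val_invariant]). The state at infinity is well defined and positive
    because it is the limit, as [n -> -oo], of the vector states at [e_n]
    ([frakA_lim], [mon_split], [omega_inf_state]). Compactness holds because the
    segment is a continuous image of [[0, 1]].

    Three facts behind this need work. First, for the span: operators with
    an extra cutoff, [a_I^+ (a_k a_k^+) a_J], are stable under left
    multiplication by generators and reduce to Hamel words through [a_(k-1)
    a_(k-1)^+ = a_k^+ a_k + a_k a_k^+] ([cutword_span], [Mo_hamels]). Second,
    for boundedness of states: elements have adjoints in the algebra
    ([adjoint_exists]), and [1 - T] has a square root in the algebra for [T]
    self-adjoint and small ([sqrt_one_sub]), which rests on completeness. Third,
    the relabelling of Hamel words by the partial shift at [0] must extend to a
    bounded linear map ([theta_extension]); otherwise the action would carry no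
    information. The basis sequences are cut at the entry [0], and the operator
    acts on the part before it, relabelled: this amplification [amp] is bounded
    and intertwines creators and annihilators with their relabelled versions. It
    differs from the desired map on the [a_i a_i^+] with [i >= 0] only;
    subtracting a functional times [a_0^+ a_0] repairs this ([shift_ext]). The
    other partial shifts are obtained by translation. *)

Set Implicit Arguments.
Unset Strict Implicit.
Unset Printing Implicit Defensive.

Local Notation basis := Defs.basis.

(** * Summable families and the inner product *)

Section summation.
Variables (R : realType) (T : choiceType).
Implicit Types (f g a b : T -> R) (u v w x y : ell2 R T).

Definition ssum a : R := fine (\esum_(t in setT) (a t)%:E).

Definition nnsum a :=
  (forall t, 0 <= a t) /\ (\esum_(t in setT) (a t)%:E < +oo)%E.

Definition dominated f g := (forall t, `|f t| <= g t) /\ nnsum g.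

Lemma ssumE a : nnsum a -> \esum_(t in setT) (a t)%:E = (ssum a)%:E.
Proof.
move=> [a0 aoo]; rewrite fineK// ge0_fin_numE//.
by apply: esum_ge0 => t _; rewrite lee_fin.
Qed.

Lemma ssum_ge0 a : (forall t, 0 <= a t) -> 0 <= ssum a.
Proof. by move=> a0; apply/fine_ge0/esum_ge0 => t _; rewrite lee_fin. Qed.

Lemma le_nnsum a b : (forall t, 0 <= a t) -> (forall t, a t <= b t) ->
  nnsum b -> nnsum a.
Proof.
move=> a0 ab [_ boo]; split=> //; apply: le_lt_trans boo.
by apply: le_esum => t _; rewrite lee_fin.
Qed.

Lemma le_ssum a b : (forall t, 0 <= a t) -> (forall t, a t <= b t) ->
  nnsum b -> ssum a <= ssum b.
Proof.
move=> a0 ab sb; rewrite -lee_fin -!ssumE//; last exact: le_nnsum sb.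
by apply: le_esum => t _; rewrite lee_fin.
Qed.

Lemma esum_EFinD a b : nnsum a -> nnsum b ->
  \esum_(t in setT) (a t + b t)%:E = (ssum a + ssum b)%:E.
Proof.
move=> sa sb; under eq_esum do rewrite EFinD.
rewrite esumD; last 2 first.
- by move=> t _; rewrite lee_fin (sa.1 t).
- by move=> t _; rewrite lee_fin (sb.1 t).
by rewrite !ssumE.
Qed.

Lemma nnsumD a b : nnsum a -> nnsum b -> nnsum (fun t => a t + b t).
Proof.
move=> sa sb; split; last by rewrite esum_EFinD ?ltry.
by move=> t; rewrite addr_ge0 ?(sa.1 t) ?(sb.1 t).
Qed.

Lemma ssumD a b : nnsum a -> nnsum b ->
  ssum (fun t => a t + b t) = ssum a + ssum b.
Proof. by move=> sa sb; rewrite /ssum esum_EFinD. Qed.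

Lemma le_esumZ (k : R) a : 0 <= k -> nnsum a ->
  (\esum_(t in setT) (k * a t)%:E <= (k * ssum a)%:E)%E.
Proof.
move=> k0 sa; apply: esum_le_fin => F; rewrite -mulr_sumr ler_wpM2l//.
by rewrite -lee_fin -(ssumE sa); exact: fin_le_esum.
Qed.

Lemma nnsumZ (k : R) a : 0 <= k -> nnsum a -> nnsum (fun t => k * a t).
Proof.
move=> k0 sa; split; first by move=> t; rewrite mulr_ge0// (sa.1 t).
by apply: le_lt_trans (le_esumZ k0 sa) _; rewrite ltry.
Qed.

Lemma ssumZ (k : R) a : 0 <= k -> nnsum a ->
  ssum (fun t => k * a t) = k * ssum a.
Proof.
move=> k0 sa; apply/eqP; rewrite eq_le; apply/andP; split.
  by rewrite -lee_fin -ssumE ?le_esumZ//; exact: nnsumZ.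
have [->|kn0] := eqVneq k 0; first by rewrite mul0r ssum_ge0// => t; rewrite mul0r.
have kp : 0 < k by rewrite lt_neqAle eq_sym kn0.
rewrite -ler_pdivlMl//.
have -> : ssum a = ssum (fun t => k^-1 * (k * a t)).
  by congr ssum; apply/funext => t; rewrite mulKf.
rewrite -lee_fin -ssumE; first by apply: le_esumZ; rewrite ?invr_ge0//; exact: nnsumZ.
by apply: nnsumZ; rewrite ?invr_ge0//; exact: nnsumZ.
Qed.

(** Any way of writing a family as a difference of two nonnegative summable ones
    computes its sum; this is what makes the sum additive although it is defined
    through positive and negative parts. *)
Lemma rsumE f a b : nnsum a -> nnsum b -> (forall t, f t = a t - b t) ->
  rsum f = ssum a - ssum b.
Proof.
move=> sa sb fE.
pose p t := Num.max (f t) 0; pose n t := Num.max (- f t) 0.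
have sp : nnsum p.
  apply: (le_nnsum _ _ sa) => t; first by rewrite le_max lexx orbT.
  by rewrite ge_max (sa.1 t) fE gerBl (sb.1 t).
have sn : nnsum n.
  apply: (le_nnsum _ _ sb) => t; first by rewrite le_max lexx orbT.
  by rewrite ge_max (sb.1 t) fE opprB gerBl (sa.1 t).
have -> : rsum f = ssum p - ssum n.
  rewrite /rsum.
  have -> : \esum_(t in [set: T]) ((EFin \o f)^\+ t)%E = (ssum p)%:E.
    by rewrite -ssumE//; apply: eq_esum => t _; rewrite funeposE /= /p EFin_max.
  have -> : \esum_(t in [set: T]) ((EFin \o f)^\- t)%E = (ssum n)%:E.
    by rewrite -ssumE//; apply: eq_esum => t _; rewrite funenegE /= /n EFin_max.
  by [].
have : ssum p + ssum b = ssum a + ssum n.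
  rewrite -!ssumD//; congr ssum; apply/funext => t; rewrite /p /n.
  have := fE t; have [h|h] := leP (f t) 0.
    by rewrite (max_idPl _) ?oppr_ge0//; lra.
  by rewrite (max_idPr _) ?oppr_le0 ?ltW//; lra.
lra.
Qed.

Lemma rsum_dominated f g : dominated f g ->
  nnsum (fun t => f t + g t) /\
  rsum f = ssum (fun t => f t + g t) - ssum g.
Proof.
move=> [fg sg].
have h : nnsum (fun t => f t + g t).
  apply: (le_nnsum _ _ (nnsumD sg sg)) => t.
    by have := fg t; rewrite ler_norml; lra.
  by have := fg t; rewrite ler_norml; lra.
by split => //; apply: rsumE => // t; rewrite addrK.
Qed.

Lemma rsumD f1 f2 g1 g2 : dominated f1 g1 -> dominated f2 g2 ->
  rsum (fun t => f1 t + f2 t) = rsum f1 + rsum f2.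
Proof.
move=> d1 d2; have [s1 ->] := rsum_dominated d1.
have [s2 ->] := rsum_dominated d2.
have [g1s g2s] := (d1.2, d2.2).
rewrite (rsumE (nnsumD s1 s2) (nnsumD g1s g2s)); last by move=> t /=; ring.
by rewrite (ssumD s1 s2) (ssumD g1s g2s); ring.
Qed.

Lemma rsumN f g : dominated f g -> rsum (fun t => - f t) = - rsum f.
Proof.
move=> d; have [s ->] := rsum_dominated d.
by rewrite (rsumE d.2 s) ?opprB// => t /=; ring.
Qed.

Lemma rsumZ k f g : dominated f g -> rsum (fun t => k * f t) = k * rsum f.
Proof.
have pos c : 0 <= c -> dominated f g -> rsum (fun t => c * f t) = c * rsum f.
  move=> c0 d; have [s ->] := rsum_dominated d.
  rewrite (rsumE (nnsumZ c0 s) (nnsumZ c0 d.2)); last by move=> t /=; ring.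
  by rewrite (ssumZ c0 s) (ssumZ c0 d.2) mulrBr.
move=> d; have [k0|k0] := leP 0 k; first exact: pos.
have -> : (fun t => k * f t) = (fun t => - (- k * f t)).
  by apply/funext => t; ring.
rewrite (@rsumN _ (fun t => - k * g t)); last first.
  split; last by apply: nnsumZ d.2; lra.
  by move=> t; rewrite normrM ger0_norm; [rewrite ler_wpM2l ?d.1//|]; lra.
by rewrite pos//; [ring|lra].
Qed.

Lemma rsum_le f g : dominated f g -> rsum f <= ssum g.
Proof.
move=> d; have [s ->] := rsum_dominated d.
rewrite lerBlDr -ssumD; try exact: d.2.
apply: le_ssum; [exact: s.1| |exact: nnsumD d.2 d.2].
by move=> t; have := d.1 t; rewrite ler_norml; lra.
Qed.

Lemma rsum_norm_le f g : dominated f g -> `|rsum f| <= ssum g.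
Proof.
move=> d; rewrite ler_norml rsum_le// andbT lerNl -(rsumN d) rsum_le//.
by split; [move=> t; rewrite normrN; exact: d.1|exact: d.2].
Qed.

Lemma rsum_single f s : (forall t, t != s -> f t = 0) -> rsum f = f s.
Proof.
move=> fs.
have sgl (h : T -> R) : (forall t, 0 <= h t) -> (forall t, t != s -> h t = 0) ->
    nnsum h /\ ssum h = h s.
  move=> h0 hs; suff E : \esum_(t in [set: T]) (h t)%:E = (h s)%:E.
    by rewrite /nnsum /ssum E ltry.
  rewrite (esumID [set s]); last by move=> t _; rewrite lee_fin.
  rewrite setTI setTI esum_set1 ?lee_fin// [X in (_ + X)%E]esum1 ?adde0//.
  by move=> t /= /eqP ts; rewrite hs.
have [t|t ts|sa aE] := sgl (fun t => `|f t| + f t).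
- by have := lerNnormlW (lexx `|f t|); lra.
- by rewrite fs// normr0 addr0.
have [t|t ts|sb bE] := sgl (fun t => `|f t|); first by [].
- by rewrite fs// normr0.
by rewrite (rsumE sa sb) ?aE ?bE; [ring|move=> t; ring].
Qed.

Lemma nnsum_modsq v : nnsum (fun t => modsq (v t)).
Proof. by split; [move=> t; exact: modsq_ge0|exact: (valP v)]. Qed.

Lemma ssum_modsq v : ssum (fun t => modsq (v t)) = l2norm v ^+ 2.
Proof.
by apply/EFin_inj; rewrite -sqsumE -ssumE//; exact: nnsum_modsq.
Qed.

Lemma young (r a b : R) : 0 < r -> a * b <= 2^-1 * (r * a ^+ 2 + r^-1 * b ^+ 2).
Proof.
move=> r0; rewrite -subr_ge0.
have -> : 2^-1 * (r * a ^+ 2 + r^-1 * b ^+ 2) - a * b = (r * a - b) ^+ 2 / (2 * r).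
  by field; rewrite gt_eqF.
by rewrite divr_ge0 ?sqr_ge0// mulr_ge0// ltW.
Qed.

(** Young's bound for the terms of an inner product; optimizing the free weight
    [r] after summation gives the Cauchy-Schwarz inequality. *)
Definition ydom (r : R) u v t :=
  2^-1 * (r * modsq (u t) + r^-1 * modsq (v t)).

Lemma nnsum_ydom r u v : 0 < r -> nnsum (ydom r u v).
Proof.
move=> r0; apply: nnsumZ; rewrite ?invr_ge0//; apply: nnsumD; apply: nnsumZ;
  rewrite ?invr_ge0 ?ltW//; exact: nnsum_modsq.
Qed.

Lemma ssum_ydom r u v : 0 < r ->
  ssum (ydom r u v) = 2^-1 * (r * l2norm u ^+ 2 + r^-1 * l2norm v ^+ 2).
Proof.
move=> r0; have ri : 0 <= r^-1 by rewrite invr_ge0 ltW.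
have hu := nnsum_modsq u; have hv := nnsum_modsq v.
have su := nnsumZ (ltW r0) hu; have sv := nnsumZ ri hv.
rewrite /ydom (ssumZ _ (nnsumD su sv)) ?invr_ge0// (ssumD su sv).
by rewrite (ssumZ (ltW r0) hu) (ssumZ ri hv) !ssum_modsq.
Qed.

Lemma dominated_Re r u v : 0 < r ->
  dominated (fun t => complex.Re (u t * (v t)^*)) (ydom r u v).
Proof.
move=> r0; split=> [t|]; last exact: nnsum_ydom.
rewrite /ydom -[(u : T -> _) t]/((ell2val u) t) -[(v : T -> _) t]/((ell2val v) t).
case: (ell2val u t) (ell2val v t) => [x y] [x' y'].
rewrite /modsq /= ler_norml.
have := young x x' r0; have := young y y' r0.
have := young (- x) x' r0; have := young (- y) y' r0.
by rewrite !sqrrN; lra.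
Qed.

Lemma dominated_Im r u v : 0 < r ->
  dominated (fun t => complex.Im (u t * (v t)^*)) (ydom r u v).
Proof.
move=> r0; split=> [t|]; last exact: nnsum_ydom.
rewrite /ydom -[(u : T -> _) t]/((ell2val u) t) -[(v : T -> _) t]/((ell2val v) t).
case: (ell2val u t) (ell2val v t) => [x y] [x' y'].
rewrite /modsq /= ler_norml.
have := young x y' r0; have := young y x' r0.
have := young (- x) y' r0; have := young (- y) x' r0.
by rewrite !sqrrN; lra.
Qed.

(** The inner product is built from sums of real and imaginary parts, which are
    additive only on dominated families. *)
Lemma inner_linear_l (a : R[i]) u1 u2 v :
  inner (a *: u1 + u2) v = a * inner u1 v + inner u2 v.
Proof.
rewrite /inner /csum.
have r1 : dominated (fun t => complex.Re (u1 t * (v t)^*)) (ydom 1 u1 v).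
  exact: dominated_Re.
have i1 : dominated (fun t => complex.Im (u1 t * (v t)^*)) (ydom 1 u1 v).
  exact: dominated_Im.
have r2 : dominated (fun t => complex.Re (u2 t * (v t)^*)) (ydom 1 u2 v).
  exact: dominated_Re.
have i2 : dominated (fun t => complex.Im (u2 t * (v t)^*)) (ydom 1 u2 v).
  exact: dominated_Im.
have dZ k f g : dominated f g -> dominated (fun t => k * f t) (fun t => `|k| * g t).
  move=> [fg sg]; split; last exact: nnsumZ.
  by move=> t; rewrite normrM ler_wpM2l.
have dD f1 f2 g1 g2 : dominated f1 g1 -> dominated f2 g2 ->
    dominated (fun t => f1 t + f2 t) (fun t => g1 t + g2 t).
  move=> [h1 s1] [h2 s2]; split; last exact: nnsumD.
  by move=> t; rewrite (le_trans (ler_normD _ _))// lerD.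
case: a => p q; set a := p +i* q.
have E t : (a *: u1 + u2) t * (v t)^* = a * (u1 t * (v t)^*) + u2 t * (v t)^*.
  by rewrite -[(a *: u1 + u2) t]/(a * u1 t + u2 t) mulrDl mulrA.
have ReE : (fun t => complex.Re ((a *: u1 + u2) t * (v t)^*)) =
    (fun t => (p * complex.Re (u1 t * (v t)^*) +
              - q * complex.Im (u1 t * (v t)^*)) + complex.Re (u2 t * (v t)^*)).
  apply/funext => t; rewrite E.
  by case: (u1 t * (v t)^*) (u2 t * (v t)^*) => [x y] [x' y'] /=; ring.
have ImE : (fun t => complex.Im ((a *: u1 + u2) t * (v t)^*)) =
    (fun t => (p * complex.Im (u1 t * (v t)^*) +
              q * complex.Re (u1 t * (v t)^*)) + complex.Im (u2 t * (v t)^*)).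
  apply/funext => t; rewrite E.
  by case: (u1 t * (v t)^*) (u2 t * (v t)^*) => [x y] [x' y'] /=; ring.
rewrite ReE ImE (rsumD (dD _ _ _ _ (dZ p _ _ r1) (dZ (- q) _ _ i1)) r2).
rewrite (rsumD (dD _ _ _ _ (dZ p _ _ i1) (dZ q _ _ r1)) i2).
rewrite (rsumD (dZ p _ _ r1) (dZ (- q) _ _ i1)) (rsumD (dZ p _ _ i1) (dZ q _ _ r1)).
rewrite (rsumZ p r1) (rsumZ (- q) i1) (rsumZ p i1) (rsumZ q r1).
by apply/eqP; rewrite eq_complex /= mulNr !eqxx.
Qed.

Lemma innerC u v : inner v u = (inner u v)^*.
Proof.
rewrite /inner /csum /=.
have <- := rsumN (dominated_Im u v ltr01).
congr (_ +i* _); congr rsum; apply/funext => t.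
all: case: ((u : T -> _) t) ((v : T -> _) t) => [x y] [x' y'] /=; ring.
Qed.

Lemma innerBl x y v : inner (x - y) v = inner x v - inner y v.
Proof.
have -> : x - y = -1 *: y + x by rewrite scaleN1r addrC.
by rewrite inner_linear_l mulN1r addrC.
Qed.

Lemma innerBr u x y : inner u (x - y) = inner u x - inner u y.
Proof.
rewrite (innerC (x - y) u) innerBl (innerC x u) (innerC y u).
case: (inner x u) (inner y u) => [a b] [c d].
by apply/eqP; rewrite eq_complex /=; apply/andP; split; apply/eqP; ring.
Qed.

Lemma Re_inner_self v : complex.Re (inner v v) = l2norm v ^+ 2.
Proof.
rewrite /inner /csum /= -ssum_modsq.
have s0 : nnsum (fun _ : T => 0 : R).
  by split=> //; rewrite esum1// ltry.
rewrite (rsumE (nnsum_modsq v) s0).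
  by rewrite /ssum [in X in _ - X]esum1 ?subr0.
by move=> t; case: ((v : T -> _) t) => x y; rewrite /modsq /=; ring.
Qed.

Lemma inner_self_ge0 v : 0 <= inner v v.
Proof.
rewrite lecE Re_inner_self sqr_ge0 andbT.
have := congr1 (@complex.Im R) (innerC v v).
by case: (inner v v) => x y /= yN; apply/eqP; lra.
Qed.

(** The best weight is [b / a]; adding a small [d] to both numbers keeps it
    meaningful when [a] or [b] vanishes. *)
Lemma young_opt (x a b : R) : 0 <= a -> 0 <= b ->
  (forall r, 0 < r -> x <= 2^-1 * (r * a ^+ 2 + r^-1 * b ^+ 2)) -> x <= a * b.
Proof.
move=> a0 b0 h; apply/ler_addgt0Pr => e e0.
pose d := Num.min 1 (e / (a + b + 1)).
have d0 : 0 < d by rewrite lt_min ltr01 divr_gt0//; lra.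
have d1 : d <= 1 by rewrite ge_min lexx.
have dlt : d * (a + b + 1) <= e.
  by rewrite -ler_pdivlMr ?ge_min ?lexx ?orbT//; lra.
have r0 : 0 < (b + d) / (a + d) by rewrite divr_gt0//; lra.
have ad : 0 < a + d by lra.
have bd : 0 < b + d by lra.
apply: (le_trans (h _ r0)).
apply: (@le_trans _ _ ((a + d) * (b + d))); last first.
  have dd : d * d <= d by rewrite -[leRHS]mulr1 ler_wpM2l// ltW.
  have -> : (a + d) * (b + d) = a * b + (d * (a + b + 1) - d + d * d) by ring.
  by rewrite lerD2l; lra.
rewrite invf_div.
have h1 : (b + d) / (a + d) * a ^+ 2 <= (a + d) * (b + d).
  rewrite mulrAC ler_pdivrMr//.
  have -> : (a + d) * (b + d) * (a + d) = (b + d) * (a + d) ^+ 2 by ring.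
  by rewrite (ler_wpM2l (ltW bd))// ler_sqr ?nnegrE; lra.
have h2 : (a + d) / (b + d) * b ^+ 2 <= (a + d) * (b + d).
  rewrite mulrAC ler_pdivrMr//.
  have -> : (a + d) * (b + d) * (b + d) = (a + d) * (b + d) ^+ 2 by ring.
  by rewrite (ler_wpM2l (ltW ad))// ler_sqr ?nnegrE; lra.
lra.
Qed.

Lemma norm_Re_inner u v : `|complex.Re (inner u v)| <= l2norm u * l2norm v.
Proof.
apply: young_opt; rewrite ?l2norm_ge0// => r r0.
by rewrite -ssum_ydom//; apply: rsum_norm_le; exact: dominated_Re.
Qed.

Lemma norm_Im_inner u v : `|complex.Im (inner u v)| <= l2norm u * l2norm v.
Proof.
apply: young_opt; rewrite ?l2norm_ge0// => r r0.
by rewrite -ssum_ydom//; apply: rsum_norm_le; exact: dominated_Im.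
Qed.

Lemma inner_delta u (s : T) : inner u (delta R s) = u s.
Proof.
rewrite /inner /csum.
have E t : t != s -> u t * (delta R s t)^* = 0.
  by move=> /negPf ts; rewrite /= ts rmorph_nat mulr0.
rewrite !(@rsum_single _ s).
- rewrite /= eqxx rmorph_nat mulr1.
  by rewrite -[(u : T -> _) s]/((ell2val u) s); case: (ell2val u s).
- by move=> t ts; rewrite E.
- by move=> t ts; rewrite E.
Qed.

Lemma modsq_coord_le v (t : T) : modsq (v t) <= l2norm v ^+ 2.
Proof.
rewrite -lee_fin -sqsumE.
by have := @fin_le_esum R T (fun t => modsq (v t)) [fset t]%fset; rewrite big_seq_fset1.
Qed.

End summation.

(** * Completeness *)

Section completeness.
Variable R : realType.
Local Notation C := R[i].
Local Notation half n := ((2^-1 : R) ^+ n%N).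

Lemma half_gt0 n : 0 < half n.
Proof. by rewrite exprn_gt0// invr_gt0. Qed.

Lemma half_ge0 n : 0 <= half n.
Proof. exact/ltW/half_gt0. Qed.

Lemma halfS n : half n.+1 = 2^-1 * half n.
Proof. by rewrite exprS. Qed.

Lemma half_add n : half n + half n.+1 <= 2 * half n.
Proof. by rewrite halfS; have := half_gt0 n; lra. Qed.

Lemma geometric_small (K e : R) n : 0 < e -> exists2 m, (n <= m)%N & K * half m <= e.
Proof.
move=> e0; pose m := maxn n (Num.bound `|K / e|); exists m; first exact: leq_maxl.
have h : K / e <= 2 ^+ m.
  apply: (le_trans (ler_norm _)).
  apply: (le_trans (ltW (archi_boundP (normr_ge0 _)))).
  apply: (@le_trans _ _ (m%:R)); last by rewrite -natrX ler_nat ltnW// ltn_expl.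
  by rewrite ler_nat /m; exact: leq_maxr.
rewrite exprVn ler_pdivrMr ?exprn_gt0//.
by rewrite mulrC -ler_pdivrMr.
Qed.

Lemma le_geometric (K x y : R) : (forall n, x <= y + K * half n) -> x <= y.
Proof.
move=> h; apply/ler_addgt0Pr => e e0; have [m _ Km] := geometric_small K 0 e0.
by apply: (le_trans (h m)); rewrite lerD2l.
Qed.

(** The sequences [a n - 2 c 2^-n] and [a n + 2 c 2^-n] are monotone and enclose
    the limit, which is the supremum of the lower one. *)
Lemma real_geometric_cvg (a : nat -> R) (c : R) :
  (forall n, `|a n.+1 - a n| <= c * half n) ->
  exists l, forall n, `|l - a n| <= 2 * c * half n.
Proof.
move=> ac.
pose lo n := a n - 2 * c * half n; pose hi n := a n + 2 * c * half n.
have c0 : 0 <= c by have := le_trans (normr_ge0 _) (ac 0); rewrite expr0 mulr1.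
have loS n : lo n <= lo n.+1.
  by rewrite /lo halfS; have := ac n; rewrite ler_norml; lra.
have hiS n : hi n.+1 <= hi n.
  by rewrite /hi halfS; have := ac n; rewrite ler_norml; lra.
have loM n m : (n <= m)%N -> lo n <= lo m.
  move=> /subnK <-; elim: (m - n)%N => // k h.
  by rewrite addSn (le_trans h).
have hiM n m : (n <= m)%N -> hi m <= hi n.
  move=> /subnK <-; elim: (m - n)%N => // k h.
  by rewrite addSn (le_trans _ h).
have lohi n m : lo n <= hi m.
  rewrite (le_trans (loM n (maxn n m) (leq_maxl _ _)))//.
  rewrite (le_trans _ (hiM m (maxn n m) (leq_maxr _ _)))//.
  have h0 : 0 <= 2 * c * half (maxn n m) by rewrite !mulr_ge0// ltW// half_gt0.
  by rewrite /lo /hi; lra.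
exists (sup (range lo)) => n.
have ub m : ubound (range lo) (hi m) by move=> _ [k _ <-].
have h1 : lo n <= sup (range lo).
  by apply: ub_le_sup; [exists (hi 0)|exists n].
have h2 : sup (range lo) <= hi n by apply: ge_sup => //; exists (lo 0), 0.
by rewrite ler_norml; move: h1 h2; rewrite /lo /hi; lra.
Qed.

Lemma modsqD2 (z w : C) : modsq (z + w) <= 2 * modsq z + 2 * modsq w.
Proof.
have := @modsqD R z w 1 1 ltr01 ltr01; rewrite !divr1.
lra.
Qed.

(** Coordinates converge; the rate in norm follows by comparing, over a finite
    set of coordinates, the limit with a far term of the sequence. The crude
    bound [(x + y)^2 <= 2 x^2 + 2 y^2] turns the constant [2] into [3], as
    [2 * 2^2 <= 3^2]. *)
Lemma ell2_geometric_cvg (T : choiceType) (u : nat -> ell2 R T) (c : R) :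
  0 <= c -> (forall n, l2norm (u n.+1 - u n) <= c * half n) ->
  exists w, forall n, l2norm (w - u n) <= 3 * c * half n.
Proof.
move=> c0 uc.
have dist n k : l2norm (u (k + n)%N - u n) <= 2 * c * half n - 2 * c * half (k + n).
  elim: k => [|k IH]; first by rewrite subrr l2norm0 subrr.
  have -> : u (k.+1 + n)%N - u n = (u (k + n).+1 - u (k + n)%N) + (u (k + n)%N - u n).
    by rewrite addrA subrK.
  rewrite (le_trans (l2norm_triangle _ _))//.
  by have := uc (k + n)%N; rewrite addSn halfS; lra.
have coord n t : modsq (u n.+1 t - u n t) <= (c * half n) ^+ 2.
  apply: (le_trans (modsq_coord_le (u n.+1 - u n) t)).
  by rewrite ler_sqr ?nnegrE ?l2norm_ge0 ?mulr_ge0 ?half_ge0.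
have absle (x y : R) : 0 <= y -> x ^+ 2 <= y ^+ 2 -> `|x| <= y.
  by move=> y0; rewrite -(real_normK (num_real x)) ler_sqr ?nnegrE ?normr_ge0.
have /choice[wr wrP] : forall t, exists l, forall n,
    `|l - complex.Re (u n t)| <= 2 * c * half n.
  move=> t; apply: real_geometric_cvg => n; apply: absle.
    by rewrite mulr_ge0// ltW// half_gt0.
  apply: le_trans (coord n t).
  case: ((u n.+1 : T -> C) t) ((u n : T -> C) t) => [x y] [x' y'].
  by rewrite /modsq /= lerDl sqr_ge0.
have /choice[wi wiP] : forall t, exists l, forall n,
    `|l - complex.Im (u n t)| <= 2 * c * half n.
  move=> t; apply: real_geometric_cvg => n; apply: absle.
    by rewrite mulr_ge0// ltW// half_gt0.
  apply: le_trans (coord n t).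
  case: ((u n.+1 : T -> C) t) ((u n : T -> C) t) => [x y] [x' y'].
  by rewrite /modsq /= lerDr sqr_ge0.
pose w t : C := wr t +i* wi t.
have wu n t : modsq (w t - u n t) <= 8 * c ^+ 2 * half n.
  (* One of the two factors [half n] is dropped: only smallness matters. *)
  have := wrP t n; have := wiP t n; rewrite /w.
  case: ((u n : T -> C) t) => [x y]; rewrite /modsq /= => hi hr.
  have hh : half n <= 1 by rewrite exprn_ile1// invf_le1// ler1n.
  have sq (z : R) : `|z| <= 2 * c * half n -> z ^+ 2 <= 4 * c ^+ 2 * half n.
    move=> hz; rewrite -(real_normK (num_real z)).
    have hp := half_gt0 n.
    apply: (@le_trans _ _ ((2 * c * half n) ^+ 2)).
      by rewrite ler_sqr ?nnegrE//; rewrite !mulr_ge0// ltW.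
    have -> : (2 * c * half n) ^+ 2 = 4 * c ^+ 2 * half n * half n by ring.
    by rewrite -[leRHS]mulr1 ler_wpM2l// !mulr_ge0 ?sqr_ge0// ltW.
  by have := sq _ hi; have := sq _ hr; lra.
have fin n (F : {fset T}) :
    \sum_(t <- F) modsq (w t - u n t) <= (3 * c * half n) ^+ 2.
  apply: (@le_trans _ _ (2 * (2 * c * half n) ^+ 2)); last first.
    have : 0 <= (c * half n) ^+ 2 by exact: sqr_ge0.
    lra.
  apply: (@le_geometric (\sum_(t <- F) (16 * c ^+ 2 * half n))) => k.
  apply: (@le_trans _ _ (\sum_(t <- F) (2 * modsq (w t - u (k + n)%N t) +
      2 * modsq (u (k + n)%N t - u n t)))).
    apply: ler_sum => t _; apply: le_trans (modsqD2 _ _).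
    by rewrite addrA subrK.
  rewrite big_split /= addrC lerD//.
    rewrite -mulr_sumr ler_wpM2l//.
    apply: (@le_trans _ _ (l2norm (u (k + n)%N - u n) ^+ 2)).
      by rewrite -lee_fin -sqsumE; exact: (@fin_le_esum R T (fun t =>
        modsq ((u (k + n)%N - u n) t))).
    rewrite ler_sqr ?nnegrE ?l2norm_ge0 ?mulr_ge0 ?half_ge0//.
    apply: (le_trans (dist _ _)); by rewrite gerBl !mulr_ge0 ?half_ge0.
  rewrite mulr_suml; apply: ler_sum => t _.
  have := wu (k + n)%N t; rewrite exprD.
  have -> : 16 * c ^+ 2 * half n * half k = 2 * (8 * c ^+ 2 * (half k * half n)) by ring.
  by move=> ?; rewrite ler_wpM2l.
have wsq : w \in @square_summable R T.
  have d0 : (w - u 0 : T -> C) \in @square_summable R T.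
    by apply: (@sqsum_finP _ _ _ ((3 * c * half 0) ^+ 2)); apply: esum_le_fin; exact: fin.
  have -> : w = ((w - u 0 : T -> C) + (u 0 : T -> C)) by rewrite subrK.
  by rewrite rpredD//; exact: (valP (u 0)).
exists (Ell2 wsq) => n; rewrite l2norm_le ?mulr_ge0 ?half_ge0//.
by apply: esum_le_fin; exact: fin.
Qed.

Lemma l2norm_geometric_eq0 (T : choiceType) (v : ell2 R T) (K : R) :
  (forall n, l2norm v <= K * half n) -> v = 0.
Proof.
move=> h; apply: l2norm_eq0; apply/eqP; rewrite eq_le l2norm_ge0 andbT.
by apply: (@le_geometric K) => n; rewrite add0r.
Qed.

Lemma bop_geometric_cvg (X : nat -> bop R) (c : R) : 0 <= c ->
  (forall n, opnorm (X n.+1 - X n) <= c * half n) ->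
  exists Y, forall n, opnorm (Y - X n) <= 3 * c * half n.
Proof.
move=> c0 Xc.
have /choice[f fP] : forall v : fock R, exists w : fock R, forall n,
    l2norm (w - X n v) <= 3 * c * l2norm v * half n.
  move=> v; have [||w wP] := @ell2_geometric_cvg _ (fun n => X n v) (c * l2norm v).
  - by rewrite mulr_ge0 ?l2norm_ge0.
  - move=> n; rewrite (le_trans (opnormP (X n.+1 - X n) v))// mulrAC.
    by rewrite ler_wpM2r ?l2norm_ge0.
  by exists w => n; have := wP n; rewrite !mulrA.
have fb : f \in @bounded_linear R.
  apply/asboolP; split.
    move=> a u v; apply/eqP; rewrite -subr_eq0; apply/eqP.
    pose K := 3 * c * l2norm (a *: u + v) + Num.sqrt (modsq a) * (3 * c * l2norm u)
      + 3 * c * l2norm v.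
    apply: (@l2norm_geometric_eq0 _ _ K) => n.
    have -> : f (a *: u + v) - (a *: f u + f v) =
        (f (a *: u + v) - X n (a *: u + v)) + (a *: (X n u - f u) + (X n v - f v)).
      rewrite (linearP (X n)) scalerBr.
      by rewrite [X in _ = _ + X]addrACA -opprD addrA subrK.
    have d1 := fP (a *: u + v) n; have d2 := fP u n; have d3 := fP v n.
    have opp (x y : fock R) : l2norm (x - y) <= l2norm (y - x).
      rewrite -[x - y]opprB -scaleN1r (le_trans (l2normZ_le _ _))//.
      by rewrite /modsq /= sqrrN expr1n oppr0 expr0n addr0 sqrtr1 mul1r.
    have d4 : l2norm (a *: (X n u - f u)) <=
    Num.sqrt (modsq a) * (3 * c * l2norm u * half n).
      apply: (le_trans (l2normZ_le _ _)); apply: ler_wpM2l; first exact: sqrtr_ge0.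
      exact: le_trans (opp _ _) d2.
    have d5 : l2norm (X n v - f v) <= 3 * c * l2norm v * half n.
      exact: le_trans (opp _ _) d3.
    have -> : K * half n = 3 * c * l2norm (a *: u + v) * half n +
        (Num.sqrt (modsq a) * (3 * c * l2norm u * half n) +
         3 * c * l2norm v * half n) by rewrite /K; ring.
    apply: (le_trans (l2norm_triangle _ _)); apply: lerD => //.
    by apply: (le_trans (l2norm_triangle _ _)); apply: lerD.
  exists (3 * c + opnorm (X 0)) => v.
  have -> : f v = (f v - X 0 v) + X 0 v by rewrite subrK.
  apply: (le_trans (l2norm_triangle _ _)).
  rewrite [leRHS]mulrDl; apply: lerD; last exact: opnormP.
  by have := fP v 0; rewrite expr0 mulr1.
exists (Bop fb) => n; apply: opnorm_le => [|v].
  by rewrite !mulr_ge0// ltW// half_gt0.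
by rewrite mulrAC; exact: fP.
Qed.

Lemma opnormN (X : bop R) : opnorm (- X) = opnorm X.
Proof.
have le (Y : bop R) : opnorm (- Y) <= opnorm Y.
  rewrite -scaleN1r (le_trans (opnormZ_le _ _))// /modsq /= sqrrN expr1n.
  by rewrite oppr0 expr0n addr0 sqrtr1 mul1r.
by apply/eqP; rewrite eq_le le -{1}(opprK X) le.
Qed.

Lemma opnormB (X Y : bop R) : opnorm (X - Y) <= opnorm X + opnorm Y.
Proof. by rewrite -(opnormN Y) opnormD. Qed.

Lemma opnorm_distC (X Y : bop R) : opnorm (X - Y) = opnorm (Y - X).
Proof. by rewrite -opnormN opprB. Qed.

Lemma opnorm0 : opnorm (0 : bop R) = 0.
Proof.
apply/eqP; rewrite eq_le opnorm_ge0 andbT; apply: opnorm_le => // v.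
by rewrite l2norm0 mul0r.
Qed.

Lemma opnorm_eq0 (X : bop R) : opnorm X = 0 -> X = 0.
Proof.
move=> X0; apply/val_inj/funext => v /=; apply: l2norm_eq0; apply/eqP.
by rewrite eq_le l2norm_ge0 andbT (le_trans (opnormP X v))// X0 mul0r.
Qed.

Lemma opnorm_geometric_eq0 (X : bop R) (K : R) :
  (forall n, opnorm X <= K * half n) -> X = 0.
Proof.
move=> h; apply: opnorm_eq0; apply/eqP; rewrite eq_le opnorm_ge0 andbT.
by apply: (@le_geometric K) => n; rewrite add0r.
Qed.

(** A bounded operator approximated by elements of the algebra, themselves
    approximated by the generated algebra, lies in the algebra. *)
Lemma mon_closed (X : nat -> mon R) (Y : bop R) (K : R) :
  (forall n, opnorm (Y - X n) <= K * half n) -> Y \in @mon_pred R.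
Proof.
move=> YX; apply/asboolP => e e0.
have e2 : 0 < e / 2 by rewrite divr_gt0.
have [n _ Kn] := geometric_small K 0 e2.
have /asboolP/(_ _ e2)[Z MZ XZ] : monval (X n) \in @mon_pred R := valP (X n).
exists Z => //.
have -> : Y - Z = (Y - X n) + (monval (X n) - Z) by rewrite addrA subrK.
rewrite (le_lt_trans (opnormD _ _))//.
have := YX n; lra.
Qed.

Lemma mon_geometric_cvg (X : nat -> mon R) (c : R) : 0 <= c ->
  (forall n, opnorm (X n.+1 - X n) <= c * half n) ->
  exists Y : mon R, forall n, opnorm (Y - X n) <= 3 * c * half n.
Proof.
move=> c0 Xc; have [Y YP] := @bop_geometric_cvg (fun n => monval (X n)) c c0 Xc.
by exists (Mon (mon_closed YP)).
Qed.

(** * Adjoints *)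

Lemma adjoint_sym (X Y : bop R) : is_adjoint X Y -> is_adjoint Y X.
Proof. by move=> h u v; rewrite innerC -h -innerC. Qed.

Lemma adjointP (k : C) (X Y X' Y' : bop R) : is_adjoint X X' -> is_adjoint Y Y' ->
  is_adjoint (k *: X + Y) (k^*%C *: X' + Y').
Proof.
move=> hX hY u v.
have -> : (k *: X + Y) u = k *: X u + Y u by [].
have -> : (k^*%C *: X' + Y') v = k^*%C *: X' v + Y' v by [].
rewrite inner_linear_l [RHS]innerC.
rewrite inner_linear_l hX hY.
rewrite (innerC u (X' v)) (innerC u (Y' v)).
case: (inner u (X' v)) (inner u (Y' v)) => [a b] [c d]; case: k => p q.
by apply/eqP; rewrite eq_complex /=; apply/andP; split; apply/eqP; ring.
Qed.

Lemma adjointM (X Y X' Y' : bop R) : is_adjoint X X' -> is_adjoint Y Y' ->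
  is_adjoint (X * Y) (Y' * X').
Proof. by move=> hX hY u v /=; rewrite hX hY. Qed.

Lemma adjoint1 : is_adjoint (1 : bop R) 1. Proof. by []. Qed.

Lemma adjointB (X Y X' Y' : bop R) : is_adjoint X X' -> is_adjoint Y Y' ->
  is_adjoint (X - Y) (X' - Y').
Proof.
move=> hX hY; have := adjointP (-1) hY hX.
by rewrite rmorphN rmorph1 !scaleN1r ![- _ + _]addrC.
Qed.

Lemma adjoint0 : is_adjoint (0 : bop R) 0.
Proof. by have := adjointB adjoint1 adjoint1; rewrite subrr. Qed.

Lemma adjoint_uniq (X Y Y' : bop R) : is_adjoint X Y -> is_adjoint X Y' -> Y = Y'.
Proof.
move=> h h'; apply/val_inj/funext => v; apply/val_inj/funext => s.
rewrite -[LHS](inner_delta (Y v) s) -[RHS](inner_delta (Y' v) s).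
by rewrite innerC -h h' -innerC.
Qed.

(** By Cauchy-Schwarz, [|Y v|^2 = <X (Y v), v> <= |X| |Y v| |v|]. *)
Lemma opnorm_adjoint_le (X Y : bop R) : is_adjoint X Y -> opnorm Y <= opnorm X.
Proof.
move=> h; apply: opnorm_le; first exact: opnorm_ge0.
move=> v; have [n0|n0] := eqVneq (l2norm (Y v)) 0.
  by rewrite n0 mulr_ge0 ?opnorm_ge0 ?l2norm_ge0.
have np : 0 < l2norm (Y v) by rewrite lt_neqAle eq_sym n0 l2norm_ge0.
rewrite -(ler_pM2l np) -expr2 -Re_inner_self -h.
apply: (le_trans (ler_norm _)); apply: (le_trans (norm_Re_inner _ _)).
by rewrite mulrCA mulrA ler_wpM2r ?l2norm_ge0 ?opnormP.
Qed.

Lemma opnorm_adjoint (X Y : bop R) : is_adjoint X Y -> opnorm Y = opnorm X.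
Proof.
move=> h; apply/eqP; rewrite eq_le opnorm_adjoint_le//=.
exact/opnorm_adjoint_le/adjoint_sym.
Qed.

Lemma adjoint_lim (X Y : nat -> bop R) (X' Y' : bop R) (K : R) :
  (forall n, opnorm (X' - X n) <= K * half n) ->
  (forall n, opnorm (Y' - Y n) <= K * half n) ->
  (forall n, is_adjoint (X n) (Y n)) -> is_adjoint X' Y'.
Proof.
move=> hX hY h u v.
have E n : inner (X' u) v - inner u (Y' v) =
    inner ((X' - X n) u) v - inner u ((Y' - Y n) v).
  have -> : (X' - X n) u = X' u - X n u by [].
  have -> : (Y' - Y n) v = Y' v - Y n v by [].
  rewrite innerBl innerBr.
  by rewrite h; ring.
have bound n : `|complex.Re (inner (X' u) v - inner u (Y' v))| <=
      2 * K * l2norm u * l2norm v * half n /\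
    `|complex.Im (inner (X' u) v - inner u (Y' v))| <=
      2 * K * l2norm u * l2norm v * half n.
  have a1 : l2norm ((X' - X n) u) * l2norm v <= K * l2norm u * l2norm v * half n.
    have -> : K * l2norm u * l2norm v * half n = K * half n * l2norm u * l2norm v by ring.
    apply: ler_wpM2r; first exact: l2norm_ge0.
    apply: (le_trans (opnormP _ _)); apply: ler_wpM2r (hX n); exact: l2norm_ge0.
  have a2 : l2norm u * l2norm ((Y' - Y n) v) <= K * l2norm u * l2norm v * half n.
    have -> : K * l2norm u * l2norm v * half n = l2norm u * (K * half n * l2norm v) by ring.
    apply: ler_wpM2l; first exact: l2norm_ge0.
    apply: (le_trans (opnormP _ _)); apply: ler_wpM2r (hY n); exact: l2norm_ge0.
  rewrite (E n) !raddfB /=.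
  have := norm_Re_inner ((X' - X n) u) v; have := norm_Im_inner ((X' - X n) u) v.
  have := norm_Re_inner u ((Y' - Y n) v); have := norm_Im_inner u ((Y' - Y n) v).
  move=> b1 b2 b3 b4; split.
    by rewrite (le_trans (ler_normB _ _))//; lra.
  by rewrite (le_trans (ler_normB _ _))//; lra.
apply/eqP; rewrite -subr_eq0 eq_complex; apply/andP; split.
  rewrite -normr_eq0 eq_le normr_ge0 andbT.
  by apply: (@le_geometric (2 * K * l2norm u * l2norm v)) => n; rewrite add0r; apply:
    (bound n).1.
rewrite -normr_eq0 eq_le normr_ge0 andbT.
by apply: (@le_geometric (2 * K * l2norm u * l2norm v)) => n; rewrite add0r; apply:
  (bound n).2.
Qed.

End completeness.

(** * Relations between creators and annihilators *)

Section relations.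
Variable R : realType.
Local Notation C := R[i].
Local Notation mon := (mon R).
Local Notation anni := (anni R).
Local Notation crea := (crea R).

Lemma mon_ext (X Y : mon) : (forall (v : fock R) s, X v s = Y v s) -> X = Y.
Proof.
move=> h; apply/val_inj/val_inj/funext => v.
by apply/val_inj/funext => s; exact: h.
Qed.

Lemma ann_dom_some i (s : incseq) : (ann_dom i s : bool) = sorted <%R (i :: val s).
Proof. by rewrite /ann_dom; case: insubP => [u ->|/negPf ->]. Qed.

(** The projection onto [Omega] and the [e_s] whose entries all exceed [i]. *)
Definition tailproj (i : int) : mon := anni i * crea i.

Lemma tailprojE i (v : fock R) s :
  tailproj i v s = if sorted <%R (i :: val s) then v s else 0.
Proof.
rewrite -ann_dom_some -(pull_pull (ann_cre i)).
by [].
Qed.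

Lemma anni_crea_neq i j : i != j -> anni i * crea j = 0.
Proof.
move=> ij; apply: mon_ext => v s.
rewrite [LHS](_ : _ = pull (ann_dom i) (pull (cre_dom j) v) s)// /pull.
case E: (ann_dom i s) => [t|] //; move/eqP: E; rewrite ann_domE => /eqP E.
case E': (cre_dom j t) => [u|] //; move/eqP: E'; rewrite cre_domE E.
by rewrite eqseq_cons (negPf ij).
Qed.

Lemma crea_crea_ge i j : j <= i -> crea i * crea j = 0.
Proof.
move=> ji; apply: mon_ext => v s.
rewrite [LHS](_ : _ = pull (cre_dom i) (pull (cre_dom j) v) s)// /pull.
case E: (cre_dom i s) => [t|] //; move/eqP: E; rewrite cre_domE => /eqP E.
case E': (cre_dom j t) => [u|] //; move/eqP: E'; rewrite cre_domE => /eqP E'.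
by have := valP s; rewrite E E' /= ltNge ji.
Qed.

Lemma path_incseq i (s : incseq) j t : val s = j :: t ->
  sorted <%R (i :: val s) = (i < j).
Proof. by move=> sE; have := valP s; rewrite sE /= => ->; rewrite andbT. Qed.

Lemma tailproj_crea i j : i < j -> tailproj i * crea j = crea j.
Proof.
move=> ij; apply: mon_ext => v s.
rewrite [LHS](tailprojE i (crea j v) s) -[RHS]/(pull (cre_dom j) v s).
rewrite -[ell2val _ s]/(pull (cre_dom j) v s) /pull.
case E: (cre_dom j s) => [t|]; last by case: ifP.
move/eqP: E; rewrite cre_domE => /eqP E.
by rewrite (path_incseq i E) ij.
Qed.

Lemma anni_tailproj j i : anni j * tailproj i = if i < j then anni j else 0.
Proof.
apply: mon_ext => v s.
rewrite [LHS](_ : _ = pull (ann_dom j) (tailproj i v) s)//.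
have E0 : (if i < j then anni j else 0) v s = if i < j then pull (ann_dom j) v s else 0.
  by case: ifP.
rewrite E0 /pull.
case E: (ann_dom j s) => [t|]; last by case: ifP.
move/eqP: E; rewrite ann_domE => /eqP E.
by rewrite tailprojE (path_incseq i E).
Qed.

Lemma path_le_int i j (s : seq int) : i <= j -> path <%R j s -> path <%R i s.
Proof. by case: s => //= x s ij /andP[jx ->]; rewrite (le_lt_trans ij jx). Qed.

Lemma crea_tailproj i j : i <= j -> crea j * tailproj i = crea j.
Proof.
move=> ij; apply: mon_ext => v s.
rewrite [LHS](_ : _ = pull (cre_dom j) (tailproj i v) s)//.
rewrite [RHS](_ : _ = pull (cre_dom j) v s)// /pull.
case E: (cre_dom j s) => [t|] //; move/eqP: E; rewrite cre_domE => /eqP E.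
have js : path <%R j (val t) by have := valP s; rewrite E.
by rewrite tailprojE /= (path_le_int ij js).
Qed.

Lemma tailproj_anni i j : i <= j -> tailproj i * anni j = anni j.
Proof.
move=> ij; apply: mon_ext => v s.
rewrite [LHS](tailprojE i (anni j v) s) -[RHS]/(pull (ann_dom j) v s).
rewrite -[ell2val _ s]/(pull (ann_dom j) v s) /pull.
case E: (ann_dom j s) => [t|]; last by case: ifP.
move/eqP: E; rewrite ann_domE => /eqP E.
have js : path <%R j (val s) by have := valP t; rewrite E.
by rewrite /= (path_le_int ij js).
Qed.

Lemma tailprojM i j : i <= j -> tailproj i * tailproj j = tailproj j.
Proof.
move=> ij; apply: mon_ext => v s.
rewrite [LHS](tailprojE i (tailproj j v) s) !tailprojE /=.
by case: ifPn => // /negP h; case: ifPn => // /(path_le_int ij).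
Qed.

Lemma tailproj_pred i : tailproj (i - 1) = crea i * anni i + tailproj i.
Proof. exact: anni_crea_pred. Qed.

Lemma anni_crea i : anni i * crea i = tailproj i. Proof. by []. Qed.

Lemma hamel1 k : hamel R [:: k] [:: k] = tailproj k.
Proof. by rewrite /hamel eqxx. Qed.

(** * The span of the Hamel words *)

Lemma linspan_sub (A : set mon) X : A X -> linspan A X.
Proof. by move=> AX V [_]; exact. Qed.

Lemma linspan0 (A : set mon) : linspan A 0.
Proof. by move=> V [[V0 _]]. Qed.

Lemma linspanP (A : set mon) (k : C) X Y :
  linspan A X -> linspan A Y -> linspan A (k *: X + Y).
Proof.
move=> hX hY V hV; have [[_ Vl] _] := hV.
by apply: Vl; [exact: hX|exact: hY].
Qed.

Lemma linspanB (A : set mon) X Y : linspan A X -> linspan A Y -> linspan A (X - Y).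
Proof. by move=> hX hY; rewrite addrC -scaleN1r; exact: linspanP. Qed.

Lemma linspan_ind (A V : set mon) : V 0 ->
  (forall (k : C) X Y, V X -> V Y -> V (k *: X + Y)) -> A `<=` V -> linspan A `<=` V.
Proof. by move=> V0 Vl AV X; apply; split. Qed.

Definition hamels : set mon :=
  [set X | exists I J, [/\ sorted <%R I, sorted >%R J & X = hamel R I J]].

(** When [k] bounds [I] and [J], this operator sends [e_(rev J ++ r)] to
    [e_(I ++ r)] for the sequences [r] above the cutoff [k] and kills the other
    basis vectors. Left multiplication by a generator maps such an operator, as
    well as the identity, to another one or to zero; Hamel words lack this
    property, as [a_i^+ a_i] is not one of them. *)
Definition cutword I k J : mon :=
  (\prod_(i <- I) crea i) * tailproj k * (\prod_(j <- J) anni j).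

Definition below (k : int) (I : seq int) := all (fun i => i <= k) I.

Definition cutwords : set mon :=
  [set X | X = 1 \/ exists I k J, [/\ sorted <%R I, sorted >%R J, below k I,
     below k J & X = cutword I k J]].

Lemma hamel_word I J : (forall i, ~ (I = [:: i] /\ J = [:: i])) ->
  hamel R I J = word R I J.
Proof.
case: I => [|i [|? ?]] //; case: J => [|j [|? ?]] //= h.
by case: eqP => // ij; case: (h j); rewrite ij.
Qed.

Lemma word_span I J : sorted <%R I -> sorted >%R J -> linspan hamels (word R I J).
Proof.
move=> sI sJ; have [[k [-> ->]]|h] := pselect (exists k, I = [:: k] /\ J = [:: k]).
  have -> : word R [:: k] [:: k] = tailproj (k - 1) - tailproj k.
    by rewrite tailproj_pred addrK /word !big_seq1.
  apply: linspanB; rewrite -hamel1; apply: linspan_sub.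
    by exists [:: k - 1], [:: k - 1].
  by exists [:: k], [:: k].
rewrite -hamel_word; first by apply: linspan_sub; exists I, J.
by move=> k hk; apply: h; exists k.
Qed.

Lemma sorted_rconsE (I : seq int) x :
  sorted <%R (rcons I x) = sorted <%R I && all (fun i => i < x) I.
Proof.
by rewrite !sorted_pairwise ?pairwise_rcons 1?andbC//; exact: lt_trans.
Qed.

Lemma sorted_consE (J : seq int) x :
  sorted >%R (x :: J) = sorted >%R J && all (fun j => j < x) J.
Proof.
by rewrite !sorted_pairwise ?pairwise_cons 1?andbC//; move=> a b c /= h h'; exact:
  lt_trans h' h.
Qed.

Lemma below_rcons k (I : seq int) : sorted <%R I -> below k I -> k \in I ->
  exists I', I = rcons I' k.
Proof.
case/lastP: I => // I x; rewrite /below all_rcons sorted_rconsE => /andP[_ ax] /andP[xk _].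
rewrite mem_rcons inE => /orP[/eqP ->|kI]; first by exists I.
by have /allP/(_ _ kI) := ax; rewrite ltNge xk.
Qed.

Lemma below_cons k (J : seq int) : sorted >%R J -> below k J -> k \in J ->
  exists J', J = k :: J'.
Proof.
case: J => // x J; rewrite /below /= -/(sorted >%R (x :: J)) sorted_consE.
move=> /andP[_ ax] /andP[xk _].
rewrite inE => /orP[/eqP ->|kI]; first by exists J.
by have /allP/(_ _ kI) := ax; rewrite ltNge xk.
Qed.

(** The creator or annihilator at the index [k] already imposes the cutoff. *)
Lemma cutword_top I k J : sorted <%R I -> sorted >%R J -> below k I -> below k J ->
  k \in I ++ J -> cutword I k J = word R I J.
Proof.
move=> sI sJ bI bJ; rewrite mem_cat => /orP[kI|kJ].
  have [I' ->] := below_rcons sI bI kI.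
  by rewrite /cutword /word big_rcons /= -[_ * crea k * tailproj k]mulrA crea_tailproj.
have [J' ->] := below_cons sJ bJ kJ.
by rewrite /cutword /word big_cons -mulrA [tailproj k * _]mulrA tailproj_anni.
Qed.

(** A sequence above [k - 1] either lies above [k] or begins with [k]. *)
Lemma cutword_pred I k J : cutword I k J =
  cutword I (k - 1) J - cutword (rcons I k) k (k :: J).
Proof.
rewrite /cutword tailproj_pred mulrDr mulrDl big_rcons /= big_cons.
have -> : (\prod_(i <- I) crea i) * crea k * tailproj k * (anni k * \prod_(j <- J) anni j)
    = (\prod_(i <- I) crea i) * (crea k * anni k) * (\prod_(j <- J) anni j).
  rewrite -[_ * crea k * tailproj k]mulrA crea_tailproj// mulrA.
  by rewrite -[_ * crea k * anni k]mulrA.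
by rewrite addrAC subrr add0r.
Qed.

(** Lowering the cutoff one step at a time produces Hamel words as corrections,
    until the cutoff reaches an index of [I] or [J]; without such an index the
    operator is a Hamel word. *)
Lemma cutword_span I k J : sorted <%R I -> sorted >%R J -> below k I -> below k J ->
  linspan hamels (cutword I k J).
Proof.
move=> sI sJ bI bJ.
have [IJ0|] := eqVneq (I ++ J) [::].
  have -> : I = [::] by case: I IJ0 {sI bI}.
  have -> : J = [::] by case: J IJ0 {sJ bJ}; case: I {sI bI}.
  rewrite /cutword !big_nil mul1r mulr1 -hamel1; apply: linspan_sub.
  by exists [:: k], [:: k].
rewrite -size_eq0 -lt0n -has_predT => /hasP[m mIJ _].
have mk : m <= k.
  move: mIJ; rewrite mem_cat => /orP[mI|mJ]; first exact: (allP bI).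
  exact: (allP bJ).
have [n kE] : exists n : nat, k = m + n%:Z.
  by exists `|k - m|%N; rewrite gez0_abs ?subr_ge0//; ring.
elim: n k kE {mk} bI bJ => [|n IH] k kE bI bJ.
  rewrite cutword_top ?kE ?addr0//; first exact: word_span.
  by rewrite kE addr0 in bI. by rewrite kE addr0 in bJ.
have [kIJ|kIJ] := boolP (k \in I ++ J).
  by rewrite cutword_top//; exact: word_span.
have ltb (L : seq int) : below k L -> k \notin L -> all (fun i => i < k) L.
  move=> /allP bL kL; apply/allP => i iL; rewrite lt_neqAle bL// andbT.
  by apply: contraNneq kL => <-.
move: kIJ; rewrite mem_cat negb_or => /andP[kI kJ].
have lI := ltb _ bI kI; have lJ := ltb _ bJ kJ.
have pred (L : seq int) : all (fun i => i < k) L -> below (k - 1) L.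
  by move=> /allP aL; apply/allP => i /aL; rewrite lerBrDr lezD1.
rewrite cutword_pred; apply: linspanB.
  by apply: IH; [rewrite kE -addn1 PoszD addrA addrK|exact: pred|exact: pred].
rewrite cutword_top.
- by apply: word_span; rewrite ?sorted_rconsE ?sorted_consE ?sI ?lI ?sJ ?lJ.
- by rewrite sorted_rconsE sI lI.
- by rewrite sorted_consE sJ lJ.
- by rewrite /below all_rcons lexx.
- by rewrite /below /= lexx.
- by rewrite mem_cat mem_rcons inE eqxx.
Qed.

Lemma cutwords_hamels : linspan cutwords `<=` linspan hamels.
Proof.
apply: linspan_ind; [exact: linspan0|by move=> *; exact: linspanP|].
move=> X [->|[I [k [J [sI sJ bI bJ ->]]]]]; last exact: cutword_span.
apply: linspan_sub; exists [::], [::]; split=> //.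
by rewrite /hamel /word !big_nil mulr1.
Qed.

Lemma crea_cutwords i X : linspan cutwords X -> linspan cutwords (crea i * X).
Proof.
move: X; apply: linspan_ind.
- by rewrite mulr0; exact: linspan0.
- by move=> k X Y hX hY; rewrite mulrDr -scalerAr; exact: linspanP.
move=> X [->|[I [k [J [sI sJ bI bJ ->]]]]].
  apply: linspan_sub; right; exists [:: i], i, [::]; split=> //.
    by rewrite /below /= lexx.
  by rewrite /cutword big_seq1 big_nil !mulr1 crea_tailproj.
case: I sI bI => [|j I] sI bI.
  have [ik|ki] := leP i k.
    apply: linspan_sub; right; exists [:: i], k, J; split=> //.
      by rewrite /below /= ik.
    by rewrite /cutword big_seq1 big_nil mul1r mulrA.
  apply: linspan_sub; right; exists [:: i], i, J; split=> //.
  - by rewrite /below /= lexx.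
  - by apply/allP => j /(allP bJ) /le_trans; apply; exact: ltW.
  - rewrite /cutword big_seq1 big_nil mul1r mulrA crea_tailproj// ?crea_tailproj//.
    exact: ltW.
have [ij|ji] := ltP i j; last first.
  by rewrite /cutword big_cons !mulrA crea_crea_ge// !mul0r; exact: linspan0.
apply: linspan_sub; right; exists [:: i, j & I], k, J; split=> //.
- by move: sI => /= ->; rewrite ij.
- by move: bI; rewrite /below /= => /andP[jk ->]; rewrite jk (le_trans (ltW ij) jk).
- by rewrite /cutword [in RHS]big_cons !mulrA.
Qed.

Lemma anni_cutwords i X : linspan cutwords X -> linspan cutwords (anni i * X).
Proof.
move: X; apply: linspan_ind.
- by rewrite mulr0; exact: linspan0.
- by move=> k X Y hX hY; rewrite mulrDr -scalerAr; exact: linspanP.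
move=> X [->|[I [k [J [sI sJ bI bJ ->]]]]].
  apply: linspan_sub; right; exists [::], i, [:: i]; split=> //.
    by rewrite /below /= lexx.
  by rewrite /cutword big_seq1 big_nil mul1r mulr1 tailproj_anni.
case: I sI bI => [|j I] sI bI.
  rewrite /cutword big_nil mul1r mulrA anni_tailproj; case: ifPn => ki; last first.
    by rewrite mul0r; exact: linspan0.
  apply: linspan_sub; right; exists [::], i, (i :: J); split=> //.
  - rewrite sorted_consE sJ; apply/allP => j /(allP bJ) jk; exact: le_lt_trans jk ki.
  - by rewrite /below /= lexx; apply/allP => j /(allP bJ) jk; exact/ltW/(le_lt_trans jk).
  - by rewrite /cutword big_nil mul1r big_cons mulrA tailproj_anni.
rewrite /cutword big_cons 3![anni i * _]mulrA.
have [ij|ij] := eqVneq i j; last first.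
  by rewrite anni_crea_neq// !mul0r; exact: linspan0.
rewrite ij anni_crea; apply: linspan_sub; right; exists I, k, J; split=> //.
- exact: path_sorted sI.
- by move: bI => /andP[].
case: I sI bI => [|l I] sI bI.
  rewrite /cutword !big_nil mulr1 mul1r tailprojM//.
  by move: bI; rewrite /below /= andbT.
rewrite /cutword big_cons [tailproj j * _]mulrA tailproj_crea//.
by move: sI => /= /andP[].
Qed.

(** Only operators having an adjoint that also preserves the span are
    considered, so that the invariance survives passing to adjoints; applying
    such an operator to the identity then puts it in the span. *)
Lemma Mo_hamels (X : bop R) : Mo X ->
  (exists2 Z : mon, linspan hamels Z & monval Z = X) /\ (exists2 Y, Mo Y & is_adjoint X Y).
Proof.
pose stab (X : bop R) := forall Z : mon, linspan cutwords Z ->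
  exists2 Z' : mon, linspan cutwords Z' & monval Z' = X * monval Z.
pose A : set (bop R) := [set X | exists Y, [/\ is_adjoint X Y, stab X & stab Y]].
have stab1 : stab 1 by move=> Z hZ; exists Z => //; rewrite mul1r.
have stabP (k : C) X1 X2 : stab X1 -> stab X2 -> stab (k *: X1 + X2).
  move=> h1 h2 Z hZ; have [Z1 s1 e1] := h1 _ hZ; have [Z2 s2 e2] := h2 _ hZ.
  exists (k *: Z1 + Z2); first exact: linspanP.
  by rewrite mulrDl -scalerAl -e1 -e2.
have stabM X1 X2 : stab X1 -> stab X2 -> stab (X1 * X2).
  move=> h1 h2 Z hZ; have [Z2 s2 e2] := h2 _ hZ; have [Z1 s1 e1] := h1 _ s2.
  by exists Z1 => //; rewrite e1 e2 mulrA.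
have MoA : @Mo R `<=` A.
  apply: smallest_sub.
    split.
    - by exists 1; split=> //; exact: adjoint1.
    - move=> k X1 X2 [Y1 [a1 s1 t1]] [Y2 [a2 s2 t2]].
      exists (k^*%C *: Y1 + Y2); split; first exact: adjointP.
        exact: stabP.
      exact: stabP.
    - move=> X1 X2 [Y1 [a1 s1 t1]] [Y2 [a2 s2 t2]].
      exists (Y2 * Y1); split; [exact: adjointM|exact: stabM|exact: stabM].
    - move=> X1 Y aXY [Y1 [a1 s1 t1]]; exists X1.
      by rewrite (adjoint_uniq aXY a1); split=> //; exact: adjoint_sym.
  move=> _ [i _ <-]; exists (crea_op R i); split; first exact: anni_crea_adjoint.
    by move=> Z hZ; exists (anni i * Z) => //; exact: anni_cutwords.
  by move=> Z hZ; exists (crea i * Z) => //; exact: crea_cutwords.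
move=> MX; have [Y [aXY sX sY]] := MoA _ MX; split.
  have [|Z hZ e] := sX 1; first by apply: linspan_sub; left.
  by exists Z; [exact: cutwords_hamels|rewrite e mulr1].
exists Y => //; have [_ _ _ h] := @Mo_star_subalgebra R; exact: h aXY MX.
Qed.

Lemma hamels_dense (X : mon) (e : R) : 0 < e ->
  exists2 Y : mon, linspan hamels Y & opnorm (X - Y) < e.
Proof.
move=> e0; have /asboolP/(_ _ e0)[Z MZ XZ] : monval X \in @mon_pred R := valP X.
by have [[Y hY YE] _] := Mo_hamels MZ; exists Y => //;
  rewrite -[opnorm _]/(opnorm (monval X - monval Y)) YE.
Qed.

(** Positivity of a functional only concerns products [Xs * X], so it says
    nothing about an element until its adjoint is known to be in the algebra.
    The adjoint is the limit of the adjoints of approximants. *)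
Lemma adjoint_exists (X : mon) : exists Xs : mon, is_adjoint X Xs.
Proof.
have /choice[Z ZP] : forall n, exists Z : bop R * bop R,
    [/\ Mo Z.1, Mo Z.2, is_adjoint Z.1 Z.2 & opnorm (monval X - Z.1) <= 2^-1 ^+ n].
  move=> n.
  have /asboolP/(_ _ (half_gt0 R n))[Z MZ XZ] : monval X \in @mon_pred R := valP X.
  have [_ [Y MY aY]] := Mo_hamels MZ.
  by exists (Z, Y); split=> //; exact: ltW.
pose Y n : mon := Mon (Mo_mon (let: And4 _ h _ _ := ZP n in h)).
have [||Xs XsP] := @mon_geometric_cvg R Y 2.
- by [].
- move=> n; rewrite (opnorm_adjoint (X := (Z n.+1).1 - (Z n).1)); last first.
    have [_ _ a1 _] := ZP n.+1; have [_ _ a0 _] := ZP n.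
    exact: adjointB.
  have -> : (Z n.+1).1 - (Z n).1 = (monval X - (Z n).1) - (monval X - (Z n.+1).1).
    by rewrite opprB [RHS]addrC addrA subrK.
  rewrite (le_trans (opnormB _ _))//.
  have [_ _ _ ] := ZP n.+1; have [_ _ _ ] := ZP n; rewrite exprS.
  have := half_gt0 R n; lra.
exists Xs; apply: (@adjoint_lim R (fun n => (Z n).1) Y _ _ (3 * 2)).
- move=> n; have [_ _ _ h] := ZP n; apply: le_trans h _.
  by rewrite ler_peMl ?half_ge0//; lra.
- exact: XsP.
- by move=> n; have [_ _ a _] := ZP n.
Qed.

End relations.

(** * Bounded functionals and states *)

Section functionals.
Variable R : realType.
Local Notation C := R[i].
Local Notation mon := (mon R).

Definition bounded_functional (phi : mon -> C) :=
  exists c : R, forall X : mon, modsq (phi X) <= c * opnorm X ^+ 2.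

Lemma scalarB (phi : mon -> C) X Y : scalar phi -> phi (X - Y) = phi X - phi Y.
Proof.
move=> sphi; have -> : X - Y = -1 *: Y + X by rewrite scaleN1r addrC.
by rewrite sphi mulN1r addrC.
Qed.

Lemma scalar_0 (phi : mon -> C) : scalar phi -> phi 0 = 0.
Proof. by move=> /(@scalarB _ 0 0); rewrite !subrr. Qed.

Lemma scalar_Z (phi : mon -> C) (k : C) X : scalar phi -> phi (k *: X) = k * phi X.
Proof. by move=> sphi; rewrite -[k *: X]addr0 sphi scalar_0// addr0. Qed.

Lemma scalar_D (phi : mon -> C) X Y : scalar phi -> phi (X + Y) = phi X + phi Y.
Proof. by move=> sphi; have := sphi 1 X Y; rewrite scale1r mul1r. Qed.

Lemma modsq_eq0 (z : C) : modsq z = 0 -> z = 0.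
Proof.
case: z => a b; rewrite /modsq /= => /eqP.
by rewrite paddr_eq0 ?sqr_ge0// !sqrf_eq0 => /andP[/eqP -> /eqP ->].
Qed.

Lemma modsqN (z : C) : modsq (- z) = modsq z.
Proof. by case: z => a b; rewrite /modsq /= !sqrrN. Qed.

(** The Hamel words span a dense subspace. *)
Lemma functional_ext (phi psi : mon -> C) : scalar phi -> scalar psi ->
  bounded_functional phi -> bounded_functional psi ->
  (forall I J, sorted <%R I -> sorted >%R J -> phi (hamel R I J) = psi (hamel R I J)) ->
  phi = psi.
Proof.
move=> sphi spsi [c hc] [d hd] e.
have span Y : linspan (@hamels R) Y -> phi Y = psi Y.
  apply: (@linspan_ind _ _ [set Y | phi Y = psi Y]).
  - by rewrite /= !scalar_0.
  - by move=> k X X' /= h h'; rewrite sphi spsi h h'.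
  - by move=> _ [I [J [sI sJ ->]]]; exact: e.
apply/funext => X; apply/eqP; rewrite -subr_eq0; apply/eqP/modsq_eq0.
apply/eqP; rewrite eq_le modsq_ge0 andbT.
apply: (@le_geometric _ (2 * `|c| + 2 * `|d|)) => n; rewrite add0r.
have [Y hY XY] := hamels_dense X (half_gt0 R n).
have -> : phi X - psi X = phi (X - Y) + - psi (X - Y).
  by rewrite !scalarB// (span _ hY) opprB addrA subrK.
apply: (le_trans (modsqD2 _ _)); rewrite modsqN.
have h1 : opnorm (X - Y) ^+ 2 <= 2^-1 ^+ n.
  have hn : (2^-1 : R) ^+ n <= 1 by rewrite exprn_ile1// invf_le1// ler1n.
  have o0 := opnorm_ge0 (X - Y).
  rewrite (le_trans _ (ltW XY))// expr2 -[leRHS]mul1r.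
  by apply: ler_wpM2r => //; apply: le_trans (ltW XY) hn.
have bnd (k : R) (z : C) : modsq z <= k * opnorm (X - Y) ^+ 2 ->
    modsq z <= `|k| * 2^-1 ^+ n.
  move=> hz; apply: (le_trans hz).
  apply: (@le_trans _ _ (`|k| * opnorm (X - Y) ^+ 2)).
    by apply: ler_wpM2r; [exact: sqr_ge0|exact: ler_norm].
  exact: ler_wpM2l.
have := bnd _ _ (hc (X - Y)); have := bnd _ _ (hd (X - Y)); lra.
Qed.

Lemma opnormZr (r : R) (X : bop R) : opnorm (r%:C *: X) <= `|r| * opnorm X.
Proof.
by rewrite (le_trans (opnormZ_le _ _))// /modsq /= expr0n addr0 sqrtr_sqr.
Qed.

Lemma opnorm1_le : opnorm (1 : bop R) <= 1.
Proof. by apply: opnorm_le => // v; rewrite mul1r. Qed.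

Lemma mon_normM (X Y : mon) : opnorm (X * Y) <= opnorm X * opnorm Y.
Proof. exact: opnormM. Qed.

Lemma mon_normD (X Y : mon) : opnorm (X + Y) <= opnorm X + opnorm Y.
Proof. exact: opnormD. Qed.

Lemma mon_normB (X Y : mon) : opnorm (X - Y) <= opnorm X + opnorm Y.
Proof. exact: opnormB. Qed.

Lemma mon_normZ (k : C) (X : mon) : opnorm (k *: X) <= Num.sqrt (modsq k) * opnorm X.
Proof. exact: opnormZ_le. Qed.

(** The square root of [1 - T] is [1 - Y], where [Y] is the fixed point of
    [Y |-> (T + Y^2) / 2]; on the ball of radius [1/2] this map is a contraction
    with ratio [1/2]. *)
Lemma sqrt_one_sub (T : mon) : is_adjoint T T -> opnorm T <= 3 / 4 ->
  exists2 Y : mon, is_adjoint Y Y & (1 - Y) * (1 - Y) = 1 - T.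
Proof.
move=> aT T34; pose h : C := (2^-1 : R)%:C.
pose step (Y : mon) : mon := h *: (T + Y * Y).
pose Y n := iter n step 0.
have hle (X : mon) (c : R) : opnorm X <= c -> opnorm (h *: X) <= 2^-1 * c.
  move=> Xc; apply: (le_trans (opnormZr _ _)); rewrite ger0_norm ?invr_ge0//.
  by rewrite ler_wpM2l ?invr_ge0.
have Y12 n : opnorm (Y n) <= 2^-1.
  elim: n => [|n IH]; first by rewrite opnorm0 invr_ge0.
  have yy : opnorm (Y n * Y n) <= 2^-1 * 2^-1.
    by apply: (le_trans (mon_normM _ _)); apply: ler_pM => //; exact: opnorm_ge0.
  have := @hle (T + Y n * Y n) 1; rewrite mulr1; apply.
  by apply: (le_trans (mon_normD _ _)); lra.
have sqB (A B : mon) : A * A - B * B = A * (A - B) + (A - B) * B.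
  by rewrite mulrBr mulrBl addrA subrK.
have stepB (A B : mon) : opnorm A <= 2^-1 -> opnorm B <= 2^-1 ->
    opnorm (step A - step B) <= 2^-1 * opnorm (A - B).
  move=> hA hB.
  have -> : step A - step B = h *: (A * A - B * B).
    by rewrite /step -scalerBr opprD addrACA subrr add0r.
  apply: hle; rewrite sqB; apply: (le_trans (mon_normD _ _)).
  have h1 : opnorm (A * (A - B)) <= 2^-1 * opnorm (A - B).
    by apply: (le_trans (mon_normM _ _)); apply: ler_wpM2r => //; exact: opnorm_ge0.
  have h2 : opnorm ((A - B) * B) <= opnorm (A - B) * 2^-1.
    by apply: (le_trans (mon_normM _ _)); apply: ler_wpM2l => //; exact: opnorm_ge0.
  lra.
have YS n : opnorm (Y n.+1 - Y n) <= 1 * 2^-1 ^+ n.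
  elim: n => [|n IH].
    rewrite expr0 /= mulr1 subr0; apply: le_trans (Y12 1%N) _.
    by rewrite invf_le1// ler1n.
  rewrite exprS mulrCA; apply: le_trans (stepB _ _ (Y12 n.+1) (Y12 n)) _.
  by rewrite ler_wpM2l ?invr_ge0.
have [Z ZP] := mon_geometric_cvg ler01 YS.
have Z12 : opnorm Z <= 2^-1.
  apply: (@le_geometric _ (3 * 1)) => n.
  have -> : monval Z = Y n + (Z - Y n) :> bop R by rewrite addrC subrK.
  apply: (le_trans (opnormD _ _)); apply: lerD; [exact: Y12|exact: ZP].
have fixZ : Z = step Z.
  apply/eqP; rewrite -subr_eq0; apply/eqP/val_inj.
  apply: (@opnorm_geometric_eq0 _ _ 6) => n.
  have -> : \val (Z - step Z) = monval (Z - Y n.+1) + monval (step (Y n) - step Z) :> bop R.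
    by rewrite -[RHS]/(monval (Z - Y n.+1 + (step (Y n) - step Z))) addrA subrK.
  apply: (le_trans (opnormD _ _)).
  have := ZP n.+1; have := stepB _ _ (Y12 n) Z12.
  have := ZP n; rewrite [opnorm (Y n - Z)]opnorm_distC exprS.
  have := half_gt0 R n; lra.
exists Z.
  have sa n : is_adjoint (Y n) (Y n).
    elim: n => [|n IH].
      exact: adjoint0.
    have hh : h = h^*%C by rewrite conjc_real.
    have := adjointP h (adjointP 1 aT (adjointM IH IH)) (@adjoint0 R).
    by rewrite !addr0 conjc1 !scale1r -hh.
  exact: (@adjoint_lim R Y Y Z Z (3 * 1)).
have ZZ : Z + Z = T + Z * Z.
  rewrite {1 2}fixZ /step -scalerDl (_ : h + h = 1) ?scale1r//.
  by rewrite /h -raddfD /=; congr (_%:C); lra.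
rewrite mulrBl mul1r mulrBr mulr1 opprB addrACA -opprD ZZ.
by rewrite opprD addrACA subrr addr0.
Qed.

Lemma state_selfadjoint_le1 (phi : mon -> C) (T : mon) : is_state phi ->
  is_adjoint T T -> opnorm T <= 3 / 4 ->
  complex.Im (phi T) = 0 /\ complex.Re (phi T) <= 1.
Proof.
move=> [sphi phi1 pos] aT T34; have [Y aY YT] := sqrt_one_sub aT T34.
have aY1 : is_adjoint (1 - Y) (1 - Y) := adjointB (@adjoint1 R) aY.
have := pos _ _ aY1; rewrite YT scalarB// phi1 lecE.
case: (phi T) => a b /= /andP[/eqP h1 h2].
by split; lra.
Qed.

(** Both [1 - T] and [1 + T] are squares of self-adjoint elements once [T] is
    scaled to norm at most [1/2]. *)
Lemma state_selfadjoint (phi : mon -> C) (T : mon) : is_state phi ->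
  is_adjoint T T ->
  complex.Im (phi T) = 0 /\ `|complex.Re (phi T)| <= 2 * opnorm T.
Proof.
move=> st aT; have [sphi _ _] := st.
have [T0|T0] := eqVneq (opnorm T) 0.
  have -> : T = 0 by apply/val_inj/opnorm_eq0.
  by rewrite scalar_0// opnorm0 mulr0 normr0.
have Tp : 0 < opnorm T by rewrite lt_neqAle eq_sym T0 opnorm_ge0.
pose r := (2 * opnorm T)^-1.
have r0 : 0 < r by rewrite invr_gt0 mulr_gt0.
have scaled (s : R) : `|s| = r -> complex.Im (phi (s%:C *: T)) = 0 /\
    complex.Re (phi (s%:C *: T)) <= 1.
  move=> sr; apply: state_selfadjoint_le1 => //.
    have := adjointP s%:C aT (@adjoint0 R).
    by rewrite conjc_real !addr0.
  apply: (le_trans (opnormZr _ _)); rewrite sr /r.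
  have -> : (2 * opnorm T)^-1 * opnorm T = 2^-1 by field.
  lra.
have [] := scaled r (gtr0_norm r0).
have [] := scaled (- r) (etrans (normrN _) (gtr0_norm r0)).
rewrite !scalar_Z//; case: (phi T) => a b /=.
rewrite !mul0r subr0 !addr0 !subr0 => _ h1 h2 h3.
have b0 : b = 0 by have /eqP := h2; rewrite mulf_eq0 gt_eqF//= => /eqP.
split => //.
have E : r * (2 * opnorm T) = 1 by rewrite mulVf// mulf_neq0.
have T2 : 0 < 2 * opnorm T by rewrite mulr_gt0.
rewrite -(ler_pM2l r0) E -[X in X * _](gtr0_norm r0) -normrM ler_norml h3.
by move: h1; rewrite mulNr; lra.
Qed.

(** Positivity controls a state on self-adjoint elements only, hence the
    decomposition into real and imaginary parts. *)
Lemma state_bounded (phi : mon -> C) : is_state phi -> bounded_functional phi.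
Proof.
move=> st; have [sphi _ _] := st; exists 8 => X.
have [Xs aX] := adjoint_exists X.
(* [X] is half of [(X + Xs) - I (I (X - Xs))]. *)
pose I : C := 0 +i* 1.
have nXs := opnorm_adjoint aX.
have aA : is_adjoint (X + Xs) (X + Xs).
  have := adjointP 1 aX (adjoint_sym aX).
  by rewrite conjc1 !scale1r [monval Xs + _]addrC.
have aB : is_adjoint (I *: (X - Xs)) (I *: (X - Xs)).
  have := adjointP I (adjointB aX (adjoint_sym aX)) (@adjoint0 R).
  rewrite !addr0.
  have -> : I^*%C *: (monval Xs - monval X) = I *: (monval X - monval Xs).
    rewrite -opprB scalerN -scaleNr; congr (_ *: _).
    by apply/eqP; rewrite eq_complex /= oppr0 opprK !eqxx.
  by [].
have [iA rA] := state_selfadjoint st aA.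
have [iB rB] := state_selfadjoint st aB.
have nA : opnorm (X + Xs) <= 2 * opnorm X.
  by apply: (le_trans (mon_normD _ _)); rewrite nXs; lra.
have nB : opnorm (I *: (X - Xs)) <= 2 * opnorm X.
  apply: (le_trans (opnormZ_le _ _)); rewrite /modsq /= expr0n add0r expr1n sqrtr1 mul1r.
  by apply: (le_trans (mon_normB _ _)); rewrite nXs; lra.
move: iA rA iB rB; rewrite scalar_D// scalar_Z// scalarB//.
case: (phi X) (phi Xs) => [a b] [c d] /= iA rA iB rB.
rewrite /modsq /=.
have ha : `|a| <= 2 * opnorm X.
  move: rA; have -> : a + c = 2 * a by lra.
  by rewrite normrM ger0_norm//; lra.
have hb : `|b| <= 2 * opnorm X.
  move: rB; have -> : 0 * (a - c) - 1 * (b - d) = - (2 * b) by lra.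
  by rewrite normrN normrM ger0_norm//; lra.
have sq (x : R) : `|x| <= 2 * opnorm X -> x ^+ 2 <= 4 * opnorm X ^+ 2.
  move=> hx; rewrite -(real_normK (num_real x)).
  have -> : 4 * opnorm X ^+ 2 = (2 * opnorm X) ^+ 2 by ring.
  by rewrite ler_sqr ?nnegrE ?mulr_ge0 ?opnorm_ge0.
by have := sq _ ha; have := sq _ hb; lra.
Qed.

End functionals.

(** * Amplifications *)

Section amplification.
Variables (R : realType) (K : choiceType).
Variables (label : incseq -> K) (part : incseq -> incseq).
Variable glue : K -> incseq -> option incseq.
Hypothesis glueE : forall k u s, (glue k u == Some s) = (label s == k) && (part s == u).

Lemma glueK s : glue (label s) (part s) = Some s.
Proof. by apply/eqP; rewrite glueE !eqxx. Qed.

Definition unglue k s := if label s == k then Some (part s) else None.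

Lemma glue_unglue k u s : (glue k u == Some s) = (unglue k s == Some u).
Proof. by rewrite glueE /unglue; case: ifP => //= _; rewrite (inj_eq Some_inj). Qed.

Definition slice k (v : fock R) : fock R := pull_ell2 (glue_unglue k) v.

Lemma sliceE k v u : slice k v u = if glue k u is Some s then v s else 0.
Proof. by []. Qed.

Lemma slice_linear k (a : R[i]) u v : slice k (a *: u + v) = a *: slice k u + slice k v.
Proof. exact: pull_linear. Qed.

Lemma esum_slices (a : K -> incseq -> \bar R) : (forall k u, (0 <= a k u)%E) ->
  \esum_(s in [set: incseq]) a (label s) (part s) =
  \esum_(k in [set: K]) \esum_(u in [set u | glue k u]) a k u.
Proof.
move=> a0; rewrite (@esum_esum _ _ _ setT (fun k => [set u | glue k u])); last first.
  by move=> k u _ _; exact: a0.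
rewrite (@reindex_esum R _ _ setT _ (fun s => (label s, part s))) //; split.
- by move=> s _; split => //=; rewrite glueK.
- by move=> s s' _ _ [e1 e2]; apply: Some_inj; rewrite -!glueK e1 e2.
- move=> [k u] [_ /=]; case E: (glue k u) => [s|] // _; exists s => //=.
  by move/eqP: E; rewrite glueE => /andP[/eqP -> /eqP ->].
Qed.

Definition amp_fun (X : bop R) (v : fock R) : incseq -> R[i] :=
  fun s => X (slice (label s) v) (part s).

(** The pieces are orthogonal, and on each of them the copy of [X] obeys the
    norm bound of [X]. *)
Lemma sqsum_amp X v : (sqsum (amp_fun X v) <= ((opnorm X * l2norm v) ^+ 2)%:E)%E.
Proof.
have sliced : \esum_(k in [set: K]) (l2norm (slice k v) ^+ 2)%:E = (l2norm v ^+ 2)%:E.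
  rewrite -sqsumE /sqsum.
  pose a k u := (if glue k u is Some s then modsq (v s) else 0)%:E.
  rewrite -[RHS](_ : \esum_(s in [set: incseq]) a (label s) (part s) = _); last first.
    by apply: eq_esum => s _; rewrite /a glueK.
  rewrite esum_slices; last first.
    by move=> k u; rewrite lee_fin; case: (glue k u) => // s; exact: modsq_ge0.
  apply: eq_esum => k _; rewrite -sqsumE [RHS]esum_mkcond; apply: eq_esum => u _.
  rewrite sliceE /a; case: ifPn; case E: (glue k u) => [s|] //.
    by rewrite modsq0.
  - by rewrite notin_setE /= E => /(_ isT).
  - by rewrite modsq0.
have sa : nnsum (fun k => l2norm (slice k v) ^+ 2).
  by split; [move=> k; exact: sqr_ge0|rewrite sliced ltry].
rewrite exprMn; have -> : l2norm v ^+ 2 = ssum (fun k => l2norm (slice k v) ^+ 2).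
  by rewrite /ssum sliced.
apply: le_trans (le_esumZ (sqr_ge0 (opnorm X)) sa).
rewrite /sqsum /amp_fun.
rewrite (esum_slices (a := fun k u => (modsq (X (slice k v) u))%:E)); last first.
  by move=> k u; rewrite lee_fin modsq_ge0.
apply: le_esum => k _; apply: (@le_trans _ _ (sqsum (X (slice k v)))).
  rewrite esum_mkcond; apply: le_esum => u _; case: ifP => // _.
  by rewrite lee_fin modsq_ge0.
rewrite sqsumE lee_fin -exprMn ler_sqr ?nnegrE ?l2norm_ge0 ?mulr_ge0 ?opnorm_ge0 ?l2norm_ge0//.
exact: opnormP.
Qed.

Lemma amp_subproof X v : amp_fun X v \in @square_summable R incseq.
Proof. exact: sqsum_finP (sqsum_amp X v). Qed.

Lemma amp_bounded X : (fun v => Ell2 (amp_subproof X v) : fock R) \in @bounded_linear R.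
Proof.
apply/asboolP; split.
  move=> a u v; apply/val_inj/funext => s /=; rewrite /amp_fun slice_linear.
  by rewrite (linearP X).
exists (opnorm X) => v; rewrite l2norm_le ?mulr_ge0 ?opnorm_ge0 ?l2norm_ge0//.
exact: sqsum_amp.
Qed.

(** Partitioning the basis into pieces, each embedded into the whole basis by
    [part], the amplification lets a copy of [X], compressed along this
    embedding, act on every piece. *)
Definition amp X : bop R := Bop (amp_bounded X).

Lemma ampE X v s : amp X v s = X (slice (label s) v) (part s).
Proof. by []. Qed.

Lemma amp_linear (a : R[i]) X Y : amp (a *: X + Y) = a *: amp X + amp Y.
Proof. by apply/val_inj/funext => v; apply/val_inj/funext => s. Qed.

Lemma opnorm_amp X : opnorm (amp X) <= opnorm X.
Proof.
apply: opnorm_le; first exact: opnorm_ge0.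
move=> v; rewrite l2norm_le ?mulr_ge0 ?opnorm_ge0 ?l2norm_ge0//.
exact: sqsum_amp.
Qed.

Lemma amp1 : amp 1 = 1.
Proof.
apply/val_inj/funext => v; apply/val_inj/funext => s.
by rewrite -[LHS]/(slice (label s) v (part s)) sliceE glueK.
Qed.

End amplification.

(** * The partial shift at the origin *)

Definition theta0 (k : int) : int := theta 0 k.
Definition theta0_inv (k : int) : int := if k < 0 then k else k - 1.

(** A sequence of integers splits at its entry [0]: the part before, pulled back
    along the partial shift, and the part from [0] on, which is a sequence that
    is empty or begins with [0]. *)
Definition pre0 (s : seq int) := map theta0_inv (take (index 0 s) s).
Definition post0 (s : seq int) := drop (index 0 s) s.
Definition zero_headed (k : seq int) := (k == [::]) || (ohead k == Some 0).

Lemma theta0_neq0 k : theta0 k != 0.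
Proof. by rewrite /theta0 /theta; case: ltP => h; apply/eqP; lia. Qed.

Lemma theta0K k : theta0_inv (theta0 k) = k.
Proof. by rewrite /theta0 /theta0_inv /theta; case: (ltP k 0) => h; case: ifP; lia. Qed.

Lemma theta0_invK k : k != 0 -> theta0 (theta0_inv k) = k.
Proof.
move=> /eqP k0; rewrite /theta0 /theta0_inv /theta.
by case: (ltP k 0) => h; case: ifP; lia.
Qed.

Lemma theta0_lt : {mono theta0 : x y / x < y}.
Proof.
by move=> x y; rewrite /theta0 /theta; case: (ltP x 0) => h; case: (ltP y 0) => h';
  apply/idP/idP; lia.
Qed.

Lemma theta0_lt0 k : (theta0 k < 0) = (k < 0).
Proof. by rewrite /theta0 /theta; case: (ltP k 0) => h; apply/idP/idP; lia. Qed.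

Lemma sorted_map_theta0 s : sorted <%R (map theta0 s) = sorted <%R s.
Proof. exact: (mono_sorted theta0_lt). Qed.

Lemma zero_notin_theta0 u : 0 \notin map theta0 u.
Proof. by apply/mapP => -[k _ /eqP]; rewrite eq_sym (negPf (theta0_neq0 k)). Qed.

Lemma zero_headed_index k : zero_headed k -> index 0 k = 0%N.
Proof. by case: k => // x k /orP[//|/eqP[->]]. Qed.

Lemma post0_zero_headed s : zero_headed (post0 s).
Proof.
rewrite /post0; have [s0|s0] := boolP (0 \in s).
  by rewrite (drop_nth 0) ?index_mem// nth_index// /zero_headed /= eqxx.
by rewrite memNindex// drop_size.
Qed.

Lemma pre0_post0 s : map theta0 (pre0 s) ++ post0 s = s.
Proof.
rewrite /pre0 -map_comp map_id_in ?cat_take_drop// => k kin /=.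
apply: theta0_invK; apply: contraL kin => /eqP ->.
have [s0|s0] := boolP (0 \in s); first by rewrite in_take// ltnn.
by rewrite memNindex// take_size.
Qed.

Lemma index0_cat u k : zero_headed k -> index 0 (map theta0 u ++ k) = size u.
Proof.
move=> zk; rewrite index_cat (negPf (zero_notin_theta0 u)) zero_headed_index//.
by rewrite addn0 size_map.
Qed.

Lemma pre0_cat u k : zero_headed k -> pre0 (map theta0 u ++ k) = u.
Proof.
move=> zk; rewrite /pre0 index0_cat// take_size_cat ?size_map//.
by rewrite -map_comp map_id_in// => x _ /=; exact: theta0K.
Qed.

Lemma post0_cat u k : zero_headed k -> post0 (map theta0 u ++ k) = k.
Proof. by move=> zk; rewrite /post0 index0_cat// drop_size_cat ?size_map. Qed.

Lemma sorted_catl (s1 s2 : seq int) : sorted <%R (s1 ++ s2) -> sorted <%R s1.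
Proof. by case: s1 => //= x s1; rewrite cat_path => /andP[]. Qed.

Lemma pre0_sorted (s : incseq) : sorted <%R (pre0 (val s)).
Proof.
by rewrite -sorted_map_theta0; apply: (@sorted_catl _ (post0 (val s)));
  rewrite pre0_post0 (valP s).
Qed.

Definition part0 (s : incseq) : incseq := Sub (pre0 (val s)) (pre0_sorted s).
Definition label0 (s : incseq) : seq int := post0 (val s).
Definition glue0 (k : seq int) (u : incseq) : option incseq :=
  if zero_headed k then insub (map theta0 (val u) ++ k) else None.

Lemma glue0E k u s : (glue0 k u == Some s) = (label0 s == k) && (part0 s == u).
Proof.
rewrite /glue0; apply/idP/andP.
  case: ifPn => // zk; case: insubP => // t _ te /eqP[<-].
  rewrite /label0 -val_eqE /= te post0_cat// pre0_cat//.
move=> [/eqP <- /eqP <-]; rewrite post0_zero_headed /= pre0_post0.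
by rewrite valK.
Qed.

Section partial_shift.
Variable R : realType.
Local Notation C := R[i].
Local Notation mon := (mon R).
Local Notation anni := (anni R).
Local Notation crea := (crea R).
Local Notation amp0 := (@amp R _ label0 part0 glue0 glue0E).
Local Notation slice0 := (@slice R _ label0 part0 glue0 glue0E).

Lemma pre0_cons i s : pre0 (theta0 i :: s) = i :: pre0 s.
Proof. by rewrite /pre0 /= (negPf (theta0_neq0 i)) /= theta0K. Qed.

Lemma post0_cons i s : post0 (theta0 i :: s) = post0 s.
Proof. by rewrite /post0 /= (negPf (theta0_neq0 i)). Qed.

Lemma amp0_crea i X : amp0 (crea_op R i * X) = crea_op R (theta0 i) * amp0 X.
Proof.
apply/val_inj/funext => v; apply/val_inj/funext => s.
rewrite -[LHS]/(pull (cre_dom i) (X (slice0 (label0 s) v)) (part0 s)).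
rewrite -[RHS]/(pull (cre_dom (theta0 i)) (amp0 X v) s) /pull.
case E': (cre_dom (theta0 i) s) => [s'|].
  move/eqP: E'; rewrite cre_domE => /eqP E'.
  have -> : cre_dom i (part0 s) = Some (part0 s').
    by apply/eqP; rewrite cre_domE /= E' pre0_cons.
  by rewrite ampE /label0 E' post0_cons.
case E: (cre_dom i (part0 s)) => [u|] //.
move/eqP: E; rewrite cre_domE => /eqP E.
have sE : val s = theta0 i :: (map theta0 (val u) ++ post0 (val s)).
  by rewrite -{1}(pre0_post0 (val s)) -[pre0 _]/(val (part0 s)) E.
have st : sorted <%R (map theta0 (val u) ++ post0 (val s)).
  by have := valP s; rewrite {1}sE /= => /path_sorted.
have : cre_dom (theta0 i) s == Some (Sub (map theta0 (val u) ++ post0 (val s)) st).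
  by rewrite cre_domE /= -sE.
by rewrite E'.
Qed.

(** Both sides prepend [theta0 i] to the glued sequence. *)
Lemma glue0_ann k u i :
  obind (glue0 k) (ann_dom i u) = obind (ann_dom (theta0 i)) (glue0 k u).
Proof.
have E1 : obind (glue0 k) (ann_dom i u) =
    if zero_headed k then insub (theta0 i :: map theta0 (val u) ++ k) else None.
  rewrite /ann_dom; case: insubP => [t _ te|nu] /=.
    by rewrite /glue0 te.
  case: ifP => // _; rewrite insubF//; apply: contraNF nu => h.
  rewrite -sorted_map_theta0 /=.
  by have := @sorted_catl (theta0 i :: map theta0 (val u)) k h.
rewrite E1 /glue0; case: ifP => // _ /=.
have [sw|nsw] := boolP (sorted <%R (map theta0 (val u) ++ k)).
  by rewrite [in RHS]insubT /= /ann_dom SubK.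
rewrite [in RHS]insubN//= insubN//.
by apply: contra nsw => /path_sorted.
Qed.

Lemma amp0_anni i X : amp0 (X * anni_op R i) = amp0 X * anni_op R (theta0 i).
Proof.
apply/val_inj/funext => v; apply/val_inj/funext => s.
rewrite -[LHS]/(X (anni_op R i (slice0 (label0 s) v)) (part0 s)).
rewrite -[RHS]/(X (slice0 (label0 s) (anni_op R (theta0 i) v)) (part0 s)).
congr (ell2val (X _) _); apply/val_inj/funext => u.
rewrite -[LHS]/(pull (ann_dom i) (slice0 (label0 s) v) u).
rewrite -[RHS]/(if glue0 (label0 s) u is Some t then pull (ann_dom (theta0 i)) v t else 0).
rewrite /pull; have := glue0_ann (label0 s) u i.
case: (ann_dom i u) => [t|] /=; case: (glue0 _ u) => [t'|] //= e.
- by rewrite -[LHS]/(if glue0 (label0 s) t is Some s1 then v s1 else 0) e.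
- by rewrite -[LHS]/(if glue0 (label0 s) t is Some s1 then v s1 else 0) e.
- by rewrite -e.
Qed.

Definition head0_proj : mon := crea 0 * anni 0.

Lemma head0_projE (v : fock R) s :
  head0_proj v s = if ohead (val s) == Some 0 then v s else 0.
Proof.
rewrite -[LHS]/(pull (cre_dom 0) (pull (ann_dom 0) v) s) (pull_pull (cre_ann 0)).
congr (if _ then _ else _); rewrite /cre_dom; case: ifP => // _.
by case: insubP => // /negP[]; case: s => -[|x s] //= /path_sorted.
Qed.

(** A sequence with first part empty passes the test on that part for every [i];
    if it begins with [0], it lies above [theta0 i] only when [i < 0]. *)
Lemma amp0_tailproj i : amp0 (monval (tailproj R i)) =
  monval (tailproj R (theta0 i)) + (if 0 <= i then monval head0_proj else 0).
Proof.
apply/val_inj/funext => v; apply/val_inj/funext => s.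
transitivity (tailproj R (theta0 i) v s + (if 0 <= i then head0_proj v s else 0)); last first.
  by case: ifP.
rewrite -[LHS]/(tailproj R i (slice0 (label0 s) v) (part0 s)).
rewrite !tailprojE head0_projE sliceE (glueK glue0E).
rewrite -[val (part0 s)]/(pre0 (val s)).
have zk := post0_zero_headed (val s); have e := pre0_post0 (val s).
have sw := valP s; move: (v s) sw => z; move: e zk (pre0_sorted s).
move: (pre0 _) (post0 _) => p k; move: (val s) => _ <- {s}.
case: p => [|x p] zk sp sw.
  rewrite /= in sw *.
  case: k zk sw => [|y k]; first by rewrite /= if_same addr0.
  rewrite /zero_headed /= => /eqP[->] ->; rewrite theta0_lt0 andbT eqxx.
  by case: ltP => _; rewrite ?addr0 ?add0r.
have -> : (ohead (map theta0 (x :: p) ++ k) == Some 0) = false.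
  by rewrite /= (inj_eq Some_inj) (negPf (theta0_neq0 x)).
rewrite if_same addr0; congr (if _ then _ else _).
move: sp sw; rewrite /= => -> ->.
by rewrite theta0_lt.
Qed.

(** * The bounded extension of the partial shift *)

Definition vac : incseq := Sub [::] isT.
Definition sng (n : int) : incseq := Sub [:: n] isT.

Definition coef (s : incseq) (X : bop R) : C := X (basis R s) s.

Lemma coef_linear s (a : C) X Y : coef s (a *: X + Y) = a * coef s X + coef s Y.
Proof. by []. Qed.

Lemma l2norm_basis s : l2norm (basis R s) <= 1.
Proof.
have e : l2norm (basis R s) ^+ 2 = 1.
  by rewrite -Re_inner_self inner_delta basisE eqxx.
by rewrite -(@ler_pXn2r _ 2)// ?nnegrE ?l2norm_ge0// e expr1n.
Qed.

Lemma modsq_coef s X : modsq (coef s X) <= opnorm X ^+ 2.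
Proof.
apply: (le_trans (modsq_coord_le _ _)).
rewrite ler_sqr ?nnegrE ?l2norm_ge0 ?opnorm_ge0//.
apply: (le_trans (opnormP _ _)); rewrite -[leRHS]mulr1.
by rewrite ler_wpM2l ?opnorm_ge0 ?l2norm_basis.
Qed.

Lemma prod_crea_cons i I (w : fock R) s :
  ohead (val s) != Some i -> (\prod_(j <- i :: I) crea j) w s = 0.
Proof.
move=> si; rewrite big_cons.
rewrite -[LHS]/(pull (cre_dom i) ((\prod_(j <- I) crea j) w) s) /pull.
by rewrite /cre_dom (negPf si).
Qed.

Lemma prod_anni_rcons j J s :
  ohead (val s) != Some j -> (\prod_(k <- rcons J j) anni k) (basis R s) = 0.
Proof.
move=> sj; rewrite big_rcons /=.
rewrite -[LHS]/((\prod_(k <- J) anni k) (anni_op R j (basis R s))).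
by rewrite anni_basis (negPf sj) linear0.
Qed.

(** A nonempty word either annihilates the vacuum or has its range orthogonal to
    it. *)
Lemma coef_word_vac I J : coef vac (word R I J) = (nilp I && nilp J)%:R.
Proof.
case: I => [|i I].
  case/lastP: J => [|J j]; first by rewrite /coef /word !big_nil mulr1.
  rewrite [nilp _ && _]/= /nilp size_rcons /coef /word.
  by rewrite big_nil mul1r prod_anni_rcons.
rewrite /= /coef /word.
by rewrite -[LHS]/((\prod_(j <- i :: I) crea j) ((\prod_(j <- J) anni j) (basis R vac))
  vac) prod_crea_cons.
Qed.

Lemma prod_anni_vac J : J != [::] -> (\prod_(j <- J) anni j) (basis R vac) = 0.
Proof. by case/lastP: J => // J j _; rewrite prod_anni_rcons. Qed.

Lemma prod_anni_sng n J : J != [::] -> J != [:: n] ->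
  (\prod_(j <- J) anni j) (basis R (sng n)) = 0.
Proof.
case/lastP: J => // J j _; have [->|jn] := eqVneq j n; last first.
  by rewrite prod_anni_rcons//= (inj_eq Some_inj) eq_sym.
case: J => [|j' J _]; first by rewrite eqxx.
rewrite big_rcons.
rewrite -[LHS]/((\prod_(k <- j' :: J) anni k) (anni_op R n (basis R (sng n)))).
rewrite anni_basis /= eqxx insubT.
rewrite (_ : Sub _ _ = vac); last exact: val_inj.
exact: prod_anni_vac.
Qed.

Lemma coef_word_sng n I J :
  ~ (I = [:: n] /\ J = [:: n]) -> coef (sng n) (word R I J) = (nilp I && nilp J)%:R.
Proof.
move=> IJ; rewrite /coef /word.
rewrite -[LHS]/((\prod_(j <- I) crea j) ((\prod_(j <- J) anni j) (basis R (sng n))) (sng n)).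
have [->|J0] := eqVneq J [::].
  case: I {IJ} => [|i I]; first by rewrite !big_nil -[LHS]/(basis R (sng n) (sng n)) basisE
    eqxx.
  rewrite big_nil [RHS]/=.
  have [->|ni] := eqVneq n i; last by rewrite prod_crea_cons//= (inj_eq Some_inj).
  rewrite big_cons.
  rewrite -[LHS]/(pull (cre_dom i) ((\prod_(j <- I) crea j) (basis R (sng i))) (sng i)).
  rewrite /pull; case E : (cre_dom i (sng i)) => [t|] //.
  move/eqP: E; rewrite cre_domE => /eqP /= [te].
  case: I => [|j I]; last by rewrite prod_crea_cons//= -te.
  by rewrite big_nil -[LHS]/(basis R (sng i) t) basisE -val_eqE /= -te.
have -> : nilp J = false by rewrite /nilp size_eq0 (negPf J0).
rewrite andbF.
have [Jn|Jn] := eqVneq J [:: n]; last first.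
  by rewrite prod_anni_sng// linear0.
rewrite Jn big_seq1 -[monval (anni n) _]/(anni_op R n _) anni_basis /= eqxx insubT.
rewrite (_ : Sub _ _ = vac); last exact: val_inj.
case: I IJ => [|i I] IJ.
  by rewrite big_nil -[LHS]/(basis R vac (sng n)) basisE -val_eqE.
have [ni|ni] := eqVneq n i; last by rewrite prod_crea_cons//= (inj_eq Some_inj).
rewrite big_cons -[LHS]/(pull (cre_dom i) ((\prod_(j <- I) crea j) (basis R vac)) (sng n)).
rewrite /pull; case E : (cre_dom i (sng n)) => [t|] //.
move/eqP: E; rewrite cre_domE => /eqP /= [_ te].
case: I IJ => [|j I] IJ; last by rewrite prod_crea_cons//= -te.
by case: IJ; rewrite Jn ni.
Qed.

(** The amplification sends every Hamel word where it should go, except that it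
    adds the projection [a_0^+ a_0] to the image of [a_i a_i^+] when [i >= 0].
    The difference of the coefficients at [Omega] and at [e_0] detects precisely
    these words. *)
Definition shift_ext (X : bop R) : bop R :=
  amp0 X - (coef vac X - coef (sng 0) X) *: monval head0_proj.

Lemma shift_ext_linear (a : C) X Y :
  shift_ext (a *: X + Y) = a *: shift_ext X + shift_ext Y.
Proof.
have lin (V : lmodType C) (A B Q : V) (p q p' q' : C) :
    a *: A + B - ((a * p + p') - (a * q + q')) *: Q =
    a *: (A - (p - q) *: Q) + (B - (p' - q') *: Q).
  rewrite scalerBr scalerA addrACA -opprD -scalerDl; congr (_ - _ *: _).
  by rewrite mulrBr opprD addrACA.
rewrite /shift_ext (amp_linear glue0E a X Y) (coef_linear vac a X Y).
rewrite (coef_linear (sng 0) a X Y).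
move: (coef vac X) (coef vac Y) (coef (sng 0) X) (coef (sng 0) Y) => p p' q q'.
move: (amp0 X) (amp0 Y) (monval head0_proj) => A B Q.
exact: (lin (bop R) A B Q p q p' q').
Qed.

Lemma shift_ext0 : shift_ext 0 = 0.
Proof.
by have := shift_ext_linear (-1) 0 0; rewrite scaler0 addr0 scaleN1r addNr.
Qed.

Lemma shift_ext_bounded : exists2 c : R, 0 <= c &
  forall X, opnorm (shift_ext X) <= c * opnorm X.
Proof.
exists (1 + 2 * opnorm head0_proj); first by rewrite addr_ge0// mulr_ge0// opnorm_ge0.
move=> X; apply: (le_trans (opnormB _ _)); rewrite mulrDl mul1r.
apply: lerD; first exact: opnorm_amp.
apply: (le_trans (opnormZ_le _ _)).
rewrite [leRHS]mulrAC; apply: ler_wpM2r; first exact: opnorm_ge0.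
have o0 := opnorm_ge0 X.
rewrite -(ger0_norm (_ : 0 <= 2 * opnorm X)) ?mulr_ge0// -sqrtr_sqr.
apply: ler_wsqrtr; apply: (le_trans (modsqD2 _ _)); rewrite modsqN.
by have := modsq_coef vac X; have := modsq_coef (sng 0) X; lra.
Qed.

Lemma amp0_word I J : amp0 (monval (word R I J)) =
  monval (word R (map theta0 I) (map theta0 J)).
Proof.
rewrite /word; elim: I => [|i I IH]; last first.
  by rewrite /= !big_cons -!mulrA -[LHS]/(amp0 (crea_op R i * _)) amp0_crea IH.
rewrite /= !big_nil !mul1r; elim/last_ind: J => [|J j IH].
  by rewrite !big_nil [LHS]amp1.
rewrite map_rcons !big_rcons /=.
by rewrite -[LHS]/(amp0 (_ * anni_op R j)) amp0_anni IH.
Qed.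

Lemma coef_tailproj s i : coef s (tailproj R i) = (sorted <%R (i :: val s))%:R.
Proof. by rewrite /coef tailprojE basisE eqxx; case: ifP. Qed.

Lemma map_theta0_sng I i : map theta0 I = [:: i] -> exists2 j, I = [:: j] & i = theta0 j.
Proof. by case: I => [|j [|? ?]] //= [<-]; exists j. Qed.

Lemma theta0_inj : injective theta0.
Proof. exact: can_inj theta0K. Qed.

Lemma shift_ext_hamel I J :
  shift_ext (monval (hamel R I J)) = monval (hamel R (map theta0 I) (map theta0 J)).
Proof.
have [[i [-> ->]]|nIJ] := pselect (exists i, I = [:: i] /\ J = [:: i]).
  rewrite /= !eqxx -[anni i * crea i]/(tailproj R i).
  rewrite /shift_ext amp0_tailproj !coef_tailproj /= andbT.
  rewrite -addrA [X in _ + X](_ : _ = 0) ?addr0//.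
  by case: ltP => _; rewrite ?subrr ?scale0r ?subr0 ?scale1r ?subrr.
have nIJ' : forall i, ~ (map theta0 I = [:: i] /\ map theta0 J = [:: i]).
  move=> i [/map_theta0_sng[j Ij ->] /map_theta0_sng[k Jk /theta0_inj jk]].
  by apply: nIJ; exists j; rewrite Ij Jk jk.
rewrite !hamel_word//; last by move=> i h; apply: nIJ; exists i.
rewrite /shift_ext amp0_word coef_word_vac coef_word_sng; last first.
  by move=> h; apply: nIJ; exists 0.
by rewrite subrr scale0r subr0.
Qed.

(** The extension preserves the span of the Hamel words, and is continuous. *)
Lemma shift_ext_mon (X : mon) : shift_ext (monval X) \in @mon_pred R.
Proof.
have [c c0 hc] := shift_ext_bounded.
have /choice[Z ZP] : forall n, exists Z : mon,
    opnorm (shift_ext (monval X) - monval Z) <= c * 2^-1 ^+ n.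
  move=> n; have [Y hY XY] := hamels_dense X (half_gt0 R n).
  have [Z ZE] : exists Z : mon, monval Z = shift_ext (monval Y).
    move: Y hY {XY}; apply: linspan_ind.
    - by exists 0; rewrite -[monval 0]/(0 : bop R) shift_ext0.
    - move=> k Y1 Y2 [Z1 E1] [Z2 E2]; exists (k *: Z1 + Z2).
      by rewrite -[LHS]/(k *: monval Z1 + monval Z2) E1 E2 -shift_ext_linear.
    - move=> _ [I [J [_ _ ->]]]; exists (hamel R (map theta0 I) (map theta0 J)).
      by rewrite shift_ext_hamel.
  exists Z; rewrite ZE.
  have -> : shift_ext (monval X) - shift_ext (monval Y) = shift_ext (monval (X - Y)).
    rewrite addrC -scaleN1r -shift_ext_linear; congr shift_ext.
    by rewrite scaleN1r addrC.
  by apply: (le_trans (hc _)); apply: ler_wpM2l => //; exact: ltW.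
exact: mon_closed ZP.
Qed.

(** On the Hamel basis the partial shift is not multiplicative, but it is still
    bounded, being a corrected amplification. *)
Lemma theta_extension : exists G : mon -> mon, bounded_extension (theta 0) G.
Proof.
exists (fun X => Mon (shift_ext_mon X)); split.
- move=> a X Y; apply/val_inj; exact: shift_ext_linear.
- by have [c _ hc] := shift_ext_bounded; exists c => X; exact: hc.
- by move=> I J _ _; apply/val_inj; exact: shift_ext_hamel.
Qed.

End partial_shift.

(** * The action of the partial shifts *)

Section action.
Variable R : realType.
Local Notation C := R[i].
Local Notation mon := (mon R).
Local Notation anni := (anni R).
Local Notation crea := (crea R).

Lemma adM k (X Y : mon) : ad k (X * Y) = ad k X * ad k Y.
Proof.
apply/val_inj.
rewrite -[LHS]/(shift_op R k * (monval X * monval Y) * shift_op R (- k)).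
rewrite -[RHS]/((shift_op R k * monval X * shift_op R (- k)) *
  (shift_op R k * monval Y * shift_op R (- k))).
by rewrite -!mulrA (mulrA (shift_op R (- k))) shift_opK mul1r.
Qed.

Lemma ad1 k : ad k (1 : mon) = 1.
Proof.
apply/val_inj; rewrite -[LHS]/(shift_op R k * 1 * shift_op R (- k)) mulr1.
by have := shift_opK R (- k); rewrite opprK.
Qed.

Lemma ad_linear k (a : C) (X Y : mon) : ad k (a *: X + Y) = a *: ad k X + ad k Y.
Proof.
apply/val_inj.
rewrite -[LHS]/(shift_op R k * (a *: monval X + monval Y) * shift_op R (- k)).
rewrite -[RHS]/(a *: (shift_op R k * monval X * shift_op R (- k)) +
  shift_op R k * monval Y * shift_op R (- k)).
by rewrite mulrDr mulrDl -scalerAr -scalerAl.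
Qed.

Lemma l2norm_shift k (v : fock R) : l2norm (shift_op R k v) <= l2norm v.
Proof. exact: l2norm_pull. Qed.

Lemma opnorm_ad k (X : mon) : opnorm (ad k X) <= opnorm X.
Proof.
apply: opnorm_le; first exact: opnorm_ge0.
move=> v; apply: (le_trans (l2norm_shift k (X (shift_op R (- k) v)))).
apply: (le_trans (opnormP X _)).
apply: ler_wpM2l; [exact: opnorm_ge0|exact: l2norm_shift].
Qed.

Lemma ad_anni k i : ad k (anni i) = anni (i + k).
Proof. by apply/val_inj; exact: shift_anni. Qed.

Lemma ad_crea k i : ad k (crea i) = crea (i + k).
Proof.
apply/val_inj; apply: (adjoint_uniq (X := anni_op R (i + k))); last exact: anni_crea_adjoint.
rewrite -shift_anni -[\val _]/(shift_op R k * crea_op R i * shift_op R (- k)).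
have adj := @shift_adjoint R.
have := adjointM (adjointM (adj k) (@anni_crea_adjoint R i)) (adj (- k)).
by rewrite opprK mulrA.
Qed.

Lemma ad_word k I J :
  ad k (word R I J) = word R (map (fun i => i + k) I) (map (fun j => j + k) J).
Proof.
have adprod (a : int -> mon) L : (forall i, ad k (a i) = a (i + k)) ->
    ad k (\prod_(i <- L) a i) = \prod_(i <- map (fun i => i + k) L) a i.
  move=> aE; elim: L => [|i L IH]; first by rewrite !big_nil ad1.
  by rewrite /= !big_cons adM aE IH.
by rewrite /word adM (adprod _ _ (ad_crea k)) (adprod _ _ (ad_anni k)).
Qed.

Lemma map_sng (f : int -> int) I i : injective f -> map f I = [:: f i] -> I = [:: i].
Proof. by move=> fI; case: I => [|j [|? ?]] //= [/fI ->]. Qed.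

Lemma ad_hamel k I J :
  ad k (hamel R I J) = hamel R (map (fun i => i + k) I) (map (fun j => j + k) J).
Proof.
have [[i [-> ->]]|nIJ] := pselect (exists i, I = [:: i] /\ J = [:: i]).
  by rewrite /= !eqxx adM ad_anni ad_crea.
rewrite !hamel_word ?ad_word//; last by move=> i h; apply: nIJ; exists i.
move=> i [hI hJ]; apply: nIJ; exists (i - k).
by split; apply: (@map_sng (fun i => i + k)); rewrite ?subrK//; exact: addIr.
Qed.

Lemma bounded_extension_comp f g F G :
  {homo g : x y / x < y} ->
  bounded_extension f F -> bounded_extension g G ->
  @bounded_extension R (f \o g) (F \o G).
Proof.
move=> gm [Fl [c Fc] Fh] [Gl [d Gd] Gh]; split.
- by move=> a X Y /=; rewrite Gl Fl.
- exists (`|c| * d) => X /=; apply: (le_trans (Fc _)).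
  apply: (@le_trans _ _ (`|c| * opnorm (G X))).
    by apply: ler_wpM2r; [exact: opnorm_ge0|exact: ler_norm].
  by rewrite -mulrA ler_wpM2l.
- move=> I J sI sJ; rewrite -[LHS]/(F (G (hamel R I J))) (Gh _ _ sI sJ).
  rewrite (map_comp f g I) (map_comp f g J).
  apply: Fh; first exact: homo_sorted sI.
  by apply: homo_sorted sJ => x y; exact: gm.
Qed.

Lemma ad_extension k : @bounded_extension R (fun i => i + k) (ad k).
Proof.
split.
- exact: ad_linear.
- by exists 1 => X; rewrite mul1r; exact: opnorm_ad.
- by move=> I J _ _; exact: ad_hamel.
Qed.

Lemma addr_homo (k : int) : {homo (fun i => i + k) : x y / x < y}.
Proof. by move=> x y; rewrite ltrD2r. Qed.

Lemma theta_homo h : {homo theta h : x y / x < y}.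
Proof.
by move=> x y; rewrite /theta; case: (ltP x h) => hx; case: (ltP y h) => hy; lia.
Qed.

Lemma psi_homo h : {homo psi h : x y / x < y}.
Proof.
by move=> x y; rewrite /psi; case: (ltP h x) => hx; case: (ltP h y) => hy; lia.
Qed.

Lemma beta0_spec : bounded_extension (theta 0) (@beta0 R).
Proof. by have [G hG] := theta_extension R; exact: (xgetPex _ (ex_intro _ G hG)). Qed.

(** The backward partial shift at [0] is the forward one preceded by
    [k |-> k - 1]. *)
Lemma psi_extension : exists G, @bounded_extension R (psi 0) G.
Proof.
exists (@beta0 R \o ad (- 1)).
rewrite (_ : psi 0 = theta 0 \o (fun i => i + - 1)).
  by apply: bounded_extension_comp; [exact: addr_homo|exact: beta0_spec|exact: ad_extension].
by apply/funext => i /=; rewrite /psi /theta; case: (ltP 0 i); case: ifP; lia.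
Qed.

Lemma gamma0_spec : bounded_extension (psi 0) (@gamma0 R).
Proof. by have [G hG] := psi_extension; exact: (xgetPex _ (ex_intro _ G hG)). Qed.

Lemma beta_spec k : bounded_extension (theta k) (@beta R k).
Proof.
rewrite (_ : theta k = ((fun i => i + k) \o theta 0) \o (fun i => i + - k)); last first.
  by apply/funext => i /=; rewrite /theta; case: (ltP i k); case: ifP; lia.
apply: bounded_extension_comp; [exact: addr_homo| |exact: ad_extension].
by apply: bounded_extension_comp; [exact: theta_homo|exact: ad_extension|exact: beta0_spec].
Qed.

Lemma gamma_spec k : bounded_extension (psi k) (@gamma R k).
Proof.
rewrite (_ : psi k = ((fun i => i + k) \o psi 0) \o (fun i => i + - k)); last first.
  by apply/funext => i /=; rewrite /psi; case: (ltP k i); case: ifP; lia.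
apply: bounded_extension_comp; [exact: addr_homo| |exact: ad_extension].
by apply: bounded_extension_comp; [exact: psi_homo|exact: ad_extension|exact: gamma0_spec].
Qed.

(** The values that an invariant state takes on the Hamel words, where [x] is
    its common value on the [a_i a_i^+]. *)
Definition hamel_val (x : C) (I J : seq int) : C :=
  if nilp I && nilp J then 1 else if (size I == 1)%N && (I == J) then x else 0.

Lemma hamel_val_map x f I J : injective f ->
  hamel_val x (map f I) (map f J) = hamel_val x I J.
Proof.
by move=> fI; rewrite /hamel_val /nilp !size_map (inj_eq (inj_map fI)).
Qed.

Definition has_hamel_val x (phi : mon -> C) :=
  forall I J, sorted <%R I -> sorted >%R J -> phi (hamel R I J) = hamel_val x I J.

Lemma homo_lt_inj (f : int -> int) : {homo f : x y / x < y} -> injective f.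
Proof.
move=> fm x y fxy; have [/fm|/fm|//] := ltgtP x y; by rewrite fxy ltxx.
Qed.

(** An injective relabelling preserves equality and size of index lists, hence
    the prescribed values; boundedness carries this to the whole algebra. *)
Lemma hamel_val_extension (phi : mon -> C) x f G :
  scalar phi -> bounded_functional phi -> has_hamel_val x phi ->
  {homo f : x y / x < y} -> bounded_extension f G -> phi \o G = phi.
Proof.
move=> sphi [c pc] phx fm [Gl [d Gd] Gh]; apply: functional_ext => //.
- by move=> a X Y /=; rewrite Gl sphi.
- exists (`|c| * d ^+ 2) => X /=; apply: (le_trans (pc _)).
  apply: (@le_trans _ _ (`|c| * opnorm (G X) ^+ 2)).
    by apply: ler_wpM2r; [exact: sqr_ge0|exact: ler_norm].
  rewrite -mulrA ler_wpM2l// -exprMn.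
  have o1 := opnorm_ge0 (G X); have := Gd X => o2.
  by rewrite ler_sqr ?nnegrE//; exact: le_trans o1 o2.
- by exists c.
- move=> I J sI sJ; rewrite -[LHS]/(phi (G (hamel R I J))) (Gh _ _ sI sJ).
  have sI' : sorted <%R (map f I) by exact: homo_sorted sI.
  have sJ' : sorted >%R (map f J) by apply: homo_sorted sJ => y z; exact: fm.
  rewrite (phx _ _ sI' sJ') (phx _ _ sI sJ); apply: hamel_val_map.
  exact: homo_lt_inj.
Qed.

Lemma hamel_val_invariant (phi : mon -> C) x :
  scalar phi -> bounded_functional phi -> has_hamel_val x phi ->
  spreading_invariant phi.
Proof.
move=> sphi bphi hphi g G; elim=> [//|k {}g {}G _ IH|k {}g {}G _ IH].
  rewrite -[LHS]/((phi \o beta k) \o G).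
  by rewrite (hamel_val_extension sphi bphi hphi (@theta_homo k) (beta_spec k)).
rewrite -[LHS]/((phi \o gamma k) \o G).
by rewrite (hamel_val_extension sphi bphi hphi (@psi_homo k) (gamma_spec k)).
Qed.

End action.

(** * Invariant states on the Hamel words *)

Section averaging.
Variable R : realType.
Local Notation C := R[i].
Local Notation mon := (mon R).
Local Notation anni := (anni R).
Local Notation crea := (crea R).

(** The nontrivial half of the [C^*]-identity. *)
Lemma opnorm_sqr (X Y : bop R) : is_adjoint X Y -> opnorm X ^+ 2 <= opnorm (Y * X).
Proof.
move=> h; have o0 := opnorm_ge0 (Y * X).
rewrite -[leRHS](sqr_sqrtr o0) ler_sqr ?nnegrE ?opnorm_ge0 ?sqrtr_ge0//.
apply: opnorm_le; first exact: sqrtr_ge0.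
move=> v; rewrite -(@ler_pXn2r _ 2)// ?nnegrE ?l2norm_ge0 ?mulr_ge0 ?sqrtr_ge0 ?l2norm_ge0//.
rewrite exprMn (sqr_sqrtr o0) -Re_inner_self h innerC.
have -> : complex.Re (inner (Y (X v)) v)^*%C = complex.Re (inner ((Y * X) v) v).
  by case: (inner _ _).
apply: (le_trans (ler_norm _)); apply: (le_trans (norm_Re_inner _ _)).
rewrite expr2 mulrA; apply: ler_wpM2r; [exact: l2norm_ge0|exact: opnormP].
Qed.

Lemma opnorm_crea i : opnorm (crea i) <= 1.
Proof. by apply: opnorm_le => // v; rewrite mul1r; exact: l2norm_pull. Qed.

Lemma opnorm_anni i : opnorm (anni i) <= 1.
Proof. by apply: opnorm_le => // v; rewrite mul1r; exact: l2norm_pull. Qed.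

Lemma opnorm_tailproj i : opnorm (tailproj R i) <= 1.
Proof.
apply: (le_trans (mon_normM _ _)).
rewrite -[leRHS]mul1r; apply: ler_pM; rewrite ?opnorm_ge0//.
  exact: opnorm_anni.
exact: opnorm_crea.
Qed.

Definition crea_sum (m : int) n : mon := \sum_(k < n) crea (m + k%:Z).
Definition anni_sum (m : int) n : mon := \sum_(k < n) anni (m + k%:Z).

Lemma crea_anni_sum_adjoint m n : is_adjoint (crea_sum m n) (anni_sum m n).
Proof.
elim: n => [|n IH].
  rewrite /crea_sum /anni_sum !big_ord0.
  exact: adjoint0.
rewrite /crea_sum /anni_sum !big_ord_recr /=.
have := adjointP 1 (adjoint_sym (@anni_crea_adjoint R (m + n%:Z))) IH.
by rewrite conjc1 !scale1r [X in is_adjoint X]addrC [X in is_adjoint _ X]addrC.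
Qed.

(** Distinct creators have orthogonal ranges, so the norms add up in square. *)
Lemma anni_sum_crea_sum m n : opnorm (anni_sum m n * crea_sum m n) <= n%:R.
Proof.
elim: n => [|n IH]; first by rewrite /crea_sum big_ord0 mulr0 opnorm0.
have ac : anni_sum m n * crea (m + n%:Z) = 0.
  rewrite mulr_suml big1// => k _; rewrite anni_crea_neq//.
  by apply/eqP => /addrI [] /eqP; rewrite ltn_eqF.
have ca : anni (m + n%:Z) * crea_sum m n = 0.
  rewrite mulr_sumr big1// => k _; rewrite anni_crea_neq//.
  by apply/eqP => /addrI [] /eqP; rewrite gtn_eqF.
have -> : anni_sum m n.+1 * crea_sum m n.+1 =
    anni_sum m n * crea_sum m n + tailproj R (m + n%:Z).
  rewrite {1}/anni_sum {1}/crea_sum !big_ord_recr /= mulrDl !mulrDr.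
  by rewrite -/(anni_sum m n) -/(crea_sum m n) ac ca addr0 add0r.
apply: (le_trans (mon_normD _ _)); rewrite -natr1; apply: lerD => //.
exact: opnorm_tailproj.
Qed.

Lemma opnorm_crea_sum m n : opnorm (crea_sum m n) ^+ 2 <= n%:R.
Proof. exact: le_trans (opnorm_sqr (crea_anni_sum_adjoint m n)) (anni_sum_crea_sum m n). Qed.

Lemma opnorm_anni_sum m n : opnorm (anni_sum m n) ^+ 2 <= n%:R.
Proof.
by rewrite (opnorm_adjoint (crea_anni_sum_adjoint m n)); exact: opnorm_crea_sum.
Qed.

(** The summands telescope: they project onto the sequences beginning with
    [m + k]. *)
Lemma opnorm_numop_sum m n :
  opnorm (\sum_(k < n) crea (m + k%:Z) * anni (m + k%:Z)) ^+ 2 <= 4 * n%:R.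
Proof.
case: n => [|n]; first by rewrite big_ord0 opnorm0 expr0n mulr0.
have -> : \sum_(k < n.+1) crea (m + k%:Z) * anni (m + k%:Z) =
    tailproj R (m - 1) - tailproj R (m + n%:Z).
  elim: n => [|n IH].
    by rewrite big_ord1 /= (addr0 m) tailproj_pred addrK.
  rewrite big_ord_recr IH /=.
  have -> : tailproj R (m + n%:Z) = crea (m + n.+1%:Z) * anni (m + n.+1%:Z) +
      tailproj R (m + n.+1%:Z).
    by rewrite -tailproj_pred; congr tailproj; lia.
  by rewrite opprD addrA addrAC subrK.
have o2 : opnorm (tailproj R (m - 1) - tailproj R (m + n%:Z)) <= 2.
  apply: (le_trans (mon_normB _ _)).
  by have := opnorm_tailproj (m - 1); have := opnorm_tailproj (m + n%:Z); lra.
apply: (@le_trans _ _ (2 ^+ 2)); first by rewrite ler_sqr ?nnegrE ?opnorm_ge0.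
by rewrite -[leLHS]mulr1 -natrX ler_wpM2l// ler1n.
Qed.

(** By linearity [phi] takes the value [n w] on the [n]-th sum, and by
    boundedness this value is at most of order [sqrt n]. *)
Lemma average_vanish (phi : mon -> C) (X : nat -> mon) (w : C) (K : R) :
  scalar phi -> bounded_functional phi -> (forall k, phi (X k) = w) ->
  (forall n, opnorm (\sum_(k < n) X k) ^+ 2 <= K * n%:R) -> w = 0.
Proof.
move=> sphi [c pc] Xw XK.
have sumE n : phi (\sum_(k < n) X k) = n%:R%:C * w.
  elim: n => [|n IH]; first by rewrite big_ord0 scalar_0// mul0r.
  by rewrite big_ord_recr /= scalar_D// IH Xw -natr1 rmorphD mulrDl rmorph1 mul1r.
have bound n : modsq w * n.+1%:R <= `|c| * K.
  have := pc (\sum_(k < n.+1) X k); rewrite sumE modsqM => h.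
  have n0 : 0 < n.+1%:R :> R by rewrite ltr0n.
  have e : modsq (n.+1%:R%:C : C) = n.+1%:R * n.+1%:R.
    by rewrite /modsq /= expr0n addr0 expr2.
  have h2 : c * opnorm (\sum_(k < n.+1) X k) ^+ 2 <= `|c| * (K * n.+1%:R).
    apply: (@le_trans _ _ (`|c| * opnorm (\sum_(k < n.+1) X k) ^+ 2)).
      by apply: ler_wpM2r; [exact: sqr_ge0|exact: ler_norm].
    by apply: ler_wpM2l.
  rewrite -(ler_pM2l n0); have := le_trans h h2; rewrite e.
  by congr (_ <= _); ring.
apply: modsq_eq0; apply/eqP; rewrite eq_le modsq_ge0 andbT leNgt; apply/negP => w0.
pose q := `|c| * K / modsq w; pose n := Num.bound `|q|.
have h : n.+1%:R <= q by rewrite ler_pdivlMr// mulrC; exact: bound.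
have := le_trans h (ler_norm _); rewrite leNgt => /negP; apply.
apply: (lt_trans (archi_boundP (normr_ge0 _))).
by rewrite -/n ltr_nat.
Qed.

End averaging.

Section invariant_states.
Variable R : realType.
Local Notation C := R[i].
Local Notation mon := (mon R).
Local Notation anni := (anni R).
Local Notation crea := (crea R).
Local Notation hamel := (hamel R).
Local Notation word := (word R).
Implicit Types I J L : seq int.

Lemma map_theta_below k L : all (fun i => i < k) L -> map (theta k) L = L.
Proof. by move=> /allP h; rewrite map_id_in// => i /h; rewrite /theta => ->. Qed.

Lemma theta_self k : theta k k = k + 1.
Proof. by rewrite /theta ltxx. Qed.

Lemma all_lt_le k l L : k <= l -> all (fun i => i < k) L -> all (fun i => i < l) L.
Proof. by move=> kl; apply: sub_all => i ik; exact: lt_le_trans ik kl. Qed.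

Section moving_top.
Variable phi : mon -> C.
Hypothesis phi_state : is_state phi.
Hypothesis phi_inv : spreading_invariant phi.

Lemma phi_scalar : scalar phi.
Proof. by have [] := phi_state. Qed.

Lemma phi_theta k I J : sorted <%R I -> sorted >%R J ->
  phi (hamel (map (theta k) I) (map (theta k) J)) = phi (hamel I J).
Proof.
move=> sI sJ; have [_ _ h] := beta_spec R k; rewrite -(h _ _ sI sJ).
exact: (congr1 (fun f => f (hamel I J)) (phi_inv (action_theta k (action_id R)))).
Qed.

Lemma le_addn (m : int) (k : nat) : m <= m + k%:Z.
Proof. by rewrite lerDl. Qed.

Lemma hamel_word_neq I J : I != J -> hamel I J = word I J.
Proof. by move=> IJ; apply: hamel_word => i [Ii Ji]; move: IJ; rewrite Ii Ji eqxx. Qed.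

Lemma opnorm_sandwich (A S B : mon) (c : R) : opnorm S ^+ 2 <= c ->
  opnorm (A * S * B) ^+ 2 <= (opnorm A * opnorm B) ^+ 2 * c.
Proof.
move=> Sc; apply: (@le_trans _ _ ((opnorm A * opnorm B) ^+ 2 * opnorm S ^+ 2)); last first.
  by apply: ler_wpM2l => //; exact: sqr_ge0.
rewrite -exprMn ler_sqr ?nnegrE ?opnorm_ge0 ?mulr_ge0 ?opnorm_ge0// mulrAC.
apply: (le_trans (mon_normM _ _)); apply: ler_wpM2r; first exact: opnorm_ge0.
exact: mon_normM.
Qed.

(** The partial shifts at [m], [m + 1], ... raise the top creator and fix all
    smaller indices, so the state takes one value on a sequence of words whose
    sums contain a sum of distinct creators. *)
Lemma vanish_left I J m : sorted <%R (rcons I m) -> sorted >%R J ->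
  all (fun j => j < m) J -> phi (word (rcons I m) J) = 0.
Proof.
rewrite sorted_rconsE => /andP[sI Im] sJ Jm.
have neq k : rcons I (m + k%:Z) != J.
  apply/eqP => e; have : m + k%:Z \in J by rewrite -e mem_rcons inE eqxx.
  by move=> /(allP Jm); rewrite ltNge le_addn.
pose X k := word (rcons I (m + k%:Z)) J.
have Xw k : phi (X k) = phi (word (rcons I m) J).
  elim: k => [|k <-]; first by rewrite /X addr0.
  rewrite /X -!hamel_word_neq//.
  have sIk : sorted <%R (rcons I (m + k%:Z)).
    by rewrite sorted_rconsE sI (all_lt_le (le_addn _ _) Im).
  rewrite -[RHS](phi_theta (m + k%:Z) sIk sJ) map_rcons theta_self.
  rewrite !map_theta_below ?(all_lt_le (le_addn _ _) Im) ?(all_lt_le (le_addn _ _) Jm)//.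
  by rewrite -addrA -PoszD addn1.
apply: (average_vanish phi_scalar (state_bounded phi_state) Xw
  (K := (opnorm (\prod_(i <- I) crea i) * opnorm (\prod_(j <- J) anni j)) ^+ 2)) => n.
have -> : \sum_(k < n) X k = (\prod_(i <- I) crea i) * crea_sum R m n * (\prod_(j <- J)
  anni j).
  by rewrite mulr_sumr mulr_suml; apply: eq_bigr => k _; rewrite /X /Defs.word big_rcons.
by apply: opnorm_sandwich; exact: opnorm_crea_sum.
Qed.

(** Here the top index occurs only as an annihilator, and it is raised as in
    [vanish_left]. *)
Lemma vanish_right I J m : sorted <%R I -> sorted >%R (m :: J) ->
  all (fun i => i < m) I -> phi (word I (m :: J)) = 0.
Proof.
rewrite sorted_consE => sI /andP[sJ Jm] Im.
have neq k : I != m + k%:Z :: J.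
  apply/eqP => e; have : m + k%:Z \in I by rewrite e inE eqxx.
  by move=> /(allP Im); rewrite ltNge le_addn.
pose X k := word I (m + k%:Z :: J).
have Xw k : phi (X k) = phi (word I (m :: J)).
  elim: k => [|k <-]; first by rewrite /X addr0.
  rewrite /X -!hamel_word_neq//.
  have sJk : sorted >%R (m + k%:Z :: J).
    by rewrite sorted_consE sJ (all_lt_le (le_addn _ _) Jm).
  rewrite -[RHS](phi_theta (m + k%:Z) sI sJk) map_cons theta_self.
  rewrite !map_theta_below ?(all_lt_le (le_addn _ _) Im) ?(all_lt_le (le_addn _ _) Jm)//.
  by rewrite -addrA -PoszD addn1.
apply: (average_vanish phi_scalar (state_bounded phi_state) Xw
  (K := (opnorm (\prod_(i <- I) crea i) * opnorm (\prod_(j <- J) anni j)) ^+ 2)) => n.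
have -> : \sum_(k < n) X k = (\prod_(i <- I) crea i) * anni_sum R m n * (\prod_(j <- J)
  anni j).
  rewrite mulr_sumr mulr_suml; apply: eq_bigr => k _.
  by rewrite /X /Defs.word big_cons mulrA.
by apply: opnorm_sandwich; exact: opnorm_anni_sum.
Qed.

(** Raising the common top index yields words whose sum is bounded, as the
    operators [a_k^+ a_k] are orthogonal projections. The case where [I] and [J]
    are both empty is excluded: then the Hamel basis contains [a_m a_m^+]
    instead of the word. *)
Lemma vanish_both I J m : sorted <%R (rcons I m) -> sorted >%R (m :: J) ->
  I ++ J != [::] -> phi (word (rcons I m) (m :: J)) = 0.
Proof.
rewrite sorted_rconsE sorted_consE => /andP[sI Im] /andP[sJ Jm] IJ.
pose X k := word (rcons I (m + k%:Z)) (m + k%:Z :: J).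
have XE k : X k = hamel (rcons I (m + k%:Z)) (m + k%:Z :: J).
  rewrite hamel_word// => i [Ii Ji]; move: IJ.
  case: Ji => _ ->; rewrite cats0.
  by move/(congr1 size): Ii; rewrite size_rcons => -[] /size0nil ->.
have Xw k : phi (X k) = phi (word (rcons I m) (m :: J)).
  elim: k => [|k <-]; first by rewrite /X addr0.
  rewrite !XE.
  have sIk : sorted <%R (rcons I (m + k%:Z)).
    by rewrite sorted_rconsE sI (all_lt_le (le_addn _ _) Im).
  have sJk : sorted >%R (m + k%:Z :: J).
    by rewrite sorted_consE sJ (all_lt_le (le_addn _ _) Jm).
  rewrite -[RHS](phi_theta (m + k%:Z) sIk sJk) map_rcons map_cons theta_self.
  rewrite !map_theta_below ?(all_lt_le (le_addn _ _) Im) ?(all_lt_le (le_addn _ _) Jm)//.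
  by rewrite -addrA -PoszD addn1.
apply: (average_vanish phi_scalar (state_bounded phi_state) Xw
  (K := (opnorm (\prod_(i <- I) crea i) * opnorm (\prod_(j <- J) anni j)) ^+ 2 * 4)) => n.
have -> : \sum_(k < n) X k = (\prod_(i <- I) crea i) *
    (\sum_(k < n) crea (m + k%:Z) * anni (m + k%:Z)) * (\prod_(j <- J) anni j).
  rewrite mulr_sumr mulr_suml; apply: eq_bigr => k _.
  by rewrite /X /Defs.word big_rcons big_cons /= !mulrA.
by rewrite -[leRHS]mulrA; apply: opnorm_sandwich; exact: opnorm_numop_sum.
Qed.

Lemma phi_tailproj i : phi (tailproj R i) = phi (tailproj R 0).
Proof.
have step k : phi (tailproj R (k + 1)) = phi (tailproj R k).
  have := @phi_theta k [:: k] [:: k] isT isT.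
  by rewrite /= !eqxx theta_self.
have stepn k (n : nat) : phi (tailproj R (k + n%:Z)) = phi (tailproj R k).
  by elim: n => [|n IH]; [rewrite addr0|rewrite -addn1 PoszD addrA step].
case: i => n; first by have := stepn 0 n; rewrite add0r.
by have := stepn (Negz n) n.+1; rewrite NegzE addNr => ->.
Qed.

Lemma state_hamel_val : has_hamel_val (phi (tailproj R 0)) phi.
Proof.
move=> I J sI sJ; rewrite /hamel_val.
case/lastP: I sI => [|I i] sI.
  case: J sJ => [|j J] sJ.
    by rewrite /= /Defs.word !big_nil mulr1; have [] := phi_state.
  by rewrite hamel_word_neq//= vanish_right.
rewrite {1}/nilp size_rcons /=.
case: J sJ => [|j J] sJ.
  rewrite hamel_word_neq ?vanish_left//; first by rewrite (_ :
    rcons I i == [::] = false) ?andbF//; case: (I).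
  by case: (I).
have := sJ; have := sI; rewrite sorted_rconsE sorted_consE => /andP[sI' Ii] /andP[sJ' Jj].
have [ij|ji|ij] := ltgtP i j.
- have al : all (fun k => k < j) (rcons I i).
    by rewrite all_rcons ij (all_lt_le (ltW ij) Ii).
  have ne : rcons I i != j :: J.
    apply/eqP => e; have : j \in rcons I i by rewrite e inE eqxx.
    by move=> /(allP al); rewrite ltxx.
  by rewrite hamel_word_neq// vanish_right// (negPf ne) andbF.
- have al : all (fun k => k < i) (j :: J).
    by rewrite /= ji (all_lt_le (ltW ji) Jj).
  have ne : rcons I i != j :: J.
    apply/eqP => e; have : i \in j :: J by rewrite -e mem_rcons inE eqxx.
    by move=> /(allP al); rewrite ltxx.
  by rewrite hamel_word_neq// vanish_left// (negPf ne) andbF.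
rewrite -ij in sJ *.
have [IJ|IJ] := eqVneq (I ++ J) [::].
  have -> : I = [::] by case: (I) IJ.
  have -> : J = [::] by case: (I) IJ => //=.
  by rewrite [rcons _ _]/= hamel1 /= eqxx phi_tailproj.
rewrite hamel_word; last first.
  move=> k [/(congr1 size)]; rewrite size_rcons => -[] /size0nil I0 [_ J0].
  by rewrite I0 J0 in IJ.
rewrite vanish_both//; case: ifP => // /andP[/eqP[/size0nil I0] /eqP].
by rewrite I0 => -[J0]; rewrite I0 -J0 in IJ.
Qed.

(** The value lies in [[0, 1]] because the projection and its complement are of
    the form [Y^* Y]. *)
Lemma state_tailproj : exists2 x : R, 0 <= x <= 1 & phi (tailproj R 0) = x%:C.
Proof.
have [sphi phi1 pos] := phi_state.
have h0 := pos (crea 0) (anni 0) (adjoint_sym (@anni_crea_adjoint R 0)).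
have aP : is_adjoint (tailproj R 0) (tailproj R 0).
  exact: (adjointM (@anni_crea_adjoint R 0) (adjoint_sym (@anni_crea_adjoint R 0))).
have h1 := pos (1 - tailproj R 0) (1 - tailproj R 0) (adjointB (@adjoint1 R) aP).
move: h1; rewrite mulrBr mulr1 mulrBl mul1r tailprojM// subrr subr0 scalarB// phi1.
move: h0; rewrite anni_crea; case: (phi _) => a b.
rewrite !lecE /= => /andP[/eqP b0 a0] /andP[_ a1].
by exists a; [rewrite a0; lra|rewrite b0].
Qed.

End moving_top.
End invariant_states.

(** * The vacuum state and the state at infinity *)

Section two_states.
Variable R : realType.
Local Notation C := R[i].
Local Notation mon := (mon R).
Local Notation anni := (anni R).
Local Notation crea := (crea R).
Local Notation words := (@words R).
Local Notation frakA := (@frakA R).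
Local Notation omega := (@omega R).
Local Notation omega_inf := (@omega_inf R).

Lemma coef_ge0 s (X Xs : bop R) : is_adjoint X Xs -> 0 <= coef s (Xs * X).
Proof.
move=> h; rewrite /coef -[X in 0 <= X](inner_delta ((Xs * X) (basis R s)) s).
rewrite (_ : inner _ _ = inner (X (basis R s)) (X (basis R s))); first exact: inner_self_ge0.
exact: (adjoint_sym h).
Qed.

Lemma coef1 s : coef s (1 : bop R) = 1.
Proof. by rewrite -[LHS]/(basis R s s) basisE eqxx. Qed.

Lemma coef_unit s (c : C) : coef s (c%:A : mon) = c.
Proof. by rewrite -[LHS]/(c * coef s (1 : bop R)) coef1 mulr1. Qed.

Lemma coefD s (X Y : mon) : coef s (X + Y) = coef s X + coef s Y.
Proof. by []. Qed.

Lemma coefB s (X Y : mon) : coef s (X - Y) = coef s X - coef s Y.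
Proof. by []. Qed.

Lemma coef_split s (Z Y : mon) (c : C) :
  coef s (Z - (Y + c%:A)) = coef s Z - (coef s Y + c).
Proof. by rewrite (coefB s Z (Y + c%:A)) (coefD s Y (c%:A)) coef_unit. Qed.

Lemma omegaE (Y : mon) : omega Y = coef vac Y.
Proof. exact: inner_delta. Qed.

Lemma omega_scalar : scalar omega.
Proof. by move=> a X Y; rewrite !omegaE. Qed.

Lemma omega_bounded : bounded_functional omega.
Proof. by exists 1 => X; rewrite mul1r omegaE; exact: modsq_coef. Qed.

Lemma omega_state : is_state omega.
Proof.
split; first exact: omega_scalar.
  by rewrite omegaE; exact: coef1.
by move=> X Xs h; rewrite omegaE; exact: coef_ge0.
Qed.

Lemma hamel_val_neq (x : C) I J : (forall i, ~ (I = [:: i] /\ J = [:: i])) ->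
  hamel_val x I J = (nilp I && nilp J)%:R.
Proof.
rewrite /hamel_val => h; case: ifP => // _; case: ifP => // /andP[I1 /eqP IJ].
by case: I I1 h IJ => [|i [|? ?]] //= _ h IJ; case: (h i).
Qed.

Lemma omega_hamel_val : has_hamel_val 1 omega.
Proof.
move=> I J sI sJ; rewrite omegaE.
have [[i [-> ->]]|nIJ] := pselect (exists i, I = [:: i] /\ J = [:: i]).
  by rewrite hamel1 coef_tailproj /hamel_val /= eqxx.
have h i : ~ (I = [:: i] /\ J = [:: i]) by move=> e; apply: nIJ; exists i.
by rewrite hamel_word// hamel_val_neq// coef_word_vac.
Qed.

(** The vector [e_n] has only the index [n], so for [n] below all indices of the
    word it is killed or mapped to an orthogonal vector. *)
Lemma words_coef0 X : words X ->
  exists N : int, forall n, n < N -> coef (sng n) X = 0.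
Proof.
have small (I : seq int) : exists N : int, all (fun i => N <= i) I.
  elim: I => [|i I [N IN]]; first by exists 0.
  exists (Num.min i N); rewrite /= ge_min lexx /=.
  by apply: sub_all IN => j; apply: le_trans; rewrite ge_min lexx orbT.
have crea0 (I : seq int) (N n : int) (w : fock R) : I != [::] -> all (fun i =>
  N <= i) I -> n < N ->
    (\prod_(i <- I) crea i) w (sng n) = 0.
  case: I => // i I _ /= /andP[Ni _] nN; rewrite prod_crea_cons//=.
  by rewrite (inj_eq Some_inj) lt_eqF// (lt_le_trans nN Ni).
have anni0 (J : seq int) (N n : int) : J != [::] -> all (fun i => N <= i) J -> n < N ->
    (\prod_(i <- J) anni i) (basis R (sng n)) = 0.
  case/lastP: J => // J j _; rewrite all_rcons => /andP[Nj _] nN.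
  by rewrite prod_anni_rcons//= (inj_eq Some_inj) lt_eqF// (lt_le_trans nN Nj).
move=> [[I [J [_ _ IJ ->]]]|[I [k [J [_ _ ->]]]]].
  have [N] := small (I ++ J); rewrite all_cat => /andP[NI NJ]; exists N => n nN.
  rewrite /coef /word.
  rewrite -[LHS]/((\prod_(j <- I) crea j) ((\prod_(j <- J) anni j) (basis R (sng n))) (sng n)).
  have [I0|I0] := eqVneq I [::]; last exact: crea0 NI nN.
  rewrite (anni0 J N n)// ?linear0//.
  by move: IJ; rewrite I0 add0n lt0n size_eq0.
have [N] := small (k :: I ++ J); rewrite /= all_cat => /and3P[Nk NI NJ].
exists N => n nN; rewrite /coef.
rewrite -[LHS]/((\prod_(j <- I) crea j) (tailproj R k ((\prod_(j <- J) anni j) (basis R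
  (sng n)))) (sng n)).
have [->|I0] := eqVneq I [::]; last exact: crea0 NI nN.
have [->|J0] := eqVneq J [::]; last by rewrite (anni0 J N n)// !linear0.
rewrite !big_nil -[LHS]/(tailproj R k (basis R (sng n)) (sng n)) tailprojE /= andbT.
by rewrite ltNge (ltW (lt_le_trans nN Nk)).
Qed.

Lemma span_words_coef0 X : linspan words X ->
  exists N : int, forall n, n < N -> coef (sng n) X = 0.
Proof.
move: X; apply: linspan_ind.
- by exists 0 => n _.
- move=> k X Y [N hN] [M hM]; exists (Num.min N M) => n; rewrite lt_min => /andP[nN nM].
  by rewrite -[LHS]/(k * coef (sng n) X + coef (sng n) Y) hN// hM// mulr0 addr0.
- exact: words_coef0.
Qed.

Lemma hamel_words I J : sorted <%R I -> sorted >%R J ->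
  ~~ (nilp I && nilp J) -> words (hamel R I J).
Proof.
move=> sI sJ IJ.
have [[i [-> ->]]|nIJ] := pselect (exists i, I = [:: i] /\ J = [:: i]).
  right; exists [::], i, [::]; split => //.
  by rewrite hamel1 !big_nil mul1r mulr1.
have h i : ~ (I = [:: i] /\ J = [:: i]) by move=> e; apply: nIJ; exists i.
left; exists I, J; split => //; last exact: hamel_word.
by move: IJ; rewrite /nilp -addn_eq0 lt0n.
Qed.

Lemma frakA_span X : linspan words X -> frakA X.
Proof.
move=> hX e e0; exists X => //.
by rewrite subrr (_ : opnorm _ = 0)//; exact: opnorm0.
Qed.

Lemma frakA_linear (k : C) X Y : frakA X -> frakA Y -> frakA (k *: X + Y).
Proof.
move=> hX hY e e0; pose d := Num.sqrt (modsq k) + 1.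
have d0 : 0 < d by rewrite ltr_wpDl ?sqrtr_ge0.
have e2 : 0 < e / 2 by rewrite divr_gt0.
have [X' sX XX] := hX (e / 2 / d) (divr_gt0 e2 d0).
have [Y' sY YY] := hY (e / 2) e2.
exists (k *: X' + Y'); first exact: linspanP.
have -> : k *: X + Y - (k *: X' + Y') = k *: (X - X') + (Y - Y').
  by rewrite scalerBr opprD addrACA.
apply: (le_lt_trans (mon_normD _ _)).
have h : opnorm (k *: (X - X')) <= e / 2.
  apply: (le_trans (mon_normZ _ _)); have o0 := opnorm_ge0 (X - X').
  move: (opnorm (X - X')) o0 XX => o o0 /ltW oe.
  apply: (@le_trans _ _ (d * o)); first by apply: ler_wpM2r => //; rewrite /d lerDl.
  by rewrite mulrC -ler_pdivlMr.
lra.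
Qed.

(** Along [n -> -oo] the vector states at [e_n] converge to zero on [frakA];
    since they are one on the identity, they single out the scalar part of an
    element of the algebra. *)
Lemma frakA_lim X (e : R) : frakA X -> 0 < e ->
  exists N : int, forall n, n < N -> modsq (coef (sng n) X) <= e.
Proof.
move=> hX e0; pose d := Num.min 1 e.
have d0 : 0 < d by rewrite lt_min ltr01.
have [Y sY XY] := hX d d0; have [N hN] := span_words_coef0 sY; exists N => n nN.
have -> : coef (sng n) X = coef (sng n) (X - Y) by rewrite coefB (hN n nN) subr0.
apply: (le_trans (modsq_coef _ _)).
have o0 := opnorm_ge0 (X - Y).
have d1 : d <= 1 by rewrite ge_min lexx.
have de : d <= e by rewrite ge_min lexx orbT.
apply: (@le_trans _ _ (opnorm (X - Y) * 1)).
  by rewrite expr2; apply: ler_wpM2l => //; exact: le_trans (ltW XY) d1.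
by rewrite mulr1; exact: le_trans (ltW XY) de.
Qed.

Lemma frakA_unit_uniq X Y (c d : C) : frakA X -> frakA Y ->
  X + c%:A = Y + d%:A -> c = d.
Proof.
move=> hX hY e; apply/eqP; rewrite -subr_eq0; apply/eqP/modsq_eq0/eqP.
rewrite eq_le modsq_ge0 andbT; apply/ler_addgt0Pr => r r0; rewrite add0r.
have r4 : 0 < r / 4 by rewrite divr_gt0.
have [N hN] := frakA_lim hX r4; have [M hM] := frakA_lim hY r4.
pose n := Num.min N M - 1.
have nNM : n < Num.min N M by rewrite /n; lia.
have := nNM; rewrite lt_min => /andP[/hN h1 /hM h2].
have -> : c - d = coef (sng n) Y + - coef (sng n) X.
  have := congr1 (fun Z : mon => coef (sng n) Z) e.
  rewrite (coefD _ X (c%:A)) (coefD _ Y (d%:A)) !coef_unit.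
  move: (coef _ X) (coef _ Y) => x y E.
  by apply/eqP; rewrite subr_eq addrAC -E addrAC subrr add0r.
by apply: (le_trans (modsqD2 _ _)); rewrite modsqN; lra.
Qed.

Lemma opnorm_unit (c : C) : opnorm (c%:A : mon) <= Num.sqrt (modsq c).
Proof.
apply: (le_trans (opnormZ_le _ _)); rewrite -[leRHS]mulr1.
by apply: ler_wpM2l; [exact: sqrtr_ge0|exact: opnorm1_le].
Qed.

Lemma span_hamels_split Z : linspan (@hamels R) Z ->
  exists Y c, linspan words Y /\ Z = Y + c%:A.
Proof.
move: Z; apply: linspan_ind.
- by exists 0, 0; split; [exact: linspan0|rewrite scale0r addr0].
- move=> k X X' [Y [c [sY ->]]] [Y' [c' [sY' ->]]].
  exists (k *: Y + Y'), (k * c + c'); split; first exact: linspanP.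
  by rewrite scalerDr scalerA addrACA -scalerDl.
- move=> _ [I [J [sI sJ ->]]].
  have [|nIJ] := boolP (nilp I && nilp J).
    move=> /andP[/nilP -> /nilP ->]; exists 0, 1; split; first exact: linspan0.
    by rewrite add0r scale1r /hamel /word !big_nil mulr1.
  exists (hamel R I J), 0; split; last by rewrite scale0r addr0.
  by apply: linspan_sub; exact: hamel_words.
Qed.

Lemma modsq_small (z : C) (r : R) : 0 <= r ->
  `|complex.Re z| <= r -> `|complex.Im z| <= r -> Num.sqrt (modsq z) <= 2 * r.
Proof.
move=> r0; case: z => a b /= ha hb.
have r2 : 0 <= 2 * r by rewrite mulr_ge0.
rewrite -(ger0_norm r2) -sqrtr_sqr; apply: ler_wsqrtr.
have sq (x : R) : `|x| <= r -> x ^+ 2 <= r ^+ 2.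
  by move=> hx; rewrite -(real_normK (num_real x)) ler_sqr ?nnegrE ?normr_ge0.
have := sq _ ha; have := sq _ hb; rewrite /modsq /=.
have := sqr_ge0 r; have -> : (2 * r) ^+ 2 = 4 * r ^+ 2 by ring.
lra.
Qed.

Lemma modsq_le_norm (z : C) (r : R) : 0 <= r -> modsq z <= r ^+ 2 ->
  `|complex.Re z| <= r /\ `|complex.Im z| <= r.
Proof.
move=> r0; case: z => a b; rewrite /modsq /= => h.
have sq (x : R) : x ^+ 2 <= r ^+ 2 -> `|x| <= r.
  by rewrite -(real_normK (num_real x)) ler_sqr ?nnegrE ?normr_ge0.
by split; apply: sq; apply: le_trans h; rewrite ?lerDl ?lerDr sqr_ge0.
Qed.

(** The scalar parts of a sequence of approximants in the span form a Cauchy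
    sequence, because they are recovered by vector states. The remainder is then
    within [2^-n + 2 (2 * 2) 2^-n = 9 * 2^-n] of the span of the words. *)
Lemma mon_split (Z : mon) : exists X c, frakA X /\ Z = X + c%:A.
Proof.
have /choice[Yc YcP] : forall n, exists Yc : mon * C, linspan words Yc.1 /\
    opnorm (Z - (Yc.1 + Yc.2%:A)) <= 2^-1 ^+ n.
  move=> n; have [W sW ZW] := hamels_dense Z (half_gt0 R n).
  have [Y [c [sY WE]]] := span_hamels_split sW.
  by exists (Y, c); split => //; move: (ltW ZW); rewrite WE.
pose Y n := (Yc n).1; pose c n := (Yc n).2.
have cS n : `|complex.Re (c n.+1) - complex.Re (c n)| <= 2 * 2^-1 ^+ n /\
    `|complex.Im (c n.+1) - complex.Im (c n)| <= 2 * 2^-1 ^+ n.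
  have [s1 d1] := YcP n.+1; have [s0 d0] := YcP n.
  have [N hN] := span_words_coef0 s1; have [M hM] := span_words_coef0 s0.
  pose k := Num.min N M - 1.
  have kNM : k < Num.min N M by rewrite /k; lia.
  have := kNM; rewrite lt_min => /andP[/hN h1 /hM h0].
  pose D := (Z - ((Yc n).1 + (Yc n).2%:A)) - (Z - ((Yc n.+1).1 + (Yc n.+1).2%:A)).
  have DE : coef (sng k) D = c n.+1 - c n.
    rewrite /D (coefB (sng k) (Z - _) (Z - _)) !coef_split h0 h1 /c.
    by move: (coef _ _) => z; ring.
  have oD : opnorm D <= 2 * 2^-1 ^+ n.
    exact: le_trans (le_trans (mon_normB _ _) (lerD d0 d1)) (half_add R n).
  have h2 : 0 <= 2 * 2^-1 ^+ n :> R by rewrite mulr_ge0// half_ge0.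
  have : modsq (coef (sng k) D) <= (2 * 2^-1 ^+ n) ^+ 2.
    apply: (le_trans (modsq_coef _ _)).
    by rewrite ler_sqr ?nnegrE ?opnorm_ge0.
  rewrite DE => /(modsq_le_norm h2).
  by case: (c n.+1) (c n) => [? ?] [? ?].
have [a aP] := real_geometric_cvg (fun n => (cS n).1).
have [b bP] := real_geometric_cvg (fun n => (cS n).2).
exists (Z - (a +i* b)%:A), (a +i* b); split; last by rewrite subrK.
move=> e e0; have e2 : 0 < e / 2 by rewrite divr_gt0.
have [n _ hn] := geometric_small 9 0 e2.
exists (Y n); first exact: (YcP n).1.
have -> : Z - (a +i* b)%:A - Y n = (Z - (Y n + (c n)%:A)) - ((a +i* b) - c n)%:A.
  have gen (V : zmodType) (z p q y : V) : z - p - y = z - (y + q) - (p - q).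
    by rewrite opprB opprD !addrA subrK addrAC.
  by rewrite scalerBl; exact: gen.
apply: (le_lt_trans (mon_normB _ _)).
have h1 : opnorm (((a +i* b) - c n)%:A : mon) <= 2 * (2 * 2 * 2^-1 ^+ n).
  apply: (le_trans (opnorm_unit _)); apply: modsq_small.
  - by rewrite !mulr_ge0// half_ge0.
  - by have := aP n; case: (c n).
  - by have := bP n; case: (c n).
have := (YcP n).2; rewrite -/(Y n) -/(c n); lra.
Qed.

Lemma omega_infP (Z : mon) : exists2 X, frakA X & Z = X + (omega_inf Z)%:A.
Proof.
have [X [c [hX ZE]]] := mon_split Z.
exact: (@xgetPex C 0 [set c | exists2 X, frakA X & Z = X + c%:A] (ex_intro _ c (ex_intro2 _
  _ X hX ZE))).
Qed.

Lemma omega_inf_eq X (c : C) : frakA X -> omega_inf (X + c%:A) = c.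
Proof. by move=> hX; have [Y hY /esym e] := omega_infP (X + c%:A); exact:
  frakA_unit_uniq hY hX e. Qed.

Lemma omega_inf_scalar : scalar omega_inf.
Proof.
move=> k X Y; have [X' hX eX] := omega_infP X; have [Y' hY eY] := omega_infP Y.
rewrite {1}eX {1}eY.
have -> : k *: (X' + (omega_inf X)%:A) + (Y' + (omega_inf Y)%:A) =
    (k *: X' + Y') + (k * omega_inf X + omega_inf Y)%:A.
  by rewrite scalerDr scalerA addrACA -scalerDl.
by apply: omega_inf_eq; exact: frakA_linear.
Qed.

Lemma omega_inf_lim (Z : mon) (e : R) : 0 < e -> exists n,
  modsq (coef (sng n) Z - omega_inf Z) <= e.
Proof.
move=> e0; have [X hX eX] := omega_infP Z; have [N hN] := frakA_lim hX e0.
exists (N - 1); rewrite {1}eX coefD coef_unit addrK; apply: hN; lia.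
Qed.

Lemma omega_inf_bounded : bounded_functional omega_inf.
Proof.
exists 2 => X; apply/ler_addgt0Pr => e e0.
have e2 : 0 < e / 2 by rewrite divr_gt0.
have [n hn] := omega_inf_lim X e2.
have -> : omega_inf X = coef (sng n) X + - (coef (sng n) X - omega_inf X).
  by rewrite opprB addrC subrK.
apply: (le_trans (modsqD2 _ _)); rewrite modsqN.
have := modsq_coef (sng n) X; lra.
Qed.

(** Positivity passes to the limit from the vector states at [e_n]. *)
Lemma omega_inf_state : is_state omega_inf.
Proof.
split; first exact: omega_inf_scalar.
  have := @omega_inf_eq 0 1 (frakA_span (@linspan0 R words)).
  by rewrite scale1r add0r.
move=> X Xs h.
have lim (e : R) : 0 < e -> exists2 z : C, 0 <= z & modsq (z - omega_inf (Xs * X)) <= e.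
  move=> e0; have [n hn] := omega_inf_lim (Xs * X) e0.
  by exists (coef (sng n) (Xs * X)) => //; exact: coef_ge0.
case: (omega_inf _) lim => a b lim; rewrite lecE /=; apply/andP; split.
  rewrite -sqrf_eq0 eq_le sqr_ge0 andbT; apply/ler_addgt0Pr => e e0; rewrite add0r.
  have [[p q]] := lim e e0; rewrite lecE /modsq /= => /andP[/eqP -> _].
  by rewrite sub0r sqrrN; have := sqr_ge0 (p - a); lra.
rewrite leNgt; apply/negP => a0.
have a2 : 0 < a ^+ 2 / 2 by rewrite divr_gt0// exprn_even_gt0//= lt_eqF.
have [[p q]] := lim _ a2; rewrite lecE /modsq /= => /andP[_ p0] h2.
have : a ^+ 2 <= (p - a) ^+ 2 by nra.
by have := sqr_ge0 (q - b); lra.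
Qed.

Lemma omega_inf_hamel_val : has_hamel_val 0 omega_inf.
Proof.
move=> I J sI sJ; have [|nIJ] := boolP (nilp I && nilp J).
  move=> /andP[/nilP -> /nilP ->]; rewrite /hamel_val /=.
  have [_ <- _] := omega_inf_state; congr omega_inf.
  by rewrite /hamel /word !big_nil mulr1.
rewrite /hamel_val (negPf nIJ) if_same.
have := @omega_inf_eq (hamel R I J) 0; rewrite scale0r addr0; apply.
by apply: frakA_span; apply: linspan_sub; exact: hamel_words.
Qed.

End two_states.

(** * The segment of invariant states *)

Section segment.
Variable R : realType.
Local Notation C := R[i].
Local Notation mon := (mon R).

Definition mixture (x : R) : mon -> C :=
  fun X => (1 - x)%:C * omega_inf X + x%:C * omega X.

Lemma mixture_scalar x : scalar (mixture x).
Proof.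
move=> a X Y; rewrite /mixture omega_inf_scalar omega_scalar.
by move: (omega_inf X) (omega_inf Y) (omega X) (omega Y) => p q r s; ring.
Qed.

Lemma mixture_bounded x : bounded_functional (mixture x).
Proof.
have [c hc] := @omega_inf_bounded R; have [d hd] := @omega_bounded R.
exists (2 * (modsq (1 - x)%:C * c) + 2 * (modsq x%:C * d)) => X.
apply: (le_trans (modsqD2 _ _)).
rewrite (modsqM _ (omega_inf X)) (modsqM _ (omega X)).
have h1 := ler_wpM2l (modsq_ge0 (1 - x)%:C) (hc X).
have h2 := ler_wpM2l (modsq_ge0 x%:C) (hd X).
have -> : (2 * (modsq (1 - x)%:C * c) + 2 * (modsq x%:C * d)) * opnorm X ^+ 2 =
    2 * (modsq (1 - x)%:C * (c * opnorm X ^+ 2)) +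
    2 * (modsq x%:C * (d * opnorm X ^+ 2)) by ring.
by apply: lerD; apply: ler_wpM2l.
Qed.

Lemma mixture_state x : 0 <= x <= 1 -> is_state (mixture x).
Proof.
move=> /andP[x0 x1]; have [_ i1 ip] := @omega_inf_state R; have [_ o1 op] := @omega_state R.
split; first exact: mixture_scalar.
  by rewrite /mixture i1 o1 !mulr1 -rmorphD /= subrK.
move=> X Xs h; rewrite /mixture addr_ge0// mulr_ge0 ?ip ?op ?ler0c ?subr_ge0//.
Qed.

Lemma mixture_hamel_val x : has_hamel_val x%:C (mixture x).
Proof.
move=> I J sI sJ; rewrite /mixture (@omega_inf_hamel_val R I J sI sJ) (@omega_hamel_val R I
  J sI sJ).
rewrite /hamel_val; case: ifP => _; first by rewrite !mulr1 -rmorphD /= subrK.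
by case: ifP => _; rewrite !mulr0 ?add0r ?mulr1.
Qed.

Lemma mixture_spreading x : 0 <= x <= 1 -> spreading_states (mixture x).
Proof.
move=> x01; split; first exact: mixture_state.
exact: hamel_val_invariant (mixture_scalar x) (mixture_bounded x) (@mixture_hamel_val x).
Qed.

(** Both sides are bounded and have the same values on the Hamel words. *)
Lemma spreading_mixture (phi : mon -> C) : spreading_states phi ->
  exists2 x, 0 <= x <= 1 & phi = mixture x.
Proof.
move=> [st inv]; have [x x01 xE] := state_tailproj st; exists x => //.
apply: functional_ext.
- by have [] := st.
- exact: mixture_scalar.
- exact: state_bounded.
- exact: mixture_bounded.
- move=> I J sI sJ.
  by rewrite (state_hamel_val st inv sI sJ) (mixture_hamel_val x sI sJ) xE.
Qed.

Lemma affine_continuous (a b : C) :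
  continuous (fun x : R => ((1 - x)%:C * a + x%:C * b : C^o)).
Proof.
move=> x0; apply/cvgrPdist_lt => e e0.
pose m := complex.Re `|a - b| + 1.
have nE : `|a - b| = (complex.Re `|a - b|)%:C.
  by rewrite RRe_real// ger0_real.
have m0 : 0 < m.
  rewrite ltr_wpDl//; have := normr_ge0 (a - b); by rewrite nE ler0c.
have e0' : 0 < complex.Re e by move: e0; rewrite ltcE => /andP[].
have eE : e = (complex.Re e)%:C by rewrite RRe_real// gtr0_real.
near=> x.
have -> : (1 - x0)%:C * a + x0%:C * b - ((1 - x)%:C * a + x%:C * b) = (x - x0)%:C * (a - b).
  by rewrite !rmorphB /=; ring.
rewrite normrM normc_def /= expr0n addr0 sqrtr_sqr nE eE -rmorphM ltcR.
apply: (@le_lt_trans _ _ (`|x - x0| * m)).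
  by apply: ler_wpM2l => //; rewrite lerDl.
rewrite -ltr_pdivlMr// distrC.
near: x; apply: cvgr_dist_lt; last by rewrite divr_gt0.
exact: cvg_id.
Unshelve. all: by end_near.
Qed.

Lemma mixture_continuous :
  continuous (mixture : R -> {ptws mon -> R[i]^o}).
Proof.
move=> x0; apply/cvg_sup => X U [V] [[W] oW <-] Wx WU.
apply: (filterS WU).
have := @affine_continuous (omega_inf X) (omega X) x0 W.
apply; apply: open_nbhs_nbhs; split; [exact: oW|exact: Wx].
Qed.

End segment.

Theorem proposition4p5 (R : realType) :
  compact (@spreading_states R : set {ptws mon R -> R[i]^o}) /\
  @spreading_states R =
    [set phi | exists x : R, 0 <= x <= 1 /\
       phi = fun X => (1 - x)%:C * omega_inf X + x%:C * omega X].
Proof.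
have E : @spreading_states R = [set phi | exists x : R, 0 <= x <= 1 /\
    phi = fun X => (1 - x)%:C * omega_inf X + x%:C * omega X].
  apply/seteqP; split=> [phi /spreading_mixture[x x01 ->]|phi [x [x01 ->]]].
    by exists x.
  exact: mixture_spreading.
split=> //.
have -> : @spreading_states R = (@mixture R : R -> {ptws mon R -> R[i]^o}) @` `[0, 1]%classic.
  rewrite E; apply/seteqP; split=> [_ [x [x01 ->]]|_ [x /= x01 <-]].
    by exists x => //=; rewrite in_itv.
  by exists x; move: x01; rewrite in_itv.
apply: continuous_compact; last exact: segment_compact.
apply: continuous_subspaceT; exact: mixture_continuous.
Qed.
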